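(* Let $f\in L^2(\Omega)$ and $g\in L^2(\Gamma;\mu)$. Let $u\in V$ be the weak solution, i.e. $a^e(u,v)=(f,v)+\langle g,v\rangle$ for all $v\in V$ (so that $u\in V_*$). Let all penalty parameters be equal, $\alpha_F=\alpha$ for all $F\in\mathcal F^{vi}$, with $\alpha\ge\frac12+C_{dt}(k_z)$, and let $u_h\in V_h$ satisfy $a_h(u_h,v_h)=(f,v_h)+\langle g,v_h\rangle$ for all $v_h\in V_h$. Then $$\|u-u_h\|_{V_h}\le\big(1+2(C_{dt}(k_z)+\alpha)\big)\inf_{v_h\in V_h}\|u-v_h\|_*.$$
   Context: $L>0$, $\Omega=(0,L)\times(0,1)$ with coordinates $(z,\mu)$, $\Gamma=\{0,L\}\times(0,1)$; $\langle u,v\rangle=\int_0^1(u(L,\mu)v(L,\mu)+u(0,\mu)v(0,\mu))\mu\,d\mu$, $L^2(\Gamma;\mu)$ the space of $g$ with $\langle g,g\rangle<\infty$; $(\cdot,\cdot)$ is the $L^2(\Omega)$ inner product. $V=\{v\in L^2(\Omega):\mu\partial_z v\in L^2(\Omega)\}$, $V_*=\{u\in V:\frac{\mu}{\sigma_t}\partial_zu\in V\}$. Coefficients $\sigma_s,\sigma_t\in L^\infty(0,L)$ depend on $z$ only, $\sigma_s\ge0$, $\sigma_t-\sigma_s\ge c>0$. $(Pu)(z,\mu)=\int_0^1u(z,\mu')d\mu'$. $a^e(u,v)=(\sigma_t^{-1}\mu\partial_zu,\mu\partial_zv)+(\sigma_tu,v)-(\sigma_sPu,v)+\langle u,v\rangle$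 on $V\times V$. $\mathcal T$ is a finite partition of $\Omega$ into open rectangles $K=(z_K^l,z_K^r)\times(\mu_K^l,\mu_K^r)$ (hanging nodes allowed) with $\sigma_t$ constant on each $K$; $h_K=z_K^r-z_K^l$. For integers $k_z,k_\mu\ge0$, $V_h=\{v\in L^2(\Omega):v|_K\in\mathbb P_{k_z+1}\otimes\mathbb P_{k_\mu}\ \forall K\}$, $V(h)=V+V_h$, $V_{*h}=V_*+V_h$; $\partial_z^h$ is the broken $z$-derivative. Interior vertical faces $F\in\mathcal F^{vi}$: $F=\{z_F\}\times(\mu_F^b,\mu_F^t)$ where two distinct elements $K_1,K_2$ satisfy $z_F=z_1^r=z_2^l$ and $(\mu_F^b,\mu_F^t)=(\mu_1^l,\mu_1^r)\cap(\mu_2^l,\mu_2^r)\ne\emptyset$. Jump $[\![v]\!]=v|_{K_1}(z_F,\cdot)-v|_{K_2}(z_F,\cdot)$, average $\{\!\{v\}\!\}=\frac12(v|_{K_1}(z_F,\cdot)+v|_{K_2}(z_F,\cdot))$ (one-sided traces); $\|w\|^2_{L^2(F;\mu)}=\int_F|w|^2\mu\,d\mu$; $D_{F,\sigma}=\big(\frac{1}{\sigma_t|_{K_1}h_{K_1}}+\frac{1}{\sigma_t|_{K_2}h_{K_2}}\big)^{-1}$. $C_{dt}(k)=1+2\sqrt{C_{ie}(k)}$ with $C_{ie}(k)$ the scale-invariant inverse-inequality constant $\|p'\|_{L^2(I)}\le\frac{\sqrt{C_{ie}(k)}}{|I|}\|p\|_{L^2(I)}$ for all intervals $I$ and polynomials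 $p$ of degree $\le k$. $a_h^e(u,v)=(\sigma_t^{-1}\mu\partial_z^hu,\mu\partial_z^hv)+(\sigma_tu,v)-(\sigma_sPu,v)+\langle u,v\rangle$ and $a_h(u,v)=a_h^e(u,v)-\sum_{F\in\mathcal F^{vi}}\int_F\big(\{\!\{\tfrac{\mu}{\sigma_t}\partial_z^hu\}\!\}[\![v]\!]+\{\!\{\tfrac{\mu}{\sigma_t}\partial_z^hv\}\!\}[\![u]\!]\big)\mu\,d\mu+\sum_{F\in\mathcal F^{vi}}\frac{\alpha_F}{D_{F,\sigma}}\int_F[\![u]\!][\![v]\!]\mu\,d\mu$. Norms: $\|v\|_{V_h}^2=a_h^e(v,v)+\sum_{F\in\mathcal F^{vi}}D_{F,\sigma}^{-1}\|[\![v]\!]\|^2_{L^2(F;\mu)}$ for $v\in V(h)$, and $\|v\|_*^2=\|v\|_{V_h}^2+\sum_{F\in\mathcal F^{vi}}\frac{D_{F,\sigma}}{C_{dt}(k_z)}\|\{\!\{\tfrac{\mu}{\sigma_t}\partial_z^hv\}\!\}\|^2_{L^2(F;\mu)}$ for $v\in V_{*h}$. *)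

(* Defs.v *)
From HB Require Import structures.
From mathcomp Require Import all_boot all_order all_algebra.
From mathcomp Require Import all_classical all_reals all_analysis.
Unset Printing Implicit Defensive.
Import Order.TTheory GRing.Theory Num.Theory.
Import numFieldNormedType.Exports.
Local Open Scope classical_set_scope.
Local Open Scope ring_scope.

Section DGDefs.
Variable R : realType.
Local Notation mu := (@lebesgue_measure R).

Definition lam2 := (mu \x mu)%E.

Definition int2 (D : set (R * R)) (f : R * R -> R) : R :=
  fine (\int[lam2]_(x in D) (f x)%:E)%E.
Definition int1 (a b : R) (f : R -> R) : R :=
  fine (\int[mu]_(x in `]a, b[) (f x)%:E)%E.

(** Omega = (0,L) x (0,1), coordinates x = (z, mu) *)
Definition Om (L : R) : set (R * R) := [set x | 0 < x.1 < L /\ 0 < x.2 < 1].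

Definition L2fun (L : R) (f : R * R -> R) : Prop :=
  measurable_fun (Om L) f /\ lam2.-integrable (Om L) (fun x => (f x ^+ 2)%:E).

(** g in L^2(Gamma; mu): g0 = g(0,.), gL = g(L,.) *)
Definition L2Gam (g0 gL : R -> R) : Prop :=
  measurable_fun `](0:R), 1[ g0 /\ measurable_fun `](0:R), 1[ gL /\
  mu.-integrable `](0:R), 1[ (fun m => ((g0 m ^+ 2 + gL m ^+ 2) * m)%:E).

(** v in V with z-derivative dv (mu * dv in L^2); v is the representative
    which is absolutely continuous in z on [0,L] along every line mu = const,
    so that traces v(z0, .) are point values. *)
Definition isV (L : R) (v dv : R * R -> R) : Prop :=
  L2fun L v /\ measurable_fun (Om L) dv /\ L2fun L (fun x => x.2 * dv x) /\
  forall m, 0 < m < 1 ->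
    mu.-integrable `](0:R), L[ (fun z => (dv (z, m))%:E) /\
    forall z1 z2, 0 <= z1 -> z1 <= z2 -> z2 <= L ->
      v (z2, m) - v (z1, m) = int1 z1 z2 (fun z => dv (z, m)).

Definition bnd (a0 aL b0 bL : R -> R) : R :=
  int1 0 1 (fun m => (aL m * bL m + a0 m * b0 m) * m).

Definition Pop (w : R * R -> R) (x : R * R) : R := int1 0 1 (fun m' => w (x.1, m')).

Definition ae (L : R) (ss st : R -> R) (u du v dv : R * R -> R) : R :=
  int2 (Om L) (fun x => (st x.1)^-1 * (x.2 * du x) * (x.2 * dv x))
  + int2 (Om L) (fun x => st x.1 * u x * v x)
  - int2 (Om L) (fun x => ss x.1 * Pop u x * v x)
  + bnd (fun m => u (0, m)) (fun m => u (L, m)) (fun m => v (0, m)) (fun m => v (L, m)).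

(** meshes: finitely many open rectangles K = (zl K, zr K) x (ml K, mr K) *)
Record mesh := Mesh {
  nK : nat;
  zl : 'I_nK -> R; zr : 'I_nK -> R;
  ml : 'I_nK -> R; mr : 'I_nK -> R }.
Arguments zl : clear implicits.
Arguments zr : clear implicits.
Arguments ml : clear implicits.
Arguments mr : clear implicits.

Definition inK (M : mesh) (K : 'I_(nK M)) (x : R * R) : bool :=
  (zl M K < x.1 < zr M K) && (ml M K < x.2 < mr M K).

(** T is a partition of Omega into open rectangles (hanging nodes allowed),
    with sigma_t constant on each element *)
Definition is_mesh (L : R) (st : R -> R) (M : mesh) : Prop :=
  (forall K, 0 <= zl M K /\ zl M K < zr M K /\ zr M K <= L /\
             0 <= ml M K /\ ml M K < mr M K /\ mr M K <= 1) /\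
  (forall (K K' : 'I_(nK M)) x, inK M K x -> inK M K' x -> K = K') /\
  (forall x, Om L x -> exists K, zl M K <= x.1 <= zr M K /\ ml M K <= x.2 <= mr M K) /\
  (forall K, exists s, forall z, zl M K < z < zr M K -> st z = s).

Definition hK (M : mesh) K : R := zr M K - zl M K.
(** sigma_t restricted to K (constant there) *)
Definition sigK (st : R -> R) (M : mesh) K : R := st ((zl M K + zr M K) / 2).

(** discrete space V_h: on each K a polynomial in P_{kz+1} (x) P_{km},
    given by its coefficient matrix c K i j (coefficient of z^i mu^j) *)
Definition coefs (M : mesh) (kz km : nat) := 'I_(nK M) -> 'M[R]_(kz.+2, km.+1).

Definition pev {a b : nat} (c : 'M[R]_(a, b)) (z m : R) : R :=
  \sum_(i < a) \sum_(j < b) c i j * z ^+ i * m ^+ j.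
Definition pdz {a b : nat} (c : 'M[R]_(a, b)) (z m : R) : R :=
  \sum_(i < a) \sum_(j < b) c i j * i%:R * z ^+ i.-1 * m ^+ j.

Definition ph (M : mesh) kz km (c : coefs M kz km) (x : R * R) : R :=
  \sum_(K < nK M | inK M K x) pev (c K) x.1 x.2.
Definition dph (M : mesh) kz km (c : coefs M kz km) (x : R * R) : R :=
  \sum_(K < nK M | inK M K x) pdz (c K) x.1 x.2.
Definition ph0 (M : mesh) kz km (c : coefs M kz km) (m : R) : R :=
  \sum_(K < nK M | (zl M K == 0) && (ml M K < m < mr M K)) pev (c K) 0 m.
Definition phL (L : R) (M : mesh) kz km (c : coefs M kz km) (m : R) : R :=
  \sum_(K < nK M | (zr M K == L) && (ml M K < m < mr M K)) pev (c K) L m.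

(** interior vertical faces F = {zr K1} x (max ml, min mr) between K1 and K2 *)
Definition isF (M : mesh) (K1 K2 : 'I_(nK M)) : bool :=
  [&& K1 != K2, zr M K1 == zl M K2 &
      Num.max (ml M K1) (ml M K2) < Num.min (mr M K1) (mr M K2)].
Definition zF (M : mesh) K1 (K2 : 'I_(nK M)) : R := zr M K1.
Definition bF (M : mesh) K1 K2 : R := Num.max (ml M K1) (ml M K2).
Definition tF (M : mesh) K1 K2 : R := Num.min (mr M K1) (mr M K2).
Definition intF (M : mesh) K1 K2 (w : R -> R) : R :=
  int1 (bF M K1 K2) (tF M K1 K2) (fun m => w m * m).
Definition DF (st : R -> R) (M : mesh) K1 K2 : R :=
  ((sigK st M K1 * hK M K1)^-1 + (sigK st M K2 * hK M K2)^-1)^-1.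
Definition sumF {M : mesh} (t : 'I_(nK M) -> 'I_(nK M) -> R) : R :=
  \sum_(K1 < nK M) \sum_(K2 < nK M | isF M K1 K2) t K1 K2.

Definition Cie (k : nat) : R :=
  inf [set C : R | 0 <= C /\
    forall a b : R, a < b -> forall p : {poly R}, (size p <= k.+1)%N ->
      Num.sqrt (int1 a b (fun x => (p^`()).[x] ^+ 2))
        <= Num.sqrt C / (b - a) * Num.sqrt (int1 a b (fun x => p.[x] ^+ 2))].
Definition Cdt (k : nat) : R := 1 + 2 * Num.sqrt (Cie k).

(** Elements of V(h) = V + V_h are given by (v, dv, c): v in V with
    z-derivative dv and c in V_h. *)
Section Broken.
Variables (L : R) (ss st : R -> R) (M : mesh) (kz km : nat).

Definition bval (v : R * R -> R) (c : coefs M kz km) x := v x + ph M kz km c x.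
Definition bdz (dv : R * R -> R) (c : coefs M kz km) x := dv x + dph M kz km c x.
Definition btr0 (v : R * R -> R) (c : coefs M kz km) m := v (0, m) + ph0 M kz km c m.
Definition btrL (v : R * R -> R) (c : coefs M kz km) m := v (L, m) + phL L M kz km c m.
Definition bjump (v : R * R -> R) (c : coefs M kz km) K1 K2 m :=
  (v (zF M K1 K2, m) + pev (c K1) (zF M K1 K2) m)
  - (v (zF M K1 K2, m) + pev (c K2) (zF M K1 K2) m).

Definition aeh (v1 dv1 : R * R -> R) (c1 : coefs M kz km)
               (v2 dv2 : R * R -> R) (c2 : coefs M kz km) : R :=
  int2 (Om L) (fun x => (st x.1)^-1 * (x.2 * bdz dv1 c1 x) * (x.2 * bdz dv2 c2 x))
  + int2 (Om L) (fun x => st x.1 * bval v1 c1 x * bval v2 c2 x)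
  - int2 (Om L) (fun x => ss x.1 * Pop (bval v1 c1) x * bval v2 c2 x)
  + bnd (btr0 v1 c1) (btrL v1 c1) (btr0 v2 c2) (btrL v2 c2).

Definition normVh (v dv : R * R -> R) (c : coefs M kz km) : R :=
  Num.sqrt (aeh v dv c v dv c
    + sumF (M := M) (fun K1 K2 => (DF st M K1 K2)^-1 * intF M K1 K2 (fun m => bjump v c K1 K2 m ^+ 2))).

(** ||.||_* on V_{*h}: w = v + c with v in V_*, where q in V is the
    representative of (mu / sigma_t) dz v; the one-sided trace of
    (mu/sigma_t) dz^h w from K_i is q(zF,.) + (mu/sigma_{t,K_i}) dz p_{K_i}(zF,.) *)
Definition bavgflux (q : R * R -> R) (c : coefs M kz km) K1 K2 m : R :=
  ((q (zF M K1 K2, m) + m / sigK st M K1 * pdz (c K1) (zF M K1 K2) m)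
   + (q (zF M K1 K2, m) + m / sigK st M K2 * pdz (c K2) (zF M K1 K2) m)) / 2.

Definition normStar (v dv q : R * R -> R) (c : coefs M kz km) : R :=
  Num.sqrt (normVh v dv c ^+ 2
    + sumF (M := M) (fun K1 K2 => DF st M K1 K2 / Cdt kz * intF M K1 K2 (fun m => bavgflux q c K1 K2 m ^+ 2))).

Definition ah (alpha : R) (c1 c2 : coefs M kz km) : R :=
  let z0 := fun _ : R * R => 0 in
  aeh z0 z0 c1 z0 z0 c2
  - sumF (M := M) (fun K1 K2 => intF M K1 K2 (fun m =>
        bavgflux z0 c1 K1 K2 m * bjump z0 c2 K1 K2 m
      + bavgflux z0 c2 K1 K2 m * bjump z0 c1 K1 K2 m))
  + sumF (M := M) (fun K1 K2 => alpha / DF st M K1 K2 * intF M K1 K2 (fun m =>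
        bjump z0 c1 K1 K2 m * bjump z0 c2 K1 K2 m)).
End Broken.

Definition sigma_hyp (L c : R) (ss st : R -> R) : Prop :=
  measurable_fun `](0:R), L[ ss /\ measurable_fun `](0:R), L[ st /\
  (exists B : R, forall z, 0 < z < L -> `|ss z| <= B /\ `|st z| <= B) /\
  0 < c /\ (forall z, 0 < z < L -> 0 <= ss z /\ c <= st z - ss z).

End DGDefs.
Arguments lam2 {R}. Arguments int2 {R}. Arguments int1 {R}. Arguments Om {R}.
Arguments L2fun {R}. Arguments L2Gam {R}. Arguments isV {R}. Arguments bnd {R}.
Arguments Pop {R}. Arguments ae {R}. Arguments mesh : clear implicits.
Arguments inK {R}. Arguments is_mesh {R}. Arguments hK {R}. Arguments sigK {R}.
Arguments coefs {R}. Arguments ph {R}. Arguments dph {R}. Arguments ph0 {R}.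
Arguments phL {R}. Arguments isF {R}. Arguments zF {R}. Arguments bF {R}.
Arguments tF {R}. Arguments intF {R}. Arguments DF {R}. Arguments Cie {R}.
Arguments Cdt {R}. Arguments bval {R}. Arguments bdz {R}. Arguments btr0 {R}.
Arguments btrL {R}. Arguments bjump {R}. Arguments aeh {R}. Arguments normVh {R}.
Arguments bavgflux {R}. Arguments normStar {R}. Arguments ah {R}.
Arguments sigma_hyp {R}.

(* Main.v *)
(* Testing the weak formulation with functions vanishing at z = 0 and z = L shows that the
   flux q = (mu / sigma_t) dz u has a representative in V with
   mu dz q = sigma_t u - sigma_s P u - f, and general test functions then give
   q + u = g at z = L and u - q = g at z = 0 almost everywhere.  Integrating q against v_h
   by parts on every element along almost every line mu = const yields consistency,
   hence Galerkin orthogonality a_h(u - u_h, v_h) = 0.  The inverse inequality gives the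
   discrete trace inequality h |p(end)|^2 <= C_dt |p|^2, which bounds the averaged flux of
   d = v_h - u_h on the faces by C_dt / 2 times its streaming energy.  With w = u - v_h this
   makes a_h coercive on d with constant 1/2 for alpha >= 1/2 + C_dt and bounds -a_h(w, d) by
   (C_dt + alpha) |w|_* |d|, so |d| <= 2 (C_dt + alpha) |w|_*, and the triangle
   inequality concludes. *)
Require Import Defs.
From HB Require Import structures.
From mathcomp Require Import all_boot all_order all_algebra.
From mathcomp Require Import all_classical all_reals all_analysis.
From mathcomp Require Import measurable_realfun.
From mathcomp Require Import ring lra.
Set Implicit Arguments.
Unset Strict Implicit.
Import Order.TTheory GRing.Theory Num.Theory.
Import numFieldNormedType.Exports.
Local Open Scope classical_set_scope.
Local Open Scope ring_scope.

(** * Square-integrable functions and Fubini on rectangles *)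

(** Members of [V] enter as representatives that are absolutely continuous along every line
    [mu = const], while the equation determines fluxes and traces only almost everywhere. The flux
    representative [q] therefore has to be constructed, and the conclusion exposes it because
    [normStar] reads its point values on the faces. Fubini reduces the element and face identities
    to a fixed line, where hanging nodes do no harm: off the finitely many heights of horizontal
    edges, the elements met by a line tile [(0, L)] in order, each interior end being shared by
    exactly two. On a line an element has at most two faces, and [D_F] weights an averaged flux by
    at most a quarter of each side, whence [C_dt / 2 = 2 * C_dt / 4]. Young's inequality then costs
    half of the energy and [C_dt] times the jumps, which is why [alpha >= 1/2 + C_dt] leaves the
    coercivity constant [1/2]. The continuity constant [C_dt + alpha] relies on [C_dt >= 1]: its
    square must dominate the coefficients collected from the energy, jump and flux terms. *)

Section PositiveSemidefinite.
Context (R : realType).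
Implicit Types a b c k : R.

(* Nonnegativity of the binary quadratic form with entries [a, b; b, c]; it packages
   Cauchy-Schwarz so that it adds up over elements and faces. *)
Definition psd (a b c : R) : Prop := forall t, 0 <= a + 2 * t * b + t ^+ 2 * c.

Lemma psd_add a b c a' b' c' :
  psd a b c -> psd a' b' c' -> psd (a + a') (b + b') (c + c').
Proof. by move=> h h' t; have := h t; have := h' t; nra. Qed.

Lemma psd_scale k a b c : 0 <= k -> psd a b c -> psd (k * a) (k * b) (k * c).
Proof.
move=> k0 h t.
have -> : k * a + 2 * t * (k * b) + t ^+ 2 * (k * c) =
  k * (a + 2 * t * b + t ^+ 2 * c) by ring.
exact: mulr_ge0 k0 (h t).
Qed.

Lemma psd_sum (I : Type) (s : seq I) (P : pred I) (a b c : I -> R) :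
  (forall i, P i -> psd (a i) (b i) (c i)) ->
  psd (\sum_(i <- s | P i) a i) (\sum_(i <- s | P i) b i) (\sum_(i <- s | P i) c i).
Proof.
move=> h t; rewrite !mulr_sumr -!big_split/=; apply: sumr_ge0 => i Pi.
exact: h.
Qed.

(** The three claims come from [t = 0], from large [t] of both signs, and from the minimiser
    [t = - b / c]. If [c = 0] the form is affine in [t], and nonnegativity forces [b = 0]. *)
Lemma psd_sqr_le a b c : psd a b c -> [/\ 0 <= a, 0 <= c & b ^+ 2 <= a * c].
Proof.
move=> h; have a0 : 0 <= a by have := h 0; rewrite !(mulr0, mul0r, expr0n)/= !addr0.
have c0 : 0 <= c.
  rewrite leNgt; apply/negP => c0.
  (* Adding the values at [t] and [- t] removes [b]; as [t >= 1] and [t * c = - (a + 1) + c], the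
     sum is negative when [c < 0]. *)
  pose t := (a + 1) / - c + 1.
  have tc : t * c = - (a + 1) + c by rewrite /t; field; rewrite lt_eqF.
  have t1 : 0 <= (a + 1) / - c by rewrite divr_ge0 ?oppr_ge0 ?ltW//; lra.
  have := h t; have := h (- t); have -> : t ^+ 2 * c = t * (t * c) by ring.
  have -> : (- t) ^+ 2 * c = t * (t * c) by ring.
  have -> : t = (a + 1) / - c + 1 by [].
  rewrite -/t tc; nra.
split=> //; have [c00|cn0] := eqVneq c 0; last first.
  have cp : 0 < c by rewrite lt_neqAle eq_sym cn0.
  have := h (- b / c); rewrite -(pmulr_rge0 _ cp).
  have -> : c * (a + 2 * (- b / c) * b + (- b / c) ^+ 2 * c) = a * c - b ^+ 2 by field.
  by rewrite subr_ge0.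
rewrite c00 mulr0; have [->|bn0] := eqVneq b 0; first by rewrite expr0n.
have := h (- (a + 1) / (2 * b)); rewrite c00 mulr0 addr0.
have -> : a + 2 * (- (a + 1) / (2 * b)) * b = -1 by field.
by rewrite ler0N1.
Qed.

End PositiveSemidefinite.

Section SquareIntegrable.
Context d (T : measurableType d) (R : realType).
Variables (mu : {measure set T -> \bar R}) (D : set T).
Hypothesis mD : measurable D.
Implicit Types b f g : T -> R.

Definition L2 f : Prop :=
  measurable_fun D f /\ mu.-integrable D (EFin \o (fun x => f x ^+ 2)).

Lemma integrable_le f g : measurable_fun D f ->
  mu.-integrable D (EFin \o g) -> (forall x, D x -> `|f x| <= g x) ->
  mu.-integrable D (EFin \o f).
Proof.
move=> mf ig fg; apply: le_integrable ig => //; first exact/measurable_EFinP.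
by move=> x Dx /=; rewrite lee_fin (le_trans (fg x Dx))// ler_norm.
Qed.

Lemma integrable_eq f g : (forall x, D x -> f x = g x) ->
  mu.-integrable D (EFin \o f) -> mu.-integrable D (EFin \o g).
Proof.
by move=> fg; apply: eq_integrable => // x /set_mem Dx /=; rewrite fg.
Qed.

Lemma integrable_measurable f :
  mu.-integrable D (EFin \o f) -> measurable_fun D f.
Proof. by move/(measurable_int mu)/measurable_EFinP. Qed.

Lemma integrable_add f g : mu.-integrable D (EFin \o f) ->
  mu.-integrable D (EFin \o g) -> mu.-integrable D (EFin \o (fun x => f x + g x)).
Proof. by move=> fi gi; have := integrableD mD fi gi. Qed.

Lemma integrable_sub f g : mu.-integrable D (EFin \o f) ->
  mu.-integrable D (EFin \o g) -> mu.-integrable D (EFin \o (fun x => f x - g x)).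
Proof. by move=> fi gi; have := integrableB mD fi gi. Qed.

Lemma integrable_scale k f : mu.-integrable D (EFin \o f) ->
  mu.-integrable D (EFin \o (fun x => k * f x)).
Proof. by move=> fi; have := integrableZl mD k fi. Qed.

Lemma L2_le f g : measurable_fun D f -> L2 g ->
  (forall x, D x -> `|f x| <= `|g x|) -> L2 f.
Proof.
move=> mf [mg ig] fg; split => //.
apply: (integrable_le _ ig); first exact: measurable_funX.
move=> x Dx; rewrite normrX -(real_normK (num_real (g x))).
by rewrite ler_pXn2r ?nnegrE// fg.
Qed.

Lemma L2_eq f g : (forall x, D x -> f x = g x) -> L2 f -> L2 g.
Proof.
move=> fg [mf fi]; split.
  by apply: eq_measurable_fun mf => x /set_mem; exact: fg.
by apply: integrable_eq fi => x Dx; rewrite fg.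
Qed.

Lemma L2_mul f g : L2 f -> L2 g -> mu.-integrable D (EFin \o (fun x => f x * g x)).
Proof.
move=> [mf fi] [mg gi].
apply: (integrable_le _ (integrable_add fi gi)); first exact: measurable_funM.
by move=> x _; rewrite ler_norml; apply/andP; split; nra.
Qed.

Lemma L2_add f g : L2 f -> L2 g -> L2 (fun x => f x + g x).
Proof.
move=> f2 g2; split; first by apply: measurable_funD; [case: f2|case: g2].
have := integrable_add (integrable_add f2.2 (integrable_scale 2 (L2_mul f2 g2))) g2.2.
by apply: integrable_eq => x _; ring.
Qed.

Lemma L2_scale k f : L2 f -> L2 (fun x => k * f x).
Proof.
move=> [mf fi]; split; first exact: measurable_funM.
by apply: integrable_eq (integrable_scale (k ^+ 2) fi) => x _; rewrite exprMn.
Qed.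

Lemma L2_opp f : L2 f -> L2 (fun x => - f x).
Proof. by move=> /(L2_scale (-1)); apply: L2_eq => x _; rewrite mulN1r. Qed.

Lemma L2_sub f g : L2 f -> L2 g -> L2 (fun x => f x - g x).
Proof. by move=> f2 /L2_opp; exact: L2_add. Qed.

Lemma L2_bounded_mul b (B : R) f : measurable_fun D b ->
  (forall x, D x -> `|b x| <= B) -> L2 f -> L2 (fun x => b x * f x).
Proof.
move=> mb bB f2; apply: (L2_le _ (L2_scale B f2)).
  by apply: measurable_funM => //; case: f2.
by move=> x Dx; rewrite !normrM ler_wpM2r// (le_trans (bB x Dx))// ler_norm.
Qed.

Lemma L2_bounded b (B : R) : (mu D < +oo)%E -> measurable_fun D b ->
  (forall x, D x -> `|b x| <= B) -> L2 b.
Proof.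
move=> Dfin mb bB; split=> //.
have : mu.-integrable D (EFin \o cst (B ^+ 2)).
  apply: measurable_bounded_integrable => //.
  by exists `|B ^+ 2|; split => // x xB y _ /=; exact: ltW.
move=> cB; apply: (integrable_le _ cB); first exact: measurable_funX.
move=> x Dx; rewrite normrX ler_pXn2r ?nnegrE// ?bB//.
by rewrite (le_trans _ (bB x Dx)).
Qed.

Lemma L2_integrable f : (mu D < +oo)%E -> L2 f -> mu.-integrable D (EFin \o f).
Proof.
move=> Dfin f2; have one2 : L2 (cst 1).
  by apply: (@L2_bounded _ 1) => // x _; rewrite normr1.
by apply: integrable_eq (L2_mul f2 one2) => x _; rewrite mulr1.
Qed.

(* [fine] sends infinities to 0. *)
Lemma Rintegral_nonintegrable f : measurable_fun D f ->
  ~ mu.-integrable D (EFin \o f) -> \int[mu]_(x in D) f x = 0.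
Proof.
move=> mf nf; rewrite /Rintegral.
have : ~~ ((\int[mu]_(x in D) (f x)%:E)%E \is a fin_num).
  apply/negP; rewrite -integral_fin_num_abs// => foo; apply: nf.
  by apply/integrableP; split => //; exact/measurable_EFinP.
by case: (\int[mu]_(x in D) (f x)%:E)%E.
Qed.

(** No integrability is assumed: for [k != 0] both integrands are integrable or neither is, and in
    the second case both sides are 0 by convention. *)
Lemma Rintegral_scale k f : measurable_fun D f ->
  \int[mu]_(x in D) (k * f x) = k * \int[mu]_(x in D) f x.
Proof.
move=> mf; have [fi|nfi] := pselect (mu.-integrable D (EFin \o f)).
  exact: RintegralZl.
have [->|k0] := eqVneq k 0.
  rewrite mul0r (@eq_Rintegral _ _ _ _ _ (cst 0)) ?Rintegral_cst ?mul0r// => x _.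
  by rewrite mul0r.
rewrite (Rintegral_nonintegrable _ nfi)// mulr0 Rintegral_nonintegrable//.
  exact: measurable_funM.
move=> /(integrable_scale k^-1) kfi; apply: nfi; apply: integrable_eq kfi => x _.
by rewrite mulrA mulVf ?mul1r.
Qed.

Lemma Rintegral_sum (I : Type) (s : seq I) (P : pred I) (h : I -> T -> R) :
  (forall i, P i -> mu.-integrable D (EFin \o h i)) ->
  \int[mu]_(x in D) (\sum_(i <- s | P i) h i x) =
  \sum_(i <- s | P i) \int[mu]_(x in D) h i x /\
  mu.-integrable D (EFin \o (fun x => \sum_(i <- s | P i) h i x)).
Proof.
move=> hi; elim: s => [|i s [IH1 IH2]].
  split; first by rewrite big_nil (@eq_Rintegral _ _ _ _ _ (cst 0)) ?Rintegral_cst ?mul0r// => x _; rewrite big_nil.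
  apply: (@integrable_eq (cst 0)); last exact: integrable0.
  by move=> x _; rewrite big_nil.
have [Pi|nPi] := boolP (P i).
  split.
    rewrite big_cons Pi -IH1 -RintegralD//; last exact: hi.
    by apply: eq_Rintegral => x _; rewrite big_cons Pi.
  apply: integrable_eq (integrable_add (hi i Pi) IH2) => x _.
  by rewrite big_cons Pi.
split.
  rewrite big_cons (negbTE nPi) -IH1.
  by apply: eq_Rintegral => x _; rewrite big_cons (negbTE nPi).
by apply: integrable_eq IH2 => x _; rewrite big_cons (negbTE nPi).
Qed.

Lemma Rintegral_ae_eq f g : measurable_fun D f -> measurable_fun D g ->
  {ae mu, forall x, D x -> f x = g x} ->
  \int[mu]_(x in D) f x = \int[mu]_(x in D) g x.
Proof.
move=> mf mg fg; congr fine; apply: ae_eq_integral => //.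
- exact/measurable_EFinP.
- exact/measurable_EFinP.
- by apply: filterS fg => x /= h Dx; rewrite h.
Qed.

Lemma integrable_ae_eq f g : measurable_fun D g ->
  {ae mu, forall x, D x -> f x = g x} ->
  mu.-integrable D (EFin \o f) -> mu.-integrable D (EFin \o g).
Proof.
move=> mg fg fi; have mf := integrable_measurable fi.
move/integrableP: (fi) => [_ foo]; apply/integrableP; split.
  exact/measurable_EFinP.
rewrite -(@ae_eq_integral _ _ _ mu D _ (fun x => `|(f x)%:E|)%E)//.
- by do 2 apply: measurableT_comp => //.
- by do 2 apply: measurableT_comp => //.
- by apply: filterS fg => x /= h Dx; rewrite h.
Qed.

Lemma L2_ae_eq f g : measurable_fun D g ->
  {ae mu, forall x, D x -> f x = g x} -> L2 f -> L2 g.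
Proof.
move=> mg fg [mf fi]; split=> //; apply: integrable_ae_eq fi.
  exact: measurable_funX.
by apply: filterS fg => x h Dx; rewrite h.
Qed.

Lemma Rintegral_eq0_ae f : mu.-integrable D (EFin \o f) ->
  (forall x, D x -> 0 <= f x) -> \int[mu]_(x in D) f x = 0 ->
  {ae mu, forall x, D x -> f x = 0}.
Proof.
move=> fi f0 If; have mf := integrable_measurable fi.
have : (\int[mu]_(x in D) `|(EFin \o f) x|)%E = 0%E.
  rewrite (eq_integral (EFin \o f)); last first.
    by move=> x /set_mem Dx /=; rewrite ger0_norm// f0.
  by rewrite -[LHS]fineK ?integrable_fin_num//; congr EFin.
move/(ae_eq_integral_abs _ _ _).1 => /(_ mD).
have mfE : measurable_fun D (EFin \o f) by exact/measurable_EFinP.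
by move=> /(_ mfE); apply: filterS => x /= h Dx; have [] := h Dx.
Qed.

Lemma L2_psd f g : L2 f -> L2 g ->
  psd (\int[mu]_(x in D) (f x ^+ 2)) (\int[mu]_(x in D) (f x * g x))
      (\int[mu]_(x in D) (g x ^+ 2)).
Proof.
move=> f2 g2 t; have fg := L2_mul f2 g2.
have -> : \int[mu]_(x in D) (f x ^+ 2) + 2 * t * \int[mu]_(x in D) (f x * g x) +
   t ^+ 2 * \int[mu]_(x in D) (g x ^+ 2) = \int[mu]_(x in D) ((f x + t * g x) ^+ 2).
  rewrite -RintegralZl// -RintegralZl//; last exact: g2.2.
  rewrite -RintegralD//; [|exact: f2.2|exact: integrable_scale].
  rewrite -RintegralD//.
  - by apply: eq_Rintegral => x _; ring.
  - by apply: integrable_add; [exact: f2.2|exact: integrable_scale].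
  - by apply: integrable_scale; exact: g2.2.
by apply: Rintegral_ge0 => x _; rewrite sqr_ge0.
Qed.

(** Extended-real values let this Cauchy-Schwarz inequality be integrated over slices not yet known
    to be square integrable. When [f ^+ 2] is not integrable, [mu D] is nonzero and the bound is
    [+oo]. *)
Lemma Rintegral_sqr_le f : (mu D < +oo)%E -> measurable_fun D f ->
  (((\int[mu]_(x in D) f x) ^+ 2)%:E <=
   mu D * \int[mu]_(x in D) (f x ^+ 2)%:E)%E.
Proof.
move=> Dfin mf.
have mf2 : measurable_fun D (fun x => (f x ^+ 2)%:E).
  by apply/measurable_EFinP; exact: measurable_funX.
have [fi|nfi] := pselect (mu.-integrable D (EFin \o (fun x => f x ^+ 2))); last first.
  have D0 : mu D != 0%E.
    by apply/eqP => D0; apply: nfi; exact: null_set_integrable.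
  have -> : (\int[mu]_(x in D) (f x ^+ 2)%:E = +oo)%E.
    apply/eqP; rewrite -leye_eq leNgt; apply/negP => foo; apply: nfi.
    apply/integrableP; split => //; apply: le_lt_trans foo.
    rewrite le_eqVlt; apply/orP; left; apply/eqP; apply: eq_integral => x _ /=.
    by rewrite ger0_norm// sqr_ge0.
  by rewrite gt0_muley ?leey// lt0e D0 measure_ge0.
have one2 : L2 (cst 1) by apply: (@L2_bounded _ 1) => // x _; rewrite normr1.
have f2 : L2 f by split.
have [_ _] := psd_sqr_le (L2_psd one2 f2).
under eq_Rintegral do rewrite mul1r.
under [X in X * _]eq_Rintegral do rewrite expr1n.
rewrite Rintegral_cst// mul1r -lee_fin => /le_trans; apply.
rewrite EFinM fineK ?ge0_fin_numE// fineK//.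
exact: integrable_fin_num.
Qed.
End SquareIntegrable.

(** * Fubini and Tonelli on products of measurable sets *)

Section FubiniRect.
Context d1 d2 (T1 : measurableType d1) (T2 : measurableType d2) (R : realType).
Variables (m1 : {sigma_finite_measure set T1 -> \bar R})
          (m2 : {sigma_finite_measure set T2 -> \bar R}).
Variables (A : set T1) (B : set T2).
Hypotheses (mA : measurable A) (mB : measurable B).
Implicit Types F : T1 * T2 -> R.
Local Notation m12 := (m1 \x m2)%E.

Let mAB : measurable (A `*` B). Proof. exact: measurableX. Qed.

Let patch1 F x y : A x -> (((EFin \o F) \_ (A `*` B)) (x, y) =
  ((fun y => (F (x, y))%:E) \_ B) y)%E.
Proof.
move=> Ax; rewrite !patchE; case: ifPn => [/set_mem[_ By]|nAB].
  by rewrite mem_set.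
case: ifPn => // /set_mem By; move: nAB; rewrite notin_setE/= => /(_ _)[].
by split.
Qed.

Let patch2 F x y : B y -> (((EFin \o F) \_ (A `*` B)) (x, y) =
  ((fun x => (F (x, y))%:E) \_ A) x)%E.
Proof.
move=> By; rewrite !patchE; case: ifPn => [/set_mem[Ax _]|nAB].
  by rewrite mem_set.
case: ifPn => // /set_mem Ax; move: nAB; rewrite notin_setE/= => /(_ _)[].
by split.
Qed.

Let patch10 F x y : ~ A x -> (((EFin \o F) \_ (A `*` B)) (x, y) = 0)%E.
Proof. by move=> Ax; rewrite patchE ifN// notin_setE => -[]. Qed.

Let patch20 F x y : ~ B y -> (((EFin \o F) \_ (A `*` B)) (x, y) = 0)%E.
Proof. by move=> By; rewrite patchE ifN// notin_setE => -[]. Qed.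

(** Fubini on the whole product is applied to [F] extended by zero; outside [A] the partial integral
    vanishes, so it is again an extension by zero. *)
Let fubF F : fubini_F m2 ((EFin \o F) \_ (A `*` B)) =
  (fun x => \int[m2]_(y in B) (F (x, y))%:E)%E \_ A.
Proof.
apply/funext => x; rewrite patchE; case: ifPn => [/set_mem Ax|/negP nA].
  by rewrite /fubini_F [RHS]integral_mkcond; apply: eq_integral => y _; rewrite patch1.
rewrite /fubini_F integral0_eq// => y _; rewrite patch10// => Ax; apply: nA.
exact/mem_set.
Qed.

Let fubG F : fubini_G m1 ((EFin \o F) \_ (A `*` B)) =
  (fun y => \int[m1]_(x in A) (F (x, y))%:E)%E \_ B.
Proof.
apply/funext => y; rewrite patchE; case: ifPn => [/set_mem By|/negP nB].
  by rewrite /fubini_G [RHS]integral_mkcond; apply: eq_integral => x _; rewrite patch2.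
rewrite /fubini_G integral0_eq// => x _; rewrite patch20// => By; apply: nB.
exact/mem_set.
Qed.

Let mpatch F : measurable_fun (A `*` B) F ->
  measurable_fun setT ((EFin \o F) \_ (A `*` B)).
Proof.
move=> mF; have : measurable_fun (A `*` B) (EFin \o F) by exact/measurable_EFinP.
by move/(measurable_restrictT _ mAB).
Qed.

Let measurable_eint1 F : measurable_fun (A `*` B) F ->
  measurable_fun A (fun x => \int[m2]_(y in B) (F (x, y))%:E)%E.
Proof.
move=> mF; apply/(measurable_restrictT _ mA).2; rewrite -fubF.
set f := _ \_ _; have mf : measurable_fun setT f by exact: mpatch.
have -> : fubini_F m2 f = (fubini_F m2 f^\+ \- fubini_F m2 f^\-)%E.
  apply/funext=> x; rewrite [LHS]integralE.
  under eq_integral do rewrite funepos_comp/=.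
  by under [X in (_ - X = _)%E]eq_integral do rewrite funeneg_comp/=.
apply: emeasurable_funB; apply: measurable_fun_fubini_tonelli_F => //.
- exact: measurable_funepos.
- exact: measurable_funeneg.
Qed.

Let measurable_eint2 F : measurable_fun (A `*` B) F ->
  measurable_fun B (fun y => \int[m1]_(x in A) (F (x, y))%:E)%E.
Proof.
move=> mF; apply/(measurable_restrictT _ mB).2; rewrite -fubG.
set f := _ \_ _; have mf : measurable_fun setT f by exact: mpatch.
have -> : fubini_G m1 f = (fubini_G m1 f^\+ \- fubini_G m1 f^\-)%E.
  apply/funext=> x; rewrite [LHS]integralE.
  under eq_integral do rewrite funepos_comp/=.
  by under [X in (_ - X = _)%E]eq_integral do rewrite funeneg_comp/=.
apply: emeasurable_funB; apply: measurable_fun_fubini_tonelli_G => //.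
- exact: measurable_funepos.
- exact: measurable_funeneg.
Qed.

Lemma measurable_Rintegral1 F : measurable_fun (A `*` B) F ->
  measurable_fun A (fun x => \int[m2]_(y in B) F (x, y)).
Proof.
move=> mF; have := @measurableT_comp _ _ _ _ _ _ (@fine R) _ _ _ (measurable_eint1 mF).
by apply; exact: fine_measurable.
Qed.

Lemma measurable_Rintegral2 F : measurable_fun (A `*` B) F ->
  measurable_fun B (fun y => \int[m1]_(x in A) F (x, y)).
Proof.
move=> mF; have := @measurableT_comp _ _ _ _ _ _ (@fine R) _ _ _ (measurable_eint2 mF).
by apply; exact: fine_measurable.
Qed.

Lemma measurable_section1 F x : measurable_fun (A `*` B) F -> A x ->
  measurable_fun B (fun y => F (x, y)).
Proof.
move=> mF Ax; have := @measurable_comp _ _ _ _ _ _ (A `*` B) F B (fun y => (x, y)).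
apply => //; first by move=> _ [y By <-].
apply: measurable_funTS; apply/measurable_fun_pairP; split.
  exact: measurable_cst.
exact: measurable_id.
Qed.

Lemma measurable_section2 F y : measurable_fun (A `*` B) F -> B y ->
  measurable_fun A (fun x => F (x, y)).
Proof.
move=> mF By; have := @measurable_comp _ _ _ _ _ _ (A `*` B) F A (fun x => (x, y)).
apply => //; first by move=> _ [x Ax <-].
apply: measurable_funTS; apply/measurable_fun_pairP; split.
  exact: measurable_id.
exact: measurable_cst.
Qed.

Lemma measurable_fun_fst f : measurable_fun A f -> measurable_fun (A `*` B) (fun x => f x.1 : R).
Proof.
move=> mf; have := @measurable_comp _ _ _ _ _ _ A f (A `*` B) fst.
apply => //; first by move=> _ [x [Ax _] <-].
exact: measurable_funTS.
Qed.

Lemma measurable_fun_snd f : measurable_fun B f -> measurable_fun (A `*` B) (fun x => f x.2 : R).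
Proof.
move=> mf; have := @measurable_comp _ _ _ _ _ _ B f (A `*` B) snd.
apply => //; first by move=> _ [x [_ Bx] <-].
exact: measurable_funTS.
Qed.

(** A partial integral may be infinite on a null set only, so passing to real values by [fine] keeps
    integrability and the integral. *)
Let integrable_fine d (T : measurableType d) (m : {measure set T -> \bar R}) (D : set T)
  (f : T -> \bar R) : measurable D -> m.-integrable D f ->
  m.-integrable D (EFin \o (fine \o f)) /\
  (\int[m]_(x in D) f x = \int[m]_(x in D) (fine (f x))%:E)%E.
Proof.
move=> mD fi; have mf := measurable_int m fi.
have mff : measurable_fun D (EFin \o (fine \o f)).
  apply/measurable_EFinP; apply: measurableT_comp => //; exact: fine_measurable.
have h : ae_eq m D f (EFin \o (fine \o f)).
  by have := integrable_ae mD fi; apply: filterS => x h Dx /=; rewrite fineK// h.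
split; last exact: ae_eq_integral.
move/integrableP: fi => [_ foo]; apply/integrableP; split => //.
rewrite -(@ae_eq_integral _ _ _ m D _ (fun x => `|f x|)%E)//.
- exact: measurableT_comp.
- exact: measurableT_comp.
- by apply: filterS h => x /= h Dx; rewrite {1}h.
Qed.

Lemma fubini1 F : m12.-integrable (A `*` B) (EFin \o F) ->
  m1.-integrable A (EFin \o (fun x => \int[m2]_(y in B) F (x, y))) /\
  \int[m12]_(x in A `*` B) F x = \int[m1]_(x in A) \int[m2]_(y in B) F (x, y).
Proof.
move=> Fi; have /integrable_mkcond FiT := Fi; have {}FiT := (FiT mAB).
have := integrable_fubini_F FiT; rewrite fubF => /(integrable_mkcond _ mA) i1.
have [i2 e2] := integrable_fine mA i1; split; first exact: i2.
rewrite /Rintegral integral_mkcond -(integral12_prod_meas1 FiT) fubF.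
by rewrite -integral_mkcond e2.
Qed.

Let integrable_fubini_G (f : T1 * T2 -> \bar R) :
  m12.-integrable setT f -> m2.-integrable setT (fubini_G m1 f).
Proof.
move=> fi; have mf : measurable_fun setT f by exact: measurable_int fi.
have mfy y : measurable_fun setT (fun x => f (x, y)) by exact: measurableT_comp.
apply/integrableP; split; first exact: (measurable_fubini_G fi).
apply: le_lt_trans ((integrable21ltyP _ _ mf).1 fi); apply: ge0_le_integral => //.
- by apply: measurableT_comp => //; exact: (measurable_fubini_G fi).
- apply: (measurable_fun_fubini_tonelli_G (abse \o f)) => [|x].
    exact: measurableT_comp.
  exact: abse_ge0.
- by move=> y _; exact: le_abse_integral.
Qed.

Lemma fubini2 F : m12.-integrable (A `*` B) (EFin \o F) ->
  m2.-integrable B (EFin \o (fun y => \int[m1]_(x in A) F (x, y))) /\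
  \int[m12]_(x in A `*` B) F x = \int[m2]_(y in B) \int[m1]_(x in A) F (x, y).
Proof.
move=> Fi; have /integrable_mkcond FiT := Fi; have {}FiT := (FiT mAB).
have := integrable_fubini_G FiT; rewrite fubG => /(integrable_mkcond _ mB) i1.
have [i2 e2] := integrable_fine mB i1; split; first exact: i2.
rewrite /Rintegral integral_mkcond -(integral21_prod_meas1 FiT) fubG.
by rewrite -integral_mkcond e2.
Qed.

Lemma ae_section2 F : m12.-integrable (A `*` B) (EFin \o F) ->
  {ae m2, forall y, B y -> m1.-integrable A (EFin \o (fun x => F (x, y)))}.
Proof.
move=> /integrable_mkcond => /(_ mAB) /ae_integrable2; apply: filterS => y + By.
move=> h; apply/integrable_mkcond => //; move: h; congr (_.-integrable _ _).
by apply/funext => x; rewrite patch2.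
Qed.

Lemma tonelli1 F : measurable_fun (A `*` B) F -> (forall x, 0 <= F x) ->
  (\int[m12]_(x in A `*` B) (F x)%:E = \int[m1]_(x in A) \int[m2]_(y in B) (F (x, y))%:E)%E.
Proof.
move=> mF F0; rewrite integral_mkcond fubini_tonelli1.
- by rewrite fubF -integral_mkcond.
- exact: mpatch.
- by move=> x; rewrite patchE; case: ifP => //= _; rewrite lee_fin.
Qed.

Lemma tonelli2 F : measurable_fun (A `*` B) F -> (forall x, 0 <= F x) ->
  (\int[m12]_(x in A `*` B) (F x)%:E = \int[m2]_(y in B) \int[m1]_(x in A) (F (x, y))%:E)%E.
Proof.
move=> mF F0; rewrite integral_mkcond fubini_tonelli2.
- by rewrite fubG -integral_mkcond.
- exact: mpatch.
- by move=> x; rewrite patchE; case: ifP => //= _; rewrite lee_fin.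
Qed.

Let integrable_ge0 d (T : measurableType d) (m : {measure set T -> \bar R}) (D : set T)
  (f : T -> R) : measurable D -> measurable_fun D f -> (forall x, 0 <= f x) ->
  (\int[m]_(x in D) (f x)%:E < +oo)%E -> m.-integrable D (EFin \o f).
Proof.
move=> mD mf f0 foo; apply/integrableP; split; first exact/measurable_EFinP.
by under eq_integral do rewrite /= ger0_norm//.
Qed.

Let integrable_ge0_lty d (T : measurableType d) (m : {measure set T -> \bar R}) (D : set T)
  (f : T -> R) : (forall x, 0 <= f x) -> m.-integrable D (EFin \o f) ->
  (\int[m]_(x in D) (f x)%:E < +oo)%E.
Proof.
move=> f0 /integrableP[_]; by under eq_integral do rewrite /= ger0_norm//.
Qed.

(** Cauchy-Schwarz on each slice and Tonelli bound the squared norm of the partial integral by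
    [m2 B] times the total. Not every slice has to be square integrable, hence the extended-real
    form of the inequality. *)
Lemma L2_Rintegral1 F : (m2 B < +oo)%E -> L2 m12 (A `*` B) F ->
  L2 m1 A (fun x => \int[m2]_(y in B) F (x, y)).
Proof.
move=> Bfin [mF Fi]; have mP := measurable_Rintegral1 mF; split => //.
apply: integrable_ge0 => //; first exact: measurable_funX.
  by move=> x; exact: sqr_ge0.
have mF2 : measurable_fun (A `*` B) (fun x => F x ^+ 2) by exact: measurable_funX.
have := integrable_ge0_lty (fun x => sqr_ge0 (F x)) Fi.
rewrite tonelli1// => [Foo|x]; last exact: sqr_ge0.
apply: (@le_lt_trans _ _ (\int[m1]_(x in A) (m2 B * \int[m2]_(y in B) (F (x, y) ^+ 2)%:E))%E).
  apply: ge0_le_integral => //.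
  - by move=> x _; rewrite lee_fin sqr_ge0.
  - by apply/measurable_EFinP; exact: measurable_funX.
  - by apply: emeasurable_funM => //; exact: (measurable_eint1 mF2).
  - by move=> x Ax; apply: Rintegral_sqr_le => //; exact: measurable_section1.
rewrite ge0_integralZl//.
- by rewrite lte_mul_pinfty// ge0_fin_numE.
- exact: (measurable_eint1 mF2).
- by move=> x _; rewrite integral_ge0// => y _; rewrite lee_fin sqr_ge0.
Qed.

Lemma L2_Rintegral2 F : (m1 A < +oo)%E -> L2 m12 (A `*` B) F ->
  L2 m2 B (fun y => \int[m1]_(x in A) F (x, y)).
Proof.
move=> Afin [mF Fi]; have mP := measurable_Rintegral2 mF; split => //.
apply: integrable_ge0 => //; first exact: measurable_funX.
  by move=> x; exact: sqr_ge0.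
have mF2 : measurable_fun (A `*` B) (fun x => F x ^+ 2) by exact: measurable_funX.
have := integrable_ge0_lty (fun x => sqr_ge0 (F x)) Fi.
rewrite tonelli2// => [Foo|x]; last exact: sqr_ge0.
apply: (@le_lt_trans _ _ (\int[m2]_(y in B) (m1 A * \int[m1]_(x in A) (F (x, y) ^+ 2)%:E))%E).
  apply: ge0_le_integral => //.
  - by move=> x _; rewrite lee_fin sqr_ge0.
  - by apply/measurable_EFinP; exact: measurable_funX.
  - by apply: emeasurable_funM => //; exact: (measurable_eint2 mF2).
  - by move=> x Ax; apply: Rintegral_sqr_le => //; exact: measurable_section2.
rewrite ge0_integralZl//.
- by rewrite lte_mul_pinfty// ge0_fin_numE.
- exact: (measurable_eint2 mF2).
- by move=> x _; rewrite integral_ge0// => y _; rewrite lee_fin sqr_ge0.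
Qed.

Lemma integrable_fst (f : T1 -> R) : (m2 B < +oo)%E -> m1.-integrable A (EFin \o f) ->
  m12.-integrable (A `*` B) (EFin \o (fun x => f x.1)).
Proof.
move=> Bfin fi; have mf := integrable_measurable fi.
have mf1 := measurable_fun_fst mf.
move/integrableP: fi => [_ foo]; apply/integrableP; split; first exact/measurable_EFinP.
have -> : (\int[m12]_(x in A `*` B) `|(EFin \o (fun x => f x.1)) x|)%E =
   (\int[m12]_(x in A `*` B) (`|f x.1|)%:E)%E by [].
rewrite (@tonelli1 (fun x => `|f x.1|))//; last exact: measurableT_comp.
under eq_integral do rewrite /= integral_cst//.
rewrite ge0_integralZr//.
- by rewrite muleC lte_mul_pinfty// ge0_fin_numE.
- by do 2 apply: measurableT_comp => //.
Qed.

Lemma integrable_snd (f : T2 -> R) : (m1 A < +oo)%E -> m2.-integrable B (EFin \o f) ->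
  m12.-integrable (A `*` B) (EFin \o (fun x => f x.2)).
Proof.
move=> Afin fi; have mf := integrable_measurable fi.
have mf1 := measurable_fun_snd mf.
move/integrableP: fi => [_ foo]; apply/integrableP; split; first exact/measurable_EFinP.
have -> : (\int[m12]_(x in A `*` B) `|(EFin \o (fun x => f x.2)) x|)%E =
   (\int[m12]_(x in A `*` B) (`|f x.2|)%:E)%E by [].
rewrite (@tonelli2 (fun x => `|f x.2|))//; last exact: measurableT_comp.
under eq_integral do rewrite /= integral_cst//.
rewrite ge0_integralZr//.
- by rewrite muleC lte_mul_pinfty// ge0_fin_numE.
- by do 2 apply: measurableT_comp => //.
Qed.

Lemma L2_fst f : (m2 B < +oo)%E -> L2 m1 A f -> L2 m12 (A `*` B) (fun x => f x.1).
Proof.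
by move=> Bfin [mf fi]; split; [exact: measurable_fun_fst|exact: (integrable_fst Bfin fi)].
Qed.

Lemma L2_snd f : (m1 A < +oo)%E -> L2 m2 B f -> L2 m12 (A `*` B) (fun x => f x.2).
Proof.
by move=> Afin [mf fi]; split; [exact: measurable_fun_snd|exact: (integrable_snd Afin fi)].
Qed.
End FubiniRect.

(** * Absolutely continuous functions and polynomials on an interval *)

Section Line.
Context (R : realType).
Implicit Types (a b k z : R) (f g : R -> R).
Local Notation mu := (@lebesgue_measure R).

Definition I1 a b f := mu.-integrable `]a, b[ (EFin \o f).

(* [lebesgue_measure] lives on [measurableTypeR R], whose display differs from
   that of the canonical measurable structure on [R]. *)
Lemma measurable_oo a b : measurable (`]a, b[ : set (measurableTypeR R)).
Proof. exact: measurable_itv. Qed.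

Lemma lebesgue_itv_fin a b : (mu `]a, b[ < +oo)%E.
Proof. by rewrite lebesgue_measure_itv/=; case: ifP => // _; rewrite ltry. Qed.

Lemma lebesgue_itv_fine a b : a <= b -> fine (mu `]a, b[) = b - a.
Proof.
rewrite le_eqVlt => /predU1P[->|ab]; first by rewrite set_itvoo0 measure0 subrr.
by rewrite lebesgue_measure_itv/= lte_fin ab.
Qed.

Lemma int1_cst a b k : a <= b -> int1 a b (fun=> k) = k * (b - a).
Proof. by move=> ab; rewrite /int1 [LHS]Rintegral_cst// lebesgue_itv_fine. Qed.

Lemma I1_sub a b a' b' f : a <= a' -> b' <= b -> I1 a b f -> I1 a' b' f.
Proof.
move=> aa bb; apply: integrableS => //.
by apply: subset_itvW.
Qed.

Lemma I1_measurable a b f : I1 a b f -> measurable_fun `]a, b[ f.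
Proof. by move=> fi; exact: integrable_measurable fi. Qed.

Lemma I1_bounded (B : R) a b f : measurable_fun `]a, b[ f ->
  (forall z, a < z < b -> `|f z| <= B) -> I1 a b f.
Proof.
move=> mf fB; apply: L2_integrable => //; first exact: lebesgue_itv_fin.
by apply: (@L2_bounded _ _ R mu _ (measurable_itv _) f B) => //; first exact: lebesgue_itv_fin.
Qed.

Lemma I1_cst a b k : I1 a b (fun=> k).
Proof. by apply: (@I1_bounded `|k|) => //; exact: measurable_cst. Qed.

Lemma eq_int1 a b f g : (forall z, a < z < b -> f z = g z) -> int1 a b f = int1 a b g.
Proof.
move=> fg; apply: eq_Rintegral => z /set_mem; rewrite /= in_itv/=; exact: fg.
Qed.

Lemma eq_I1 a b f g : (forall z, a < z < b -> f z = g z) -> I1 a b f -> I1 a b g.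
Proof.
move=> fg; apply: integrable_eq => // z; rewrite /= in_itv/=; exact: fg.
Qed.

Lemma int1_ge a b f : b <= a -> int1 a b f = 0.
Proof.
move=> ba; rewrite /int1 set_itv_ge ?Rintegral_set0 ?bnd_simp -?leNgt//.
exact: Rintegral_set0.
Qed.

Lemma int1_split c a b f : a <= c -> c <= b -> I1 a b f ->
  int1 a b f = int1 a c f + int1 c b f.
Proof.
move=> ac; rewrite le_eqVlt => /predU1P[->|cb] fi.
  by rewrite (int1_ge _ (lexx b)) addr0.
have := @Rintegral_itvB R f (BRight a) (BLeft b) c fi.
move=> h; have {h} := h ltac:(by rewrite bnd_simp) ltac:(by rewrite bnd_simp).
rewrite -[int1 c b f]/(Rintegral _ _ _) => <-.
rewrite -Rintegral_itv_bndo_bndc; first by rewrite /int1 /Rintegral addrC subrK.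
by apply: I1_sub fi => //; exact: ltW.
Qed.

(** Trades a variable interval for an indicator under a fixed one, which makes the dependence on the
    end points accessible to Fubini. *)
Lemma int1_cond a b a' b' f : a <= a' -> b' <= b ->
  int1 a' b' f = int1 a b (fun z => if a' < z < b' then f z else 0).
Proof.
move=> aa bb; rewrite /int1 -!/(Rintegral _ _ _).
have -> : `]a', b'[%classic = `]a, b[ `&` `]a', b'[ :> set R.
  by rewrite setIidr//; apply: subset_itvW.
rewrite Rintegral_mkcondr; apply: eq_Rintegral => z _; rewrite patchE.
by rewrite mem_setE in_itv.
Qed.

Lemma I1_cond a b a' b' f : a <= a' -> b' <= b ->
  I1 a' b' f -> I1 a b (fun z => if a' < z < b' then f z else 0).
Proof.
move=> aa bb fi.
have -> : (fun z => if a' < z < b' then f z else 0) = f \_ `]a', b'[.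
  by apply/funext => z; rewrite patchE mem_setE in_itv.
rewrite /I1 -restrict_EFin; apply/integrable_restrict => //.
by apply: integrableS fi => //; exact: measurableI.
Qed.

Lemma int1D a b f g : I1 a b f -> I1 a b g ->
  int1 a b (fun z => f z + g z) = int1 a b f + int1 a b g.
Proof. by move=> fi gi; rewrite /int1 -!/(Rintegral _ _ _) RintegralD. Qed.

Lemma int1B a b f g : I1 a b f -> I1 a b g ->
  int1 a b (fun z => f z - g z) = int1 a b f - int1 a b g.
Proof. by move=> fi gi; rewrite /int1 -!/(Rintegral _ _ _) RintegralB. Qed.

Lemma int1Z a b k f : measurable_fun `]a, b[ f ->
  int1 a b (fun z => k * f z) = k * int1 a b f.
Proof. by move=> fi; rewrite /int1 -!/(Rintegral _ _ _) Rintegral_scale. Qed.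

Lemma int1_sum (I : finType) (P : pred I) a b (h : I -> R -> R) :
  (forall i, P i -> I1 a b (h i)) ->
  int1 a b (fun z => \sum_(i | P i) h i z) = \sum_(i | P i) int1 a b (h i) /\
  I1 a b (fun z => \sum_(i | P i) h i z).
Proof. by move=> hi; exact: (Rintegral_sum (measurable_oo a b) (index_enum I) hi). Qed.

Lemma le_int1 a b f g : I1 a b f -> I1 a b g ->
  (forall z, a < z < b -> f z <= g z) -> int1 a b f <= int1 a b g.
Proof.
move=> fi gi fg; apply: le_Rintegral => // z; rewrite /= in_itv/=; exact: fg.
Qed.

Lemma int1_ge0 a b f : (forall z, a < z < b -> 0 <= f z) -> 0 <= int1 a b f.
Proof. by move=> f0; apply: Rintegral_ge0 => z; rewrite /= in_itv/=; exact: f0. Qed.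

Lemma normr_int1_le a b f : I1 a b f -> `|int1 a b f| <= int1 a b (fun z => `|f z|).
Proof. exact: le_normr_Rintegral. Qed.

Lemma I1_norm a b f : I1 a b f -> I1 a b (fun z => `|f z|).
Proof. by move=> fi; have := integrable_norm fi. Qed.

Lemma normr_int1_sub_le a b a' b' f : a <= a' -> b' <= b -> I1 a b f ->
  `|int1 a' b' f| <= int1 a b (fun z => `|f z|).
Proof.
move=> aa bb fi; have fi' := I1_sub aa bb fi.
apply: (le_trans (normr_int1_le fi')); rewrite (int1_cond _ aa bb).
apply: le_int1 => //; [exact: (I1_cond aa bb (I1_norm fi'))|exact: I1_norm|].
by move=> z _; case: ifP.
Qed.

(** Absolute continuity in integrated form, as [isV] demands of every line; the end points are
    included so that traces there are plain values. *)
Definition AC1 a b (f f' : R -> R) := I1 a b f' /\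
  forall z1 z2, a <= z1 -> z1 <= z2 -> z2 <= b -> f z2 - f z1 = int1 z1 z2 f'.

Lemma AC1_sub a b a' b' f f' : a <= a' -> b' <= b -> AC1 a b f f' -> AC1 a' b' f f'.
Proof.
move=> aa bb [fi fE]; split; first exact: I1_sub fi.
by move=> z1 z2 h1 h2 h3; apply: fE => //; lra.
Qed.

Lemma AC1_primitive a b k f' : I1 a b f' -> AC1 a b (fun z => k + int1 a z f') f'.
Proof.
move=> fi; split => // z1 z2 h1 h2 h3.
rewrite (@int1_split z1 a z2)//; first by lra.
exact: I1_sub fi.
Qed.

Lemma AC1_bounded a b f f' : a <= b -> AC1 a b f f' ->
  forall z, a <= z <= b -> `|f z| <= `|f a| + int1 a b (fun z => `|f' z|).
Proof.
move=> ab [fi fE] z /andP[az zb].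
have -> : f z = f a + int1 a z f' by rewrite -fE//; lra.
by apply: (le_trans (ler_normD _ _)); rewrite lerD2l; exact: normr_int1_sub_le.
Qed.

Lemma measurable_ltr2 a b a' b' : measurable_fun (`]a, b[ `*` `]a', b'[)
   (fun x : R * R => x.2 < x.1).
Proof. by apply: measurable_fun_ltr; exact: measurable_funTS. Qed.

(** [f z] is [f a] plus a partial integral of the jointly measurable function [f' y] cut off to
    [y < z], so measurability follows from Fubini. *)
Lemma measurable_AC1 a b f f' : AC1 a b f f' -> measurable_fun `]a, b[ f.
Proof.
move=> [fi fE].
pose F (x : R * R) := if x.2 < x.1 then f' x.2 else 0.
have mF : measurable_fun (`]a, b[ `*` `]a, b[) F.
  apply: measurable_fun_if => //.
  - exact: measurableX.
  - exact: measurable_ltr2.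
  - apply: (@measurable_funS _ _ _ _ (`]a, b[ `*` `]a, b[)) => //.
      exact: measurableX.
    by apply: measurable_fun_snd => //; exact: integrable_measurable fi.
have mi := measurable_Rintegral1 mu (measurable_itv _) (measurable_itv _) mF.
have : measurable_fun `]a, b[ (fun z => f a + \int[mu]_(y in `]a, b[) F (z, y)).
  exact: measurable_funD.
apply: eq_measurable_fun => z /set_mem; rewrite /= in_itv/= => /andP[az zb].
rewrite [X in _ + X](_ : _ = int1 a z f').
  by rewrite -fE//; [ring|exact: ltW..].
rewrite (@int1_cond a b)//; last exact: ltW.
by apply: eq_int1 => y /andP[ay yb]; rewrite /F/= ay.
Qed.

(** An absolutely continuous function is bounded, so both products are integrable; the conclusion
    records this because later sums over elements split the integral. *)
Lemma AC1_ibp a b f f' g g' : a <= b -> AC1 a b f f' -> AC1 a b g g' ->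
  [/\ I1 a b (fun z => f' z * g z), I1 a b (fun z => f z * g' z) &
  int1 a b (fun z => f' z * g z + f z * g' z) = f b * g b - f a * g a].
Proof.
move=> ab ACf ACg; have [fi fE] := ACf; have [gi gE] := ACg.
have mf' := I1_measurable fi; have mg' := I1_measurable gi.
have i1 : I1 a b (fun z => f' z * g z).
  pose B : R := `|g a| + int1 a b (fun z => `|g' z|).
  apply: (@integrable_le _ _ R mu _ (measurable_itv _) _ (fun z => B * `|f' z|)) => //.
  - apply: measurable_funM => //; exact: measurable_AC1 ACg.
  - by apply: integrable_scale => //; exact: I1_norm.
  - move=> z; rewrite /= in_itv/= => /andP[az zb]; rewrite normrM mulrC ler_wpM2r//.
    by apply: (AC1_bounded ab ACg); rewrite (ltW az) (ltW zb).
have i2 : I1 a b (fun z => f z * g' z).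
  pose B : R := `|f a| + int1 a b (fun z => `|f' z|).
  apply: (@integrable_le _ _ R mu _ (measurable_itv _) _ (fun z => B * `|g' z|)) => //.
  - apply: measurable_funM => //; exact: measurable_AC1 ACf.
  - by apply: integrable_scale => //; exact: I1_norm.
  - move=> z; rewrite /= in_itv/= => /andP[az zb]; rewrite normrM ler_wpM2r//.
    by apply: (AC1_bounded ab ACf); rewrite (ltW az) (ltW zb).
split => //.
(* Both [f' (g b - g)] and [(f - f a) g'] are marginals of [f'(s) g'(z)] on [s < z]. *)
pose F (x : R * R) := if x.1 < x.2 then f' x.1 * g' x.2 else 0.
have mF : measurable_fun (`]a, b[ `*` `]a, b[) F.
  apply: measurable_fun_if => //.
  - exact: measurableX.
  - by apply: measurable_fun_ltr; exact: measurable_funTS.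
  - apply: (@measurable_funS _ _ _ _ (`]a, b[ `*` `]a, b[)) => //.
      exact: measurableX.
    by apply: measurable_funM; [exact: measurable_fun_fst|exact: measurable_fun_snd].
have Fi : (mu \x mu)%E.-integrable (`]a, b[ `*` `]a, b[) (EFin \o F).
  apply/integrableP; split; first exact/measurable_EFinP.
  have mabs : measurable_fun (`]a, b[ `*` `]a, b[) (fun x => `|f' x.1| * `|g' x.2|).
    apply: measurable_funM; apply: measurableT_comp => //.
      exact: measurable_fun_fst.
    exact: measurable_fun_snd.
  apply: (@le_lt_trans _ _ (\int[(mu \x mu)%E]_(x in `]a, b[ `*` `]a, b[) (`|f' x.1| * `|g' x.2|)%:E)%E).
    apply: ge0_le_integral => //.
    - exact: measurableX.
    - by do 2 apply: measurableT_comp => //.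
    - exact/measurable_EFinP.
    - by move=> x _; rewrite /= /F lee_fin; case: ifP => _; rewrite ?normrM// normr0 mulr_ge0.
  rewrite tonelli1//=.
  have gfin : (\int[mu]_(y in `]a, b[) `|(g' y)%:E| < +oo)%E by case/integrableP: gi.
  have ffin : (\int[mu]_(y in `]a, b[) `|(f' y)%:E| < +oo)%E by case/integrableP: fi.
  have -> : (\int[mu]_(x in `]a, b[) \int[mu]_(y in `]a, b[) (`|f' x| * `|g' y|)%:E =
     \int[mu]_(x in `]a, b[) (`|(f' x)%:E| * \int[mu]_(y in `]a, b[) `|(g' y)%:E|))%E.
    apply: eq_integral => x _; under eq_integral do rewrite EFinM.
    by rewrite ge0_integralZl//; do 2 apply: measurableT_comp => //.
  have mabsf : measurable_fun `]a, b[ (fun x => `|(f' x)%:E|)%E.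
    by do 2 apply: measurableT_comp => //.
  have g0 : (0 <= \int[mu]_(y in `]a, b[) `|(g' y)%:E|)%E by rewrite integral_ge0.
  rewrite ge0_integralZr// muleC lte_mul_pinfty// ge0_fin_numE//.
have [_ e1] := fubini1 (measurable_oo a b) (measurable_oo a b) Fi.
have [_ e2] := fubini2 (measurable_oo a b) (measurable_oo a b) Fi.
have E1 : \int[mu]_(x in `]a, b[) \int[mu]_(y in `]a, b[) F (x, y) =
   int1 a b (fun z => g b * f' z - f' z * g z).
  apply: eq_int1 => s /andP[as_ sb].
  transitivity (f' s * int1 s b g').
    rewrite -int1Z; last by apply: I1_measurable; apply: I1_sub gi => //; exact: ltW.
    rewrite (@int1_cond a b s b _ (ltW as_) (lexx b)); apply: eq_int1 => y /andP[ay yb].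
    by rewrite /F/= yb andbT.
  by rewrite -(gE s b (ltW as_) (ltW sb) (lexx b)); ring.
have E2 : \int[mu]_(y in `]a, b[) \int[mu]_(x in `]a, b[) F (x, y) =
   int1 a b (fun z => f z * g' z - f a * g' z).
  apply: eq_int1 => z /andP[az zb].
  transitivity (g' z * int1 a z f').
    rewrite -int1Z; last by apply: I1_measurable; apply: I1_sub fi => //; exact: ltW.
    rewrite (@int1_cond a b a z _ (lexx a) (ltW zb)); apply: eq_int1 => y /andP[ay yb].
    by rewrite /F/= ay/= mulrC.
  by rewrite -(fE a z (lexx a) (ltW az) (ltW zb)); ring.
move: e1; rewrite e2 E1 E2 !int1B//; do ?exact: integrable_scale.
rewrite !int1Z// -(fE a b (lexx a) ab (lexx b)) -(gE a b (lexx a) ab (lexx b)) int1D//.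
by move=> e; lra.
Qed.
End Line.

(** * Inverse and discrete trace inequalities for polynomials *)

Section Polynomials.
Context (R : realType).
Implicit Types (p : {poly R}) (a b : R).
Local Notation mu := (@lebesgue_measure R).

Lemma measurable_horner p (D : set R) : measurable_fun D (horner p).
Proof. by apply: measurable_funTS; apply: continuous_measurable_fun; exact: continuous_horner. Qed.

Lemma I1_poly a b p : I1 a b (horner p).
Proof.
apply: (@integrableS _ _ _ mu `[a, b]) => //; first exact: subset_itv_oo_cc.
apply: continuous_compact_integrable; first exact: segment_compact.
apply: continuous_subspaceT; exact: continuous_horner.
Qed.

Lemma L2_poly a b p : L2 mu `]a, b[ (horner p).
Proof.
split; first exact: measurable_horner.
by apply: eq_I1 (I1_poly a b (p ^+ 2)) => x _; rewrite horner_exp.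
Qed.

Lemma int1_deriv a b p : a <= b -> int1 a b (horner p^`()) = p.[b] - p.[a].
Proof.
rewrite le_eqVlt => /predU1P[->|ab]; first by rewrite int1_ge ?subrr.
have := @continuous_FTC2 R (horner p^`()) (horner p) a b ab.
move=> h; have {h} : (\int[mu]_(x in `[a, b]) (p^`().[x])%:E = (p.[b])%:E - (p.[a])%:E)%E.
  apply: h.
  - apply: continuous_subspaceT; exact: continuous_horner.
  - split.
    + by move=> x _; exact: derivable_horner.
    + by apply: cvg_at_right_filter; exact: continuous_horner.
    + by apply: cvg_at_left_filter; exact: continuous_horner.
  - by move=> x _; rewrite -derivE.
move=> e; rewrite /int1 integral_itv_obnd_cbnd ?integral_itv_bndo_bndc ?e//.
- by apply/measurable_EFinP; exact: measurable_horner.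
- by apply/measurable_EFinP; exact: measurable_horner.
Qed.

Lemma AC1_poly a b p : AC1 a b (horner p) (horner p^`()).
Proof. by split=> [|z1 z2 _ z12 _]; [exact: I1_poly|rewrite int1_deriv]. Qed.

Definition primitive_poly p : {poly R} :=
  \poly_(i < (size p).+1) (p`_i.-1 / i%:R *+ (i != 0%N)).

Lemma deriv_primitive_poly p : (primitive_poly p)^`() = p.
Proof.
apply/polyP => i; rewrite coef_deriv coef_poly ltnS; case: ltnP => ip /=.
  by rewrite mulr1n -[LHS]mulr_natr mulfVK// pnatr_eq0.
by rewrite mul0rn nth_default.
Qed.

(** The substitution is the chain rule: both integrals are differences of values of a primitive [P],
    respectively of [P \Po l]. *)
Lemma int1_affine a b p : a < b ->
  int1 a b (horner p) = (b - a) * int1 0 1 (horner (p \Po ((b - a) *: 'X + a%:P))).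
Proof.
move=> ab; set l := _ *: 'X + _; set P := primitive_poly p.
rewrite -int1Z; last exact: measurable_horner.
have l0 : l.[0] = a by rewrite /l hornerD hornerZ hornerX hornerC mulr0 add0r.
have l1 : l.[1] = b by rewrite /l hornerD hornerZ hornerX hornerC mulr1 subrK.
have dl : l^`() = (b - a)%:P.
  by rewrite /l derivD derivZ derivX derivC addr0 -mul_polyC mulr1.
transitivity (int1 0 1 (horner (P \Po l)^`())).
  rewrite int1_deriv// !horner_comp l0 l1 -int1_deriv ?ltW//.
  by rewrite deriv_primitive_poly.
apply: eq_int1 => x _; rewrite deriv_comp dl deriv_primitive_poly.
by rewrite hornerM hornerC mulrC.
Qed.

(** The primitive of [p ^+ 2] that vanishes at 0 is nonnegative on [[0, 1]] and bounded there by the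
    total integral 0. It vanishes on the whole interval, hence is the zero polynomial, and so is its
    derivative [p ^+ 2]. *)
Lemma int1_sqr_eq0 p : int1 0 1 (fun x => p.[x] ^+ 2) = 0 -> p = 0.
Proof.
move=> p0; set P := primitive_poly (p ^+ 2); set Q := P - P.[0]%:P.
have dQ : Q^`() = p ^+ 2 by rewrite derivB derivC subr0 deriv_primitive_poly.
have Qroot x : 0 <= x <= 1 -> root Q x.
  move=> /andP[x0 x1]; apply/rootP; have := int1_deriv Q x0.
  have -> : Q.[0] = 0 by rewrite !hornerE subrr.
  rewrite subr0 dQ => <-; apply: le_anti; apply/andP; split; last first.
    by apply: int1_ge0 => z _; rewrite horner_exp sqr_ge0.
  rewrite -[leRHS]p0 (@int1_cond R 0 1 0 x)//; apply: le_int1.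
  - by apply: I1_cond => //; exact: I1_poly.
  - by apply: eq_I1 (I1_poly 0 1 (p ^+ 2)) => y _; rewrite horner_exp.
  - by move=> y _; case: ifP => _; rewrite ?horner_exp// sqr_ge0.
have Q0 : Q = 0.
  (* [size Q] distinct points of [[0, 1]], more roots than a nonzero [Q] can have. *)
  pose rs := [seq (i.+1%:R : R)^-1 | i <- iota 0 (size Q)].
  apply: (@roots_geq_poly_eq0 _ Q rs); last by rewrite size_map size_iota.
    apply/allP => x /mapP[i _ ->]; apply: Qroot.
    by rewrite invr_ge0 ler0n/= invf_le1 ?ltr0n// ler1n.
  rewrite map_inj_uniq ?iota_uniq// => i j /invr_inj /eqP.
  by rewrite eqr_nat => /eqP[].
by apply/eqP; have := expf_eq0 p 2; rewrite -dQ Q0 deriv0 eqxx/= => <-.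
Qed.

(* The coefficients are recovered from the moments through the inverse Gram matrix of
   the monomials. *)
Lemma poly_coef_bound (n : nat) : exists2 K : R, 0 <= K &
  forall p, (size p <= n)%N -> forall i : 'I_n,
    `|p`_i| <= K * Num.sqrt (int1 0 1 (fun x => p.[x] ^+ 2)).
Proof.
pose G : 'M[R]_n := \matrix_(i, j) int1 0 1 (fun x => x ^+ i * x ^+ j).
have vG (v : 'rV[R]_n) j : (v *m G) 0 j = int1 0 1 (fun x => (rVpoly v).[x] * x ^+ j).
  rewrite mxE.
  have Ii (i : 'I_n) : true -> I1 0 1 (fun x => v 0 i * (x ^+ i * x ^+ j)).
    move=> _; apply: eq_I1 (I1_poly 0 1 (v 0 i *: ('X^i * 'X^j))) => x _.
    by rewrite ?hornerZ hornerM !hornerXn.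
  transitivity (\sum_(i < n) int1 0 1 (fun x => v 0 i * (x ^+ i * x ^+ j))).
    apply: eq_bigr => i _; rewrite int1Z; first by rewrite mxE.
    apply: I1_measurable; apply: eq_I1 (I1_poly 0 1 ('X^i * 'X^j)) => x _.
    by rewrite ?hornerZ hornerM !hornerXn.
  have [<- _] := int1_sum Ii; apply: eq_int1 => x _.
  rewrite (horner_coef_wide _ (size_poly _ _)) mulr_suml; apply: eq_bigr => i _.
  by rewrite coef_rVpoly_ord mulrA.
have pI p q : I1 0 1 (fun x => p.[x] * q.[x]).
  by apply: eq_I1 (I1_poly 0 1 (p * q)) => x _; rewrite hornerM.
(* A vector in the kernel of the Gram matrix gives a polynomial orthogonal to all monomials, hence
   to itself. *)
have Gu : G \in unitmx.
  rewrite -row_free_unit; apply: inj_row_free => v vG0.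
  apply: (can_inj rVpolyK); rewrite [RHS]linear0; apply: int1_sqr_eq0.
  transitivity (int1 0 1 (fun x => \sum_(j < n) v 0 j * ((rVpoly v).[x] * x ^+ j))).
    apply: eq_int1 => x _; rewrite expr2 {2}(horner_coef_wide _ (size_poly _ _)).
    by rewrite mulr_sumr; apply: eq_bigr => i _; rewrite coef_rVpoly_ord mulrCA.
  have Ij (j : 'I_n) : I1 0 1 (fun x => (rVpoly v).[x] * x ^+ j).
    by apply: eq_I1 (pI (rVpoly v) 'X^j) => x _; rewrite hornerXn.
  have [-> _] := int1_sum (fun (j : 'I_n) (_ : true) =>
     integrable_scale (measurable_oo 0 1) (v 0 j) (Ij j)).
  rewrite big1// => j _; rewrite int1Z; last exact: I1_measurable (Ij j).
  by rewrite -vG vG0 mxE mulr0.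
pose K := \sum_(i < n) \sum_(j < n) `|invmx G j i|.
exists K; first by apply: sumr_ge0 => i _; apply: sumr_ge0.
move=> p pn i; set N := Num.sqrt _.
have N0 : 0 <= N by exact: sqrtr_ge0.
have pE : p`_i = \sum_(j < n) int1 0 1 (fun x => p.[x] * x ^+ j) * invmx G j i.
  transitivity ((poly_rV p *m G *m invmx G) 0 i); first by rewrite mulmxK// mxE.
  by rewrite mxE; apply: eq_bigr => j _; rewrite vG poly_rV_K.
have jN (j : 'I_n) : `|int1 0 1 (fun x => p.[x] * x ^+ j)| <= N.
  have := psd_sqr_le (L2_psd (measurable_oo 0 1) (L2_poly 0 1 p) (L2_poly 0 1 'X^j)).
  move=> [p0 x0 h]; rewrite -sqrtr_sqr ler_sqrt//.
  have -> : int1 0 1 (fun x => p.[x] * x ^+ j) = int1 0 1 (fun x => p.[x] * ('X^j).[x]).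
    by apply: eq_int1 => x _; rewrite hornerXn.
  apply: (le_trans h); rewrite -[leRHS]mulr1; apply: ler_wpM2l => //.
  have e1 : int1 0 1 (fun=> 1) = 1 :> R by rewrite int1_cst// subr0 mulr1.
  rewrite -[leRHS]e1; apply: le_int1; [exact: (L2_poly 0 1 'X^j).2|exact: I1_cst|].
  by move=> x /andP[x0' x1]; rewrite hornerXn -exprM; apply: exprn_ile1; exact: ltW.
rewrite pE (le_trans (ler_norm_sum _ _ _))//.
apply: (@le_trans _ _ (\sum_(j < n) N * `|invmx G j i|)).
  by apply: ler_sum => j _; rewrite normrM ler_wpM2r// jN.
rewrite -mulr_sumr mulrC ler_wpM2r// /K [leRHS](bigD1 i)//= lerDl.
by apply: sumr_ge0 => k _; apply: sumr_ge0.
Qed.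

(** On [[0, 1]] the derivative is at most the sum of its coefficients in absolute value: [n] terms
    with factors [i.+1 <= n], which gives [n * (n * K)]. Only finiteness of this constant matters:
    it makes the infimum defining [Cie] one over a nonempty set. *)
Lemma inverse_inequality01 (n : nat) : exists2 K : R, 0 <= K &
  forall p, (size p <= n)%N ->
    int1 0 1 (fun x => p^`().[x] ^+ 2) <= K * int1 0 1 (fun x => p.[x] ^+ 2).
Proof.
have [K K0 hK] := poly_coef_bound n; pose C := n%:R * (n%:R * K).
exists (C ^+ 2); first exact: sqr_ge0.
move=> p pn; set X := int1 0 1 (fun x => p.[x] ^+ 2).
have X0 : 0 <= X by apply: int1_ge0 => x _; exact: sqr_ge0.
pose N := Num.sqrt X; have N2 : N ^+ 2 = X by rewrite sqr_sqrtr.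
have N0 : 0 <= N by exact: sqrtr_ge0.
have dn : (size p^`() <= n)%N by apply: leq_trans (leq_trans (size_poly _ _) (leq_pred _)) pn.
rewrite -N2 -exprMn.
have -> : (C * N) ^+ 2 = int1 0 1 (fun=> (C * N) ^+ 2).
  by rewrite int1_cst// subr0 mulr1.
apply: le_int1; [exact: (L2_poly 0 1 p^`()).2|exact: I1_cst|].
move=> x /andP[x0 x1]; rewrite -[leLHS]ger0_norm ?sqr_ge0// normrX.
have C0 : 0 <= C by rewrite /C !mulr_ge0.
rewrite ler_pXn2r ?nnegrE// ?mulr_ge0//.
rewrite (horner_coef_wide _ dn) (le_trans (ler_norm_sum _ _ _))//.
apply: (@le_trans _ _ (\sum_(i < n) n%:R * (K * N))); last first.
  by rewrite sumr_const card_ord -[leLHS]mulr_natl /C !mulrA.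
apply: ler_sum => i _; rewrite normrM normrX (ger0_norm (ltW x0)).
apply: (@le_trans _ _ `|p^`()`_i|).
  by rewrite -[leRHS]mulr1 ler_wpM2l// exprn_ile1// ltW.
rewrite coef_deriv; case: (ltnP i.+1 n) => [iln|nli]; last first.
  rewrite (_ : p`_i.+1 = 0) ?mul0rn ?normr0 ?mulr_ge0//.
  by rewrite nth_default// (leq_trans pn).
have h1 : `|p`_i.+1| <= K * N := hK p pn (Ordinal iln).
rewrite -[p`_i.+1 *+ i.+1]mulr_natl normrM normr_nat; apply: ler_pM => //.
by rewrite ler_nat ltnW.
Qed.

Lemma inverse_inequality (n : nat) : exists2 K : R, 0 <= K &
  forall a b, a < b -> forall p, (size p <= n)%N ->
    int1 a b (fun x => p^`().[x] ^+ 2) <=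
    K / (b - a) ^+ 2 * int1 a b (fun x => p.[x] ^+ 2).
Proof.
have [K K0 hK] := inverse_inequality01 n; exists K => // a b ab p pn.
set l := (b - a) *: 'X + a%:P; have h0 : 0 < b - a by rewrite subr_gt0.
have dl : l^`() = (b - a)%:P.
  by rewrite /l derivD derivZ derivX derivC addr0 -mul_polyC mulr1.
have sl : (size l <= 2)%N.
  rewrite (leq_trans (size_polyD _ _))// geq_max (leq_trans (size_scale_leq _ _)) ?size_polyX//.
  by rewrite (leq_trans (size_polyC_leq1 _)).
have sq : (size (p \Po l) <= n)%N.
  have [->|p0] := eqVneq p 0; first by rewrite comp_poly0 size_poly0.
  apply: leq_trans (size_comp_poly_leq _ _) _.
  rewrite (leq_trans _ pn)// -[X in (_ <= X)%N]prednK ?size_poly_gt0// ltnS.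
  by rewrite -[X in (_ <= X)%N]muln1 leq_mul2l; case: (size l) sl => [|[|[|]]]//= _; rewrite orbT.
have E q : int1 a b (fun x => q.[x] ^+ 2) = (b - a) * int1 0 1 (fun x => (q \Po l).[x] ^+ 2).
  transitivity (int1 a b (horner (q ^+ 2))).
    by apply: eq_int1 => x _; rewrite horner_exp.
  rewrite int1_affine// -/l; congr (_ * _).
  by apply: eq_int1 => x _; rewrite !(horner_comp, horner_exp).
have := hK _ sq; rewrite !E.
have -> : int1 0 1 (fun x => (p \Po l)^`().[x] ^+ 2) =
  (b - a) ^+ 2 * int1 0 1 (fun x => (p^`() \Po l).[x] ^+ 2).
  rewrite -int1Z; last by case: (L2_poly 0 1 (p^`() \Po l)) => _ /I1_measurable.
  by apply: eq_int1 => x _; rewrite deriv_comp dl hornerM hornerC; ring.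
move=> h; have hb : (b - a) ^+ 2 != 0 by rewrite expf_neq0// gt_eqF.
rewrite [leRHS](_ : _ = (b - a) * ((b - a) ^- 2 * (K * int1 0 1 (fun x => (p \Po l).[x] ^+ 2)))); last by ring.
by rewrite ler_pM2l// mulrC ler_pdivlMr ?exprn_gt0// mulrC.
Qed.

Lemma Cie_ge0 k : 0 <= Cie k :> R.
Proof.
rewrite /Cie; set E := [set C | _].
have [->|/set0P E0] := eqVneq E set0; first by rewrite inf0.
by apply: lb_le_inf => // C [].
Qed.

(** The infimum is itself an admissible constant: for fixed [p] the quotient of the two sides is a
    lower bound of the admissible constants, which exist by [inverse_inequality]. If [p] has zero
    norm there is no quotient, and that lemma gives [Y = 0] directly. *)
Lemma Cie_inverse k a b p : a < b -> (size p <= k.+1)%N ->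
  (b - a) ^+ 2 * int1 a b (fun x => p^`().[x] ^+ 2) <= Cie k * int1 a b (fun x => p.[x] ^+ 2).
Proof.
move=> ab pk; have h0 : 0 < b - a by rewrite subr_gt0.
set Y := int1 a b _; set X := int1 a b _.
have Y0 : 0 <= Y by apply: int1_ge0 => x _; exact: sqr_ge0.
have X0 : 0 <= X by apply: int1_ge0 => x _; exact: sqr_ge0.
have [K K0 hK] := inverse_inequality k.+1.
move: X0; rewrite le_eqVlt => /predU1P[X0|X0].
  have := hK a b ab p pk; rewrite -/X -/Y -X0 !mulr0 => Yle.
  have -> : Y = 0 by apply/eqP; rewrite eq_le Yle.
  by rewrite mulr0.
rewrite -ler_pdivrMr//; apply: lb_le_inf.
  exists K; split => // a' b' ab' q qk; rewrite -subr_gt0 in ab'.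
  have h := hK a' b' _ q qk; rewrite subr_gt0 in ab'; have {}h := h ab'.
  rewrite -subr_gt0 in ab'.
  have -> : b' - a' = Num.sqrt ((b' - a') ^+ 2) by rewrite sqrtr_sqr gtr0_norm.
  rewrite -sqrtrV ?sqr_ge0// -sqrtrM// -sqrtrM ?divr_ge0 ?sqr_ge0//.
  by rewrite ler_wsqrtr.
move=> C [C0 hC]; rewrite ler_pdivrMr//.
have := hC a b ab p pk; rewrite -/X -/Y => h.
have hY : Y = Num.sqrt Y ^+ 2 by rewrite sqr_sqrtr.
have hX : X = Num.sqrt X ^+ 2 by rewrite sqr_sqrtr// ltW.
have hCC : C = Num.sqrt C ^+ 2 by rewrite sqr_sqrtr.
rewrite hY hX hCC -!exprMn ler_pXn2r ?nnegrE ?mulr_ge0 ?sqrtr_ge0 ?(ltW h0)//.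
by rewrite -ler_pdivlMl// mulrA [X in X * _]mulrC.
Qed.

Lemma Cdt_ge1 k : 1 <= Cdt k :> R.
Proof. by rewrite /Cdt lerDl mulr_ge0// sqrtr_ge0. Qed.

(* Integrate the derivative of [(b - x) p^2], respectively [(x - a) p^2]. *)
Lemma discrete_trace k a b p : a < b -> (size p <= k.+1)%N ->
  (b - a) * p.[a] ^+ 2 <= Cdt k * int1 a b (fun x => p.[x] ^+ 2) /\
  (b - a) * p.[b] ^+ 2 <= Cdt k * int1 a b (fun x => p.[x] ^+ 2).
Proof.
move=> ab pk; have h0 : 0 < b - a by rewrite subr_gt0.
have := Cie_inverse ab pk; have p2 := L2_poly a b p; have d2 := L2_poly a b p^`().
have nL2 q : L2 mu `]a, b[ (fun x => `|q.[x]|).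
  apply: (L2_le (measurable_oo a b) _ (L2_poly a b q)) => [|x _]; last by rewrite normr_id.
  by apply: measurableT_comp => //; exact: measurable_horner.
have := psd_sqr_le (L2_psd (measurable_oo a b) (nL2 p) (nL2 p^`())).
set W := Rintegral _ _ (fun x => _ * _).
have nI q : Rintegral mu `]a, b[ (fun x => `|q.[x]| ^+ 2) = int1 a b (fun x => q.[x] ^+ 2).
  by apply: eq_int1 => x _; rewrite real_normK ?num_real.
have Wi := L2_mul (measurable_oo a b) (nL2 p) (nL2 p^`()).
rewrite !nI; set X := int1 a b (fun x => p.[x] ^+ 2); set Y := int1 a b (fun x => p^`().[x] ^+ 2).
move=> [X0 Y0 WXY] hY.
have W0 : 0 <= W by apply: Rintegral_ge0 => x _; rewrite mulr_ge0.
have S0 := sqrtr_ge0 (Cie k : R).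
(* By Cauchy-Schwarz and the inverse inequality, the mixed integral of [p] and its derivative costs
   a factor [Num.sqrt (Cie k)]. *)
have hW : (b - a) * W <= Num.sqrt (Cie k) * X.
  rewrite -(@ler_pXn2r _ 2)// ?nnegrE ?mulr_ge0// ?(ltW h0)//.
  rewrite !exprMn sqr_sqrtr ?Cie_ge0//.
  apply: (@le_trans _ _ ((b - a) ^+ 2 * (X * Y))); first by rewrite ler_wpM2l ?sqr_ge0.
  by rewrite mulrCA [X ^+ 2]expr2 [leRHS]mulrCA ler_wpM2l.
(* [q] stands for the weight [b - x] or [x - a], which has slope of modulus 1, is at most [b - a]
   and vanishes at one end. Differentiating [q] gives the 1 in [Cdt k], differentiating [p ^+ 2]
   gives [2 * Num.sqrt (Cie k)]. *)
have key (s : R) (q : {poly R}) : (forall x, a < x < b -> `|q.[x]| <= b - a) ->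
    q^`() = s%:P -> `|s| = 1 ->
    `|(q * p ^+ 2).[b] - (q * p ^+ 2).[a]| <= Cdt k * X.
  move=> qle qs s1; rewrite -(int1_deriv _ (ltW ab)).
  have dE : (q * p ^+ 2)^`() = s *: p ^+ 2 + 2 *: (q * (p * p^`())).
    by rewrite derivM qs -mul_polyC expr2 derivM -mul_polyC polyCMn; ring.
  apply: (le_trans (normr_int1_le (I1_poly a b _))).
  have XW : I1 a b (fun x => p.[x] ^+ 2 + 2 * (b - a) * (`|p.[x]| * `|p^`().[x]|)).
    apply: integrable_add => //; first exact: p2.2.
    exact: integrable_scale.
  apply: (@le_trans _ _ (int1 a b (fun x => p.[x] ^+ 2 + 2 * (b - a) * (`|p.[x]| * `|p^`().[x]|)))).
    apply: le_int1 => //; first by apply: I1_norm; exact: I1_poly.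
    move=> x xab; rewrite dE hornerD !hornerZ horner_exp !hornerM.
    apply: (le_trans (ler_normD _ _)); rewrite !normrM s1 mul1r.
    rewrite -expr2 real_normK ?num_real// lerD2l -mulrA [`|2|]ger0_norm// ler_wpM2l//.
    by rewrite ler_wpM2r ?mulr_ge0// qle.
  rewrite int1D; [|exact: p2.2|exact: integrable_scale].
  rewrite int1Z; last exact: I1_measurable.
  by rewrite -/X -[int1 a b _]/W /Cdt; nra.
split.
- have e : ((b%:P - 'X) * p ^+ 2).[b] - ((b%:P - 'X) * p ^+ 2).[a] = - ((b - a) * p.[a] ^+ 2).
    by rewrite !hornerM !hornerD !hornerN !hornerX !hornerC; ring.
  have := key (-1) (b%:P - 'X); rewrite e.
  have -> : `|- ((b - a) * p.[a] ^+ 2)| = (b - a) * p.[a] ^+ 2.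
    by rewrite normrN ger0_norm// mulr_ge0 ?sqr_ge0// ltW.
  apply; last by rewrite normrN1.
    by move=> x /andP[ax xb]; rewrite hornerD hornerN hornerX hornerC ger0_norm; lra.
  by rewrite derivB derivC derivX sub0r polyCN.
- have e : (('X - a%:P) * p ^+ 2).[b] - (('X - a%:P) * p ^+ 2).[a] = (b - a) * p.[b] ^+ 2.
    by rewrite !hornerM !hornerD !hornerN !hornerX !hornerC; ring.
  have := key 1 ('X - a%:P); rewrite e.
  have -> : `|(b - a) * p.[b] ^+ 2| = (b - a) * p.[b] ^+ 2.
    by rewrite ger0_norm// mulr_ge0 ?sqr_ge0// ltW.
  apply; last by rewrite normr1.
    by move=> x /andP[ax xb]; rewrite hornerD hornerN hornerX hornerC ger0_norm; lra.
  by rewrite derivB derivC derivX subr0.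
Qed.
End Polynomials.

(** * The slab and its meshes *)

Section Domain.
Context (R : realType).
Implicit Types (L : R) (F G : R * R -> R).
Local Notation mu := (@lebesgue_measure R).

Lemma OmE L : Om L = (`]0, L[ : set (measurableTypeR R)) `*` (`]0, 1[ : set (measurableTypeR R)).
Proof. by apply/seteqP; split => -[z m] /=; rewrite !in_itv/=. Qed.

Lemma measurable_Om L : measurable (Om L : set (measurableTypeR R * measurableTypeR R)).
Proof. by rewrite OmE; apply: measurableX; exact: measurable_oo. Qed.

Lemma lam2_Om_fin L : (lam2 (Om L) < +oo :> \bar R)%E.
Proof.
rewrite OmE /lam2 product_measure1E; [|exact: measurable_oo..].
by rewrite lte_mul_pinfty ?lebesgue_itv_fin// ge0_fin_numE ?lebesgue_itv_fin.
Qed.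

Definition I2 L F := lam2.-integrable (Om L) (EFin \o F).

Lemma eq_int2 L F G : (forall x, Om L x -> F x = G x) -> int2 (Om L) F = int2 (Om L) G.
Proof. by move=> FG; apply: eq_Rintegral => x /set_mem; exact: FG. Qed.

Lemma eq_I2 L F G : (forall x, Om L x -> F x = G x) -> I2 L F -> I2 L G.
Proof. exact: (integrable_eq (measurable_Om L)). Qed.

Lemma int2D L F G : I2 L F -> I2 L G ->
  int2 (Om L) (fun x => F x + G x) = int2 (Om L) F + int2 (Om L) G.
Proof. exact: (RintegralD (measurable_Om L)). Qed.

Lemma int2B L F G : I2 L F -> I2 L G ->
  int2 (Om L) (fun x => F x - G x) = int2 (Om L) F - int2 (Om L) G.
Proof. exact: (RintegralB (measurable_Om L)). Qed.

Lemma I2D L F G : I2 L F -> I2 L G -> I2 L (fun x => F x + G x).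
Proof. exact: (integrable_add (measurable_Om L)). Qed.

Lemma I2B L F G : I2 L F -> I2 L G -> I2 L (fun x => F x - G x).
Proof. exact: (integrable_sub (measurable_Om L)). Qed.

Lemma I2Z L k F : I2 L F -> I2 L (fun x => k * F x).
Proof. exact: (integrable_scale (measurable_Om L)). Qed.

Lemma int2_fubini_m L F : I2 L F ->
  I1 0 1 (fun m => int1 0 L (fun z => F (z, m))) /\
  int2 (Om L) F = int1 0 1 (fun m => int1 0 L (fun z => F (z, m))).
Proof. by rewrite /I2 OmE => /(fubini2 (measurable_oo 0 L) (measurable_oo 0 1)). Qed.

Lemma int2_fubini_z L F : I2 L F ->
  I1 0 L (fun z => int1 0 1 (fun m => F (z, m))) /\
  int2 (Om L) F = int1 0 L (fun z => int1 0 1 (fun m => F (z, m))).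
Proof. by rewrite /I2 OmE => /(fubini1 (measurable_oo 0 L) (measurable_oo 0 1)). Qed.

Lemma measurable_slice_m L F (m : R) : measurable_fun (Om L) F -> 0 < m < 1 ->
  measurable_fun `]0, L[ (fun z => F (z, m)).
Proof.
rewrite OmE => mF m01.
by apply: (measurable_section2 (measurable_oo 0 L) (measurable_oo 0 1) mF); rewrite /= in_itv.
Qed.

Lemma measurable_slice_z L F (z : R) : measurable_fun (Om L) F -> 0 < z < L ->
  measurable_fun `](0 : R), 1[ (fun m => F (z, m)).
Proof.
rewrite OmE => mF z0L.
by apply: (measurable_section1 (measurable_oo 0 L) (measurable_oo 0 1) mF); rewrite /= in_itv.
Qed.

Lemma measurable_Om_fst L (f : R -> R) : measurable_fun `]0, L[ f ->
  measurable_fun (Om L) (fun x : R * R => f x.1).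
Proof. by move=> mf; rewrite OmE; exact: (measurable_fun_fst (measurable_oo 0 L) mf). Qed.

Lemma measurable_Om_snd L (f : R -> R) : measurable_fun `](0 : R), 1[ f ->
  measurable_fun (Om L) (fun x : R * R => f x.2).
Proof. by move=> mf; rewrite OmE; exact: (measurable_fun_snd (measurable_oo 0 1) mf). Qed.

Lemma L2fun_fst L (f : R -> R) : L2 mu `]0, L[ f -> L2fun L (fun x => f x.1).
Proof.
move=> f2; have := L2_fst (measurable_oo 0 L) (measurable_oo 0 1) (lebesgue_itv_fin 0 1) f2.
by rewrite -OmE.
Qed.

Lemma L2fun_snd L (f : R -> R) : L2 mu `]0, 1[ f -> L2fun L (fun x => f x.2).
Proof.
move=> f2; have := L2_snd (measurable_oo 0 L) (measurable_oo 0 1) (lebesgue_itv_fin 0 L) f2.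
by rewrite -OmE.
Qed.

Lemma L2fun_Pop L F : L2fun L F -> L2fun L (Pop F).
Proof.
rewrite /L2fun OmE => F2.
have := L2_Rintegral1 (measurable_oo 0 L) (measurable_oo 0 1) (lebesgue_itv_fin 0 1) F2.
by move=> /L2fun_fst; rewrite /L2fun OmE.
Qed.

Lemma L2_int_z L F : L2fun L F -> L2 mu `]0, 1[ (fun m => int1 0 L (fun z => F (z, m))).
Proof.
rewrite /L2fun OmE => F2.
exact: (L2_Rintegral2 (measurable_oo 0 L) (measurable_oo 0 1) (lebesgue_itv_fin 0 L) F2).
Qed.

Lemma ae_slice_m L F : I2 L F ->
  {ae mu, forall m, 0 < m < 1 -> I1 0 L (fun z => F (z, m))}.
Proof.
rewrite /I2 OmE => /(ae_section2 (measurable_oo 0 L) (measurable_oo 0 1)).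
by apply: filterS => m h m01; apply: h; rewrite /= in_itv.
Qed.

Lemma L2funM L F G : L2fun L F -> L2fun L G -> I2 L (fun x => F x * G x).
Proof. by move=> F2 G2; exact: (L2_mul (measurable_Om L) F2 G2). Qed.
End Domain.

(** * Combinatorics of elements and faces along a line *)

Section MeshTheory.
Context (R : realType) (L : R) (st : R -> R) (M : mesh R).
Hypothesis hM : is_mesh L st M.
Implicit Types (K : 'I_(nK R M)) (m : R).

Definition onK m K : bool := (ml R M K < m < mr R M K).

Lemma mesh_bounds K : [/\ 0 <= zl R M K, zl R M K < zr R M K & zr R M K <= L] /\
  [/\ 0 <= ml R M K, ml R M K < mr R M K & mr R M K <= 1].
Proof. by have [h _] := hM; have [? [? [? [? []]]]] := h K. Qed.

Lemma mesh_disjoint m z K K' : onK m K -> onK m K' ->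
  zl R M K < z < zr R M K -> zl R M K' < z < zr R M K' -> K = K'.
Proof.
have [_ [h _]] := hM; move=> mK mK' zK zK'.
by apply: (h K K' (z, m)); rewrite /inK/= ?zK ?zK'.
Qed.

(** Two such elements would overlap just to the right of their common left end; the midpoint up to
    the nearer right end is a witness. *)
Lemma mesh_left_unique m K K' : onK m K -> onK m K' -> zl R M K = zl R M K' -> K = K'.
Proof.
move=> mK mK' e; have [[_ h1 _] _] := mesh_bounds K; have [[_ h2 _] _] := mesh_bounds K'.
apply: (@mesh_disjoint m ((zl R M K + Num.min (zr R M K) (zr R M K')) / 2)) => //.
  have : zl R M K < Num.min (zr R M K) (zr R M K') by rewrite lt_min h1 e h2.
  have : Num.min (zr R M K) (zr R M K') <= zr R M K by rewrite ge_min lexx.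
  by move=> ? ?; apply/andP; split; lra.
have : zl R M K < Num.min (zr R M K) (zr R M K') by rewrite lt_min h1 e h2.
have : Num.min (zr R M K) (zr R M K') <= zr R M K' by rewrite ge_min lexx orbT.
by move=> ? ?; apply/andP; split; lra.
Qed.

Lemma mesh_right_unique m K K' : onK m K -> onK m K' -> zr R M K = zr R M K' -> K = K'.
Proof.
move=> mK mK' e; have [[_ h1 _] _] := mesh_bounds K; have [[_ h2 _] _] := mesh_bounds K'.
apply: (@mesh_disjoint m ((zr R M K + Num.max (zl R M K) (zl R M K')) / 2)) => //.
  have : Num.max (zl R M K) (zl R M K') < zr R M K by rewrite gt_max h1 e h2.
  have : zl R M K <= Num.max (zl R M K) (zl R M K') by rewrite le_max lexx.
  by move=> ? ?; apply/andP; split; lra.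
have : Num.max (zl R M K) (zl R M K') < zr R M K by rewrite gt_max h1 e h2.
have : zl R M K' <= Num.max (zl R M K) (zl R M K') by rewrite le_max lexx orbT.
by move=> ? ?; apply/andP; split; lra.
Qed.

(** Replaces faces by pairs of elements that meet on the line: [m] itself witnesses the nonempty
    overlap, and positive width makes [K1] and [K2] distinct. *)
Lemma onFE m K1 K2 : isF M K1 K2 && (bF M K1 K2 < m < tF M K1 K2) =
  [&& zr R M K1 == zl R M K2, onK m K1 & onK m K2].
Proof.
rewrite /isF /bF /tF /onK; apply/idP/idP.
  move=> /andP[/and3P[_ -> _]]; rewrite gt_max lt_min.
  by move=> /andP[/andP[-> ->] /andP[-> ->]].
move=> /and3P[/eqP e /andP[h1 h2] /andP[h3 h4]].
have h5 : Num.max (ml R M K1) (ml R M K2) < m by rewrite gt_max h1 h3.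
have h6 : m < Num.min (mr R M K1) (mr R M K2) by rewrite lt_min h2 h4.
rewrite e eqxx h5 h6 (lt_trans h5 h6) !andbT.
apply/eqP => e12; have [[_ h _] _] := mesh_bounds K1.
by move: h; rewrite e e12 ltxx.
Qed.

(* Lines [mu = m] carrying no horizontal edge; only there do neighbours match up. *)
Definition generic m := forall K, m != ml R M K /\ m != mr R M K.

Lemma ae_generic : {ae (@lebesgue_measure R), forall m, generic m}.
Proof.
pose S : set R := (range (ml R M)) `|` (range (mr R M)).
have cS : countable S.
  apply: finite_set_countable; rewrite finite_setU; split;
    apply: finite_image; exact: finite_finset.
have mS : measurable (S : set (measurableTypeR R)).
  exact: countable_measurable.
exists S; split => //; first exact: countable_lebesgue_measure0.
move=> m /= nm; apply: contrapT => nS; apply: nm => K; split; apply/eqP => e; apply: nS.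
  by left; exists K.
by right; exists K.
Qed.

Lemma mesh_cover m z : generic m -> 0 < m < 1 -> 0 < z < L ->
  exists K, onK m K /\ zl R M K <= z <= zr R M K.
Proof.
move=> gm m01 z0L; have [_ [_ [h _]]] := hM.
have [K [zK /= /andP[h1 h2]]] := h (z, m) (conj z0L m01).
have [n1 n2] := gm K; exists K; split => //.
by rewrite /onK !lt_neqAle h1 h2 eq_sym n1 n2.
Qed.

(** Among the elements on the line that reach beyond the right end of [K], take the one with the
    leftmost left end. A gap after [K] would contain a point covered by an element starting earlier,
    and a start before the right end of [K] would make it overlap [K]. *)
Lemma mesh_right_neighbour m K : generic m -> 0 < m < 1 -> onK m K -> zr R M K < L ->
  exists K', onK m K' /\ zr R M K = zl R M K'.
Proof.
move=> gm m01 mK zL; have [[z0 zz _] _] := mesh_bounds K.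
pose P K' := onK m K' && (zr R M K < zr R M K').
have cov z : zr R M K < z < L -> exists K', P K' /\ zl R M K' <= z.
  move=> /andP[z1 z2]; have [] := @mesh_cover m z gm m01 _; first by apply/andP; split; lra.
  move=> K' [mK' /andP[h1 h2]]; exists K'; split => //.
  by rewrite /P mK'/=; lra.
have [] := cov ((zr R M K + L) / 2); first by apply/andP; split; lra.
move=> K0 [PK0 _]; case: (arg_minP (zl R M) PK0) => K' /andP[mK' rK'] minK'.
exists K'; split => //; apply: le_anti; apply/andP; split; last first.
  rewrite leNgt; apply/negP => lt1.
  have [] := cov ((zr R M K + zl R M K') / 2).
    by have [[? ? ?] _] := mesh_bounds K'; apply/andP; split; lra.
  by move=> K'' [/minK' h1 h2]; lra.
rewrite leNgt; apply/negP => lt1; have e : K = K'.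
  apply: (@mesh_disjoint m ((zr R M K + Num.max (zl R M K) (zl R M K')) / 2)) => //.
    have : Num.max (zl R M K) (zl R M K') < zr R M K by rewrite gt_max zz lt1.
    have : zl R M K <= Num.max (zl R M K) (zl R M K') by rewrite le_max lexx.
    by move=> ? ?; apply/andP; split; lra.
  have : Num.max (zl R M K) (zl R M K') < zr R M K by rewrite gt_max zz lt1.
  have : zl R M K' <= Num.max (zl R M K) (zl R M K') by rewrite le_max lexx orbT.
  by move=> ? ?; apply/andP; split; lra.
by move: rK'; rewrite e ltxx.
Qed.

Lemma mesh_left_neighbour m K : generic m -> 0 < m < 1 -> onK m K -> 0 < zl R M K ->
  exists K', onK m K' /\ zr R M K' = zl R M K.
Proof.
move=> gm m01 mK z0; have [[_ zz zL] _] := mesh_bounds K.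
pose P K' := onK m K' && (zl R M K' < zl R M K).
have cov z : 0 < z < zl R M K -> exists K', P K' /\ z <= zr R M K'.
  move=> /andP[z1 z2]; have [] := @mesh_cover m z gm m01 _; first by apply/andP; split; lra.
  move=> K' [mK' /andP[h1 h2]]; exists K'; split => //.
  by rewrite /P mK'/=; lra.
have [] := cov (zl R M K / 2); first by apply/andP; split; lra.
move=> K0 [PK0 _]; case: (arg_maxP (zr R M) PK0) => K' /andP[mK' rK'] maxK'.
exists K'; split => //; apply: le_anti; apply/andP; split; last first.
  rewrite leNgt; apply/negP => lt1.
  have [] := cov ((zr R M K' + zl R M K) / 2).
    by have [[? ? ?] _] := mesh_bounds K'; apply/andP; split; lra.
  by move=> K'' [/maxK' /= h1 h2]; lra.
rewrite leNgt; apply/negP => lt1; have e : K = K'.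
  apply: (@mesh_disjoint m ((zl R M K + Num.min (zr R M K) (zr R M K')) / 2)) => //.
    have : zl R M K < Num.min (zr R M K) (zr R M K') by rewrite lt_min zz lt1.
    have : Num.min (zr R M K) (zr R M K') <= zr R M K by rewrite ge_min lexx.
    by move=> ? ?; apply/andP; split; lra.
  have : zl R M K < Num.min (zr R M K) (zr R M K') by rewrite lt_min zz lt1.
  have : Num.min (zr R M K) (zr R M K') <= zr R M K' by rewrite ge_min lexx orbT.
  by move=> ? ?; apply/andP; split; lra.
by move: rK'; rewrite e ltxx.
Qed.

Lemma sum_pred_unique (I : finType) (P : pred I) (c : I -> R) i0 :
  P i0 -> (forall i, P i -> i = i0) -> \sum_(i | P i) c i = c i0.
Proof.
move=> P0 h; rewrite (big_pred1 i0)// => i; apply/idP/eqP => [/h//|->//].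
Qed.

Lemma sum_pred_atmost1 (I : finType) (P : pred I) (c : R) : 0 <= c ->
  (forall i j, P i -> P j -> i = j) -> \sum_(i | P i) c <= c.
Proof.
move=> c0 h; have [i0 P0|nP] := pickP P; last by rewrite big_pred0.
by rewrite (sum_pred_unique _ P0)// => i Pi; exact: h.
Qed.

Lemma sqr_sum_inK x (c : 'I_(nK R M) -> R) :
  (\sum_(K | inK M K x) c K) ^+ 2 = \sum_(K | inK M K x) c K ^+ 2.
Proof.
have [_ [h _]] := hM; have [K0 P0|nP] := pickP (inK M ^~ x); last first.
  by rewrite !big_pred0// expr0n.
by rewrite !(@sum_pred_unique _ (fun K => inK M K x) _ K0 P0)// => K /h; exact.
Qed.

(** Summation by parts over the cells of a line: each interior right end is the left end of exactly
    one neighbour, and since [q] has a single value there only the jump of the discrete factor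
    remains. *)
Lemma sum_faces m (q : R -> R) (pl pr : 'I_(nK R M) -> R) : generic m -> 0 < m < 1 ->
  \sum_(K | onK m K) (q (zr R M K) * pr K - q (zl R M K) * pl K) =
  \sum_K1 \sum_(K2 | isF M K1 K2) (if bF M K1 K2 < m < tF M K1 K2
      then q (zF M K1 K2) * (pr K1 - pl K2) else 0)
  + \sum_(K | (zr R M K == L) && onK m K) q L * pr K
  - \sum_(K | (zl R M K == 0) && onK m K) q 0 * pl K.
Proof.
move=> gm m01.
pose N K1 K2 := [&& zr R M K1 == zl R M K2, onK m K1 & onK m K2].
have -> : \sum_K1 \sum_(K2 | isF M K1 K2) (if bF M K1 K2 < m < tF M K1 K2
      then q (zF M K1 K2) * (pr K1 - pl K2) else 0) =
   \sum_K1 \sum_(K2 | N K1 K2) q (zr R M K1) * pr K1 -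
   \sum_K2 \sum_(K1 | N K1 K2) q (zl R M K2) * pl K2.
  rewrite [X in _ = _ - X](exchange_big_dep predT)//= -sumrB; apply: eq_bigr => K1 _.
  rewrite -big_mkcondr/= -sumrB; apply: eq_big => [K2|K2]; first by rewrite onFE.
  by rewrite onFE /zF => /and3P[/eqP <- _ _]; rewrite mulrBr.
rewrite sumrB (bigID (fun K => zr R M K == L))/=.
rewrite [X in _ - X = _](bigID (fun K => zl R M K == 0))/=.
have -> : \sum_(K | onK m K && (zr R M K == L)) q (zr R M K) * pr K =
   \sum_(K | (zr R M K == L) && onK m K) q L * pr K.
  by apply: eq_big => [K|K /andP[_ /eqP->]//]; exact: andbC.
have -> : \sum_(K | onK m K && (zl R M K == 0)) q (zl R M K) * pl K =
   \sum_(K | (zl R M K == 0) && onK m K) q 0 * pl K.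
  by apply: eq_big => [K|K /andP[_ /eqP->]//]; exact: andbC.
(* Away from [L] the element [K1] has exactly one right neighbour, so the inner sum over [K2] has
   one term; at [L] it is empty. *)
have -> : \sum_(K | onK m K && (zr R M K != L)) q (zr R M K) * pr K =
  \sum_K1 \sum_(K2 | N K1 K2) q (zr R M K1) * pr K1.
  rewrite big_mkcond/=; apply: eq_bigr => K1 _; have [[_ _ zL] _] := mesh_bounds K1.
  case: ifPn => [/andP[mK nL]|]; last first.
    rewrite negb_and negbK => /orP[nK1|/eqP e]; rewrite big_pred0// => K2; apply/negbTE.
      by rewrite /N (negbTE nK1) andbF.
    by apply/negP => /and3P[/eqP e2 _ _]; have [[_ ? ?] _] := mesh_bounds K2; lra.
  have [] := mesh_right_neighbour gm m01 mK; first by rewrite lt_neqAle nL.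
  move=> K2 [mK2 e]; rewrite (@sum_pred_unique _ _ _ K2)//; first by rewrite /N e eqxx mK mK2.
  move=> K3 /and3P[/eqP e3 _ mK3]; apply: (mesh_left_unique mK3 mK2); congruence.
have -> : \sum_(K | onK m K && (zl R M K != 0)) q (zl R M K) * pl K =
  \sum_K2 \sum_(K1 | N K1 K2) q (zl R M K2) * pl K2.
  rewrite big_mkcond/=; apply: eq_bigr => K2 _; have [[z0 _ _] _] := mesh_bounds K2.
  case: ifPn => [/andP[mK nL]|]; last first.
    rewrite negb_and negbK => /orP[nK1|/eqP e]; rewrite big_pred0// => K1; apply/negbTE.
      by rewrite /N (negbTE nK1) !andbF.
    by apply/negP => /and3P[/eqP e2 _ _]; have [[? ? ?] _] := mesh_bounds K1; lra.
  have [] := mesh_left_neighbour gm m01 mK; first by rewrite lt_neqAle eq_sym nL.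
  move=> K1 [mK1 e]; rewrite (@sum_pred_unique _ _ _ K1)//; first by rewrite /N e eqxx mK mK1.
  move=> K3 /and3P[/eqP e3 mK3 _]; apply: (mesh_right_unique mK3 mK1); congruence.
by ring.
Qed.

(* On the line [mu = m] every element is adjacent to at most two interior faces. *)
Lemma sum_faces_le m (e : 'I_(nK R M) -> R) : (forall K, 0 <= e K) ->
  \sum_K1 \sum_(K2 | isF M K1 K2) (if bF M K1 K2 < m < tF M K1 K2 then e K1 + e K2 else 0)
  <= 2 * \sum_(K | onK m K) e K.
Proof.
move=> e0; pose N K1 K2 := [&& zr R M K1 == zl R M K2, onK m K1 & onK m K2].
have -> : \sum_K1 \sum_(K2 | isF M K1 K2)
    (if bF M K1 K2 < m < tF M K1 K2 then e K1 + e K2 else 0) =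
   \sum_K1 \sum_(K2 | N K1 K2) e K1 + \sum_K2 \sum_(K1 | N K1 K2) e K2.
  rewrite [X in _ = _ + X](exchange_big_dep predT)//= -big_split; apply: eq_bigr => K1 _.
  by rewrite -big_mkcondr/= -big_split; apply: eq_bigl => K2; rewrite onFE.
have -> : 2 * \sum_(K | onK m K) e K = \sum_(K | onK m K) e K + \sum_(K | onK m K) e K by ring.
apply: lerD; rewrite [leRHS]big_mkcond/=; apply: ler_sum => K _; case: ifPn => mK.
- apply: sum_pred_atmost1 => // K2 K3 /and3P[/eqP e2 _ mK2] /and3P[/eqP e3 _ mK3].
  by apply: (mesh_left_unique mK2 mK3); congruence.
- by rewrite big_pred0// => K2; rewrite /N (negbTE mK) andbF.
- apply: sum_pred_atmost1 => // K2 K3 /and3P[/eqP e2 mK2 _] /and3P[/eqP e3 mK3 _].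
  by apply: (mesh_right_unique mK2 mK3); congruence.
- by rewrite big_pred0// => K2; rewrite /N (negbTE mK) !andbF.
Qed.
End MeshTheory.

(** [m] is a bare set function here, so that the lemma serves [mu] and [lam2] alike. *)
Lemma ae_imp d (T : measurableType d) (R : realType) (m : set T -> \bar R) (P Q : T -> Prop) :
  (forall x, P x -> Q x) -> {ae m, forall x, P x} -> {ae m, forall x, Q x}.
Proof.
move=> PQ [N [mN N0 sub]]; exists N; split => // x nQ; apply: sub => Px.
exact/nQ/PQ.
Qed.

(** * Traces and regularity of the weak solution *)

Section VSpace.
Context (R : realType) (L : R).
Hypothesis L0 : 0 < L.
Implicit Types (F q v dv dq : R * R -> R) (m z : R).
Local Notation mu := (@lebesgue_measure R).

Let half_L : 0 < L / 2 < L.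
Proof. by rewrite divr_gt0//= ltr_pdivrMr// ltr_pMr// ltr1n. Qed.

Lemma isV_AC1 v dv m : isV L v dv -> 0 < m < 1 ->
  AC1 0 L (fun z => v (z, m)) (fun z => dv (z, m)).
Proof. by move=> [_ [_ [_ h]]]; exact: h. Qed.

Lemma measurable_int_z F a b : measurable_fun (Om L) F -> 0 <= a -> b <= L ->
  measurable_fun `](0 : R), 1[ (fun m => int1 a b (fun z => F (z, m))).
Proof.
move=> mF a0 bL; pose F' (x : R * R) := if a < x.1 < b then F x else 0.
have mF' : measurable_fun (Om L) F'.
  apply: measurable_fun_if => //; first exact: measurable_Om.
    apply: measurable_and; apply: measurable_fun_ltr => //; exact: measurable_funTS.
  apply: measurable_funS mF => //; exact: measurable_Om.
move: mF'; rewrite OmE => mF'.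
have := measurable_Rintegral2 mu (measurable_oo 0 L) (measurable_oo 0 1) mF'.
apply: eq_measurable_fun => m _; rewrite [RHS](int1_cond _ a0 bL).
by apply: eq_int1 => z _.
Qed.

(** The end points [0] and [L] lie outside [Om L], where measurability of [v] is not given. The
    slice at [L / 2] is measurable, and any trace differs from it by an integral of [dv]. *)
Lemma measurable_trace v dv z : isV L v dv -> 0 <= z <= L ->
  measurable_fun `](0 : R), 1[ (fun m => v (z, m)).
Proof.
move=> hv /andP[z0 zL]; have [[mv _] [mdv _]] := hv.
have mh : measurable_fun `](0 : R), 1[ (fun m => v (L / 2, m)).
  exact: (measurable_slice_z mv half_L).
have /andP[/ltW h1 /ltW h2] := half_L.
have [le1|/ltW le1] := leP (L / 2) z.
  have := measurable_funD mh (measurable_int_z mdv h1 zL).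
  apply: eq_measurable_fun => m /set_mem; rewrite /= in_itv/= => m01.
  have [_ h] := isV_AC1 hv m01.
  by rewrite -h//; ring.
have := measurable_funB mh (measurable_int_z mdv z0 h2).
apply: eq_measurable_fun => m /set_mem; rewrite /= in_itv/= => m01.
have [_ h] := isV_AC1 hv m01.
by rewrite -h//; ring.
Qed.

(** Integration by parts of [f] with itself expresses the change of [f ^+ 2] between two points as
    the integral of [2 * (f * f')]. *)
Lemma AC1_sqr_le (f f' : R -> R) z0 z : AC1 0 L f f' -> 0 <= z0 <= L -> 0 <= z <= L ->
  f z0 ^+ 2 <= f z ^+ 2 + 2 * int1 0 L (fun s => `|f s| * `|f' s|).
Proof.
move=> ACf /andP[z00 z0L] /andP[zz0 zL].
have [i1 i2 _] := AC1_ibp (ltW L0) ACf ACf.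
have i3 : I1 0 L (fun s => f' s * f s + f s * f' s) by apply: integrable_add => //.
have key a b : 0 <= a -> a <= b -> b <= L ->
    `|f b ^+ 2 - f a ^+ 2| <= 2 * int1 0 L (fun s => `|f s| * `|f' s|).
  move=> a0 ab bL; have ACf' := AC1_sub a0 bL ACf.
  have [_ _ e] := AC1_ibp ab ACf' ACf'.
  rewrite !expr2 -e; apply: (le_trans (normr_int1_sub_le a0 bL i3)).
  rewrite -int1Z.
    rewrite le_eqVlt; apply/orP; left; apply/eqP; apply: eq_int1 => s _.
    have -> : f' s * f s + f s * f' s = 2 * (f s * f' s) by ring.
    by rewrite !normrM ger0_norm.
  apply: measurable_funM; apply: measurableT_comp => //.
    exact: measurable_AC1 ACf.
  by case: ACf => /I1_measurable.
have [le1|/ltW le1] := leP z z0.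
  by have := key z z0 zz0 le1 z0L; rewrite ler_norml => /andP[_]; lra.
by have := key z0 z z00 le1 zL; rewrite ler_norml => /andP[]; lra.
Qed.

(* Averaging [AC1_sqr_le] over [z] bounds the weighted trace by the graph norm. *)
Lemma integrable_trace v dv z0 : isV L v dv -> 0 <= z0 <= L ->
  I1 0 1 (fun m => v (z0, m) ^+ 2 * m).
Proof.
move=> hv z0L; have [v2 [mdv [dv2 _]]] := hv.
have nv2 : L2fun L (fun x => `|v x|).
  apply: (L2_le (measurable_Om L) _ v2) => [|x _]; last by rewrite normr_id.
  by apply: measurableT_comp => //; case: v2.
have ndv2 : L2fun L (fun x => `|x.2 * dv x|).
  apply: (L2_le (measurable_Om L) _ dv2) => [|x _]; last by rewrite normr_id.
  by apply: measurableT_comp => //; case: dv2.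
pose F x := L^-1 * v x ^+ 2 + 2 * (`|v x| * `|x.2 * dv x|).
have Fi : I2 L F.
  by apply: I2D; apply: I2Z; [exact: v2.2|exact: L2funM].
have [i1 _] := int2_fubini_m Fi.
apply: (integrable_le (measurable_oo 0 1) _ i1).
  apply: measurable_funM; last exact: measurable_id.
  by apply: measurable_funX; exact: (measurable_trace hv).
move=> m; rewrite /= in_itv/= => m01; have ACm := isV_AC1 hv m01.
have /andP[m0 m1] := m01.
have t0 : 0 <= v (z0, m) ^+ 2 * m by apply: mulr_ge0; [exact: sqr_ge0|exact: ltW].
rewrite ger0_norm//.
have [j1 j2 _] := AC1_ibp (ltW L0) ACm ACm.
have mvm : measurable_fun `]0, L[ (fun z => v (z, m)) by exact: measurable_AC1 ACm.
have vv : I1 0 L (fun z => v (z, m) ^+ 2).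
  pose B : R := `|v (0, m)| + int1 0 L (fun z => `|dv (z, m)|).
  apply: (@I1_bounded R (B ^+ 2)); first exact: measurable_funX.
  move=> z /andP[z1 z2]; have h := AC1_bounded (ltW L0) ACm; rewrite normrX.
  have h1 : `|v (z, m)| <= B by apply: h; rewrite !ltW.
  by rewrite ler_pXn2r ?nnegrE// (le_trans _ h1).
have W1 : I1 0 L (fun z => `|v (z, m)| * `|dv (z, m)|).
  by apply: eq_I1 (I1_norm j2) => z _; rewrite normrM.
have -> : int1 0 L (fun z => F (z, m)) = L^-1 * int1 0 L (fun z => v (z, m) ^+ 2) +
   2 * m * int1 0 L (fun z => `|v (z, m)| * `|dv (z, m)|).
  rewrite -int1Z; last exact: I1_measurable.
  rewrite -int1Z; last exact: I1_measurable.
  rewrite -int1D; [|exact: integrable_scale|exact: integrable_scale].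
  by apply: eq_int1 => z _; rewrite /F/= normrM (ger0_norm (ltW m0)); ring.
set X := int1 0 L (fun z => v (z, m) ^+ 2).
set W := int1 0 L (fun z => `|v (z, m)| * _).
have W0 : 0 <= W by apply: int1_ge0 => z _; rewrite mulr_ge0.
have X0 : 0 <= X by apply: int1_ge0 => z _; rewrite sqr_ge0.
have key : L * v (z0, m) ^+ 2 <= X + 2 * W * L.
  have <- : int1 0 L (fun=> v (z0, m) ^+ 2) = L * v (z0, m) ^+ 2.
    by rewrite int1_cst ?ltW// subr0 mulrC.
  have <- : int1 0 L (fun=> 2 * W) = 2 * W * L by rewrite int1_cst ?ltW// subr0.
  rewrite -int1D//; last exact: I1_cst.
  apply: le_int1; [exact: I1_cst|by apply: integrable_add => //; exact: I1_cst|].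
  by move=> z /andP[z1 z2]; apply: (AC1_sqr_le ACm z0L); rewrite !ltW.
(* The weight [m] turns [dv] into the controlled [mu * dv] in the second term; in front of [X] it is
   dropped because [m <= 1]. *)
rewrite -(ler_pM2l L0); have -> : L * (L^-1 * X + 2 * m * W) = X + m * (2 * W * L).
  by field; rewrite gt_eqF.
have -> : L * (v (z0, m) ^+ 2 * m) = m * (L * v (z0, m) ^+ 2) by ring.
apply: (le_trans (ler_wpM2l (ltW m0) key)).
by rewrite mulrDr lerD2r ler_piMl// ltW.
Qed.

(** The weight [k] is 1 when the primitive of the source is integrated by parts, and the identity
    when the factor [mu] of the bilinear form is present. *)
Lemma green (k : R -> R) q dq v dv :
  (forall m, 0 < m < 1 -> AC1 0 L (fun z => q (z, m)) (fun z => dq (z, m))) ->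
  (forall m, 0 < m < 1 -> AC1 0 L (fun z => v (z, m)) (fun z => dv (z, m))) ->
  I2 L (fun x => k x.2 * (dq x * v x + q x * dv x)) ->
  int2 (Om L) (fun x => k x.2 * (dq x * v x + q x * dv x)) =
  int1 0 1 (fun m => k m * (q (L, m) * v (L, m) - q (0, m) * v (0, m))).
Proof.
move=> ACq ACv Fi; have [_ ->] := int2_fubini_m Fi; apply: eq_int1 => m m01 /=.
have [i1 i2 <-] := AC1_ibp (ltW L0) (ACq m m01) (ACv m m01).
by rewrite int1Z//; apply: measurable_funD; exact: I1_measurable.
Qed.

Lemma ae_snd (P : R -> Prop) : {ae mu, forall m, P m} -> {ae lam2, forall x : R * R, P x.2}.
Proof.
move=> [N [mN N0 PN]]; exists (setT `*` N); split.
- exact: measurableX.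
- have -> : lam2 (setT `*` N) = (mu setT * mu N)%E by rewrite [LHS]product_measure1E.
  by rewrite N0 mule0.
- by move=> [z m] /= nP; split => //; exact: PN.
Qed.

Lemma lam2_ae_and (P Q : R * R -> Prop) :
  {ae lam2, forall x, P x} -> {ae lam2, forall x, Q x} -> {ae lam2, forall x, P x /\ Q x}.
Proof.
move=> hP hQ; have := @negligibleU _ _ _ (mu \x mu)%E _ _ hP hQ.
apply: negligibleS => x /= /not_andP[nP|nQ]; [by left|by right].
Qed.

(* Non-integrable functions integrate to 0, so the test below selects exactly the
   integrable slices. *)
Lemma good_slices F : L2fun L F -> exists F', [/\ L2fun L F',
  forall m, 0 < m < 1 -> I1 0 L (fun z => F' (z, m)) &
  {ae lam2, forall x, Om L x -> F x = F' x}].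
Proof.
(* The summand 1 makes the integral over an integrable slice at least [L], hence positive even where
   [F] vanishes. *)
move=> F2; pose G (x : R * R) := 1 + `|F x|; pose I m := int1 0 L (fun z => G (z, m)).
have mG : measurable_fun (Om L) G.
  by apply: measurable_funD => //; apply: measurableT_comp => //; case: F2.
have mI : measurable_fun `](0 : R), 1[ I by exact: (measurable_int_z mG (lexx 0) (lexx L)).
pose F' x := if 0 < I x.2 then F x else 0.
have mF' : measurable_fun (Om L) F'.
  apply: measurable_fun_if => //; first exact: measurable_Om.
    by apply: measurable_fun_ltr => //; exact: (measurable_Om_snd mI).
  by case: F2 => mF _; apply: measurable_funS mF => //; exact: measurable_Om.
have Ipos m : 0 < m < 1 -> I1 0 L (fun z => F (z, m)) -> 0 < I m.
  move=> m01 Fi; apply: (lt_le_trans L0).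
  have <- : int1 0 L (fun=> 1) = L by rewrite int1_cst ?ltW// subr0 mul1r.
  apply: le_int1; [exact: I1_cst| |by move=> z _; rewrite lerDl].
  by apply: integrable_add => //; [exact: I1_cst|exact: I1_norm].
exists F'; split.
- apply: (L2_le (measurable_Om L) mF' F2) => x _; rewrite /F'; case: ifP => // _.
  by rewrite normr0.
- move=> m m01; have [Im|nIm] := boolP (0 < I m); last first.
    by apply: eq_I1 (I1_cst 0 L 0) => z _; rewrite /F'/= (negbTE nIm).
  suff : I1 0 L (fun z => F (z, m)) by apply: eq_I1 => z _; rewrite /F'/= Im.
  have mGm := measurable_slice_m mG m01; have mFm := measurable_slice_m F2.1 m01.
  have [Gi|nGi] := pselect (I1 0 L (fun z => G (z, m))).
    by apply: (integrable_le (measurable_oo 0 L) mFm Gi) => z _; rewrite lerDr.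
  by move: Im; rewrite /I [int1 _ _ _]Rintegral_nonintegrable ?ltxx.
- have Fi : I2 L F by apply: (L2_integrable (measurable_Om L) (lam2_Om_fin L) F2).
  have := ae_snd (ae_slice_m Fi); apply: ae_imp => -[z m] /= h [_ /= m01].
  by rewrite /F'/= Ipos// h.
Qed.

(** The size is bounded by the integral of [|F|] over the full line, which is square integrable in
    [mu]. Joint measurability with a variable upper limit comes from a function of three variables
    that carries the cutoff [s < z]. *)
Lemma L2fun_cumul F : L2fun L F ->
  (forall m, 0 < m < 1 -> I1 0 L (fun z => F (z, m))) ->
  L2fun L (fun x => int1 0 x.1 (fun s => F (s, x.2))).
Proof.
move=> F2 Fi; have nF2 : L2fun L (fun x => `|F x|).
  apply: (L2_le (measurable_Om L) _ F2) => [|x _]; last by rewrite normr_id.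
  by apply: measurableT_comp => //; case: F2.
have E2 := L2fun_snd L (L2_int_z nF2).
apply: (L2_le (measurable_Om L) _ E2); last first.
  move=> [z m] [/= /andP[z0 zL] m01].
  have h := normr_int1_sub_le (lexx 0) (ltW zL) (Fi m m01).
  by apply: (le_trans h); exact: ler_norm.
pose H (p : (R * R) * R) := if p.2 < p.1.1 then F (p.2, p.1.2) else 0.
pose X := measurableTypeR R.
have mOmL : measurable (Om L `*` `]0, L[ : set ((X * X) * X)).
  by apply: measurableX; [exact: measurable_Om|exact: measurable_oo].
have mH : measurable_fun (Om L `*` `]0, L[ : set ((X * X) * X)) H.
  apply: measurable_fun_if => //.
    by apply: measurable_fun_ltr; apply: measurable_funTS => //; exact: measurableT_comp.
  apply: (@measurable_funS _ _ _ _ (Om L `*` `]0, L[ : set ((X * X) * X))) => //.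
  have := @measurable_comp _ _ _ _ _ _ (Om L) F (Om L `*` `]0, L[ : set ((X * X) * X))
    (fun p => (p.2, p.1.2)).
  apply; [exact: measurable_Om| |by case: F2|].
    by move=> _ [[[z m] s] [[/= _ m01] +] <-]; rewrite in_itv/= => s0L; split.
  apply: measurable_funTS; apply/measurable_fun_pairP; split; first exact: measurable_snd.
  exact: (measurableT_comp measurable_snd measurable_fst).
have := measurable_Rintegral1 mu (measurable_Om L) (measurable_oo 0 L) mH.
apply: eq_measurable_fun => -[z m] /set_mem[/= /andP[z0 zL] m01].
rewrite [RHS](int1_cond _ (lexx 0) (ltW zL)).
by apply: eq_int1 => s /andP[s0 sL]; rewrite /H/= s0.
Qed.

Lemma isV_primitive (k : R -> R) dv v : measurable_fun (Om L) dv ->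
  L2fun L (fun x => x.2 * dv x) ->
  (forall m, 0 < m < 1 -> I1 0 L (fun z => dv (z, m))) ->
  (forall x, v x = k x.2 + int1 0 x.1 (fun s => dv (s, x.2))) ->
  L2fun L v -> isV L v dv.
Proof.
move=> mdv dv2 dvi vE v2; split => //; split => //; split => // m m01.
have [h1 h2] := AC1_primitive (k m) (dvi m m01); split => // z1 z2 h3 h4 h5.
by rewrite !vE/= h2.
Qed.

(* [L^2((0, 1); mu dmu)], the space of traces on vertical lines. *)
Definition Tr (f : R -> R) := L2 mu `](0 : R), 1[ (fun m => Num.sqrt m * f m).

Lemma TrP (f : R -> R) : measurable_fun `](0 : R), 1[ f -> I1 0 1 (fun m => f m ^+ 2 * m) -> Tr f.
Proof.
move=> mf fi; split.
  apply: measurable_funM => //; apply: measurable_funTS.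
  by apply: continuous_measurable_fun; exact: sqrt_continuous.
by apply: eq_I1 fi => m /andP[m0 _]; rewrite exprMn sqr_sqrtr ?ltW// mulrC.
Qed.

Lemma Tr_trace v dv z : isV L v dv -> 0 <= z <= L -> Tr (fun m => v (z, m)).
Proof.
by move=> hv z0L; apply: TrP; [exact: measurable_trace hv z0L|exact: integrable_trace hv z0L].
Qed.

Lemma TrD f g : Tr f -> Tr g -> Tr (fun m => f m + g m).
Proof.
move=> f2 g2; apply: (L2_eq (measurable_oo 0 1) _ (L2_add (measurable_oo 0 1) f2 g2)) => m _.
by rewrite mulrDr.
Qed.

Lemma TrN f : Tr f -> Tr (fun m => - f m).
Proof.
by move=> f2; apply: (L2_eq (measurable_oo 0 1) _ (L2_opp (measurable_oo 0 1) f2)) => m _; rewrite mulrN.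
Qed.

Lemma TrB f g : Tr f -> Tr g -> Tr (fun m => f m - g m).
Proof. by move=> f2 /TrN; exact: TrD. Qed.

Lemma TrM f g : Tr f -> Tr g -> I1 0 1 (fun m => f m * g m * m).
Proof.
move=> f2 g2; apply: eq_I1 (L2_mul (measurable_oo 0 1) f2 g2) => m /andP[m0 _].
have := sqr_sqrtr (ltW m0); set s := Num.sqrt m => <-; ring.
Qed.

Lemma Tr_bounded (f : R -> R) (B : R) : measurable_fun `](0 : R), 1[ f ->
  (forall m, 0 < m < 1 -> `|f m| <= B) -> Tr f.
Proof.
move=> mf fB; apply: TrP => //; apply: (@I1_bounded R (B ^+ 2)).
  by apply: measurable_funM; [exact: measurable_funX|exact: measurable_id].
move=> m m01; have /andP[m0 m1] := m01; rewrite normrM normrX (ger0_norm (ltW m0)).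
have h := fB m m01; rewrite -[leRHS]mulr1; apply: ler_pM; [exact: exprn_ge0|exact: ltW| |exact: ltW].
by rewrite ler_pXn2r ?nnegrE// (le_trans _ h).
Qed.

Lemma Tr_psd b t f g : 0 <= b -> t <= 1 -> Tr f -> Tr g ->
  psd (int1 b t (fun m => f m ^+ 2 * m)) (int1 b t (fun m => f m * g m * m))
      (int1 b t (fun m => g m ^+ 2 * m)).
Proof.
move=> b0 t1 f2 g2.
have sub h : Tr h -> L2 mu `]b, t[ (fun m => Num.sqrt m * h m).
  move=> [mh ih]; split; last exact: I1_sub ih.
  by apply: measurable_funS mh => //; apply: subset_itvW.
have := L2_psd (measurable_oo b t) (sub f f2) (sub g g2).
congr psd; apply: eq_int1 => m /andP[m0 _];
  have := sqr_sqrtr (ltW (le_lt_trans b0 m0)); set s := Num.sqrt m => <-; ring.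
Qed.
End VSpace.

(** * Flux and boundary conditions of the weak solution *)

Section Regularity.
Context (R : realType) (L c : R) (ss st : R -> R).
Hypotheses (L0 : 0 < L) (hs : sigma_hyp L c ss st).
Implicit Types (F v dv : R * R -> R).
Local Notation mu := (@lebesgue_measure R).

Lemma measurable_pos_inv d (T : measurableType d) (D : set T) (h : T -> R) :
  measurable D -> measurable_fun D h -> (forall x, D x -> 0 < h x) ->
  measurable_fun D (fun x => (h x)^-1).
Proof.
move=> mD mh h0; have mi : measurable_fun `](0 : R), +oo[ (@GRing.inv R).
  apply: open_continuous_measurable_fun; first exact: interval_open.
  by move=> x; rewrite inE/= in_itv/= andbT => x0; apply: inv_continuous; rewrite gt_eqF.
have := @measurable_comp _ _ _ _ _ _ `](0 : R), +oo[ (@GRing.inv R) D h.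
apply => //; move=> _ [x Dx <-]; rewrite /= in_itv/= andbT; exact: h0.
Qed.

Lemma st_gt0 z : 0 < z < L -> 0 < st z.
Proof.
by move=> z0; case: hs => _ [_ [_ [c0 h]]]; have [? ?] := h z z0; lra.
Qed.

Lemma st_bounds : exists B : R, forall x, Om L x ->
  [/\ `|ss x.1| <= B, `|st x.1| <= B & `|(st x.1)^-1| <= B].
Proof.
(* [c^-1] bounds the inverse of [st], since [st >= c + ss >= c]. *)
case: hs => _ [_ [[B hB] [c0 h]]]; exists (Num.max B c^-1) => x [x0 _].
have [h1 h2] := hB _ x0; have [h3 h4] := h _ x0; have h5 := st_gt0 x0.
rewrite !le_max h1 h2; split => //; apply/orP; right.
by rewrite ger0_norm ?invr_ge0 ?(ltW h5)// lef_pV2 ?posrE//; lra.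
Qed.

Lemma measurable_st : measurable_fun (Om L) (fun x : R * R => st x.1).
Proof. by apply: measurable_Om_fst; case: hs => _ []. Qed.

Lemma measurable_ss : measurable_fun (Om L) (fun x : R * R => ss x.1).
Proof. by apply: measurable_Om_fst; case: hs. Qed.

Lemma measurable_stV : measurable_fun (Om L) (fun x : R * R => (st x.1)^-1).
Proof.
apply: (measurable_pos_inv (measurable_Om L)); first exact: measurable_st.
by move=> x [x0 _]; exact: st_gt0.
Qed.

Lemma L2fun_st F : L2fun L F -> L2fun L (fun x => st x.1 * F x).
Proof.
move=> F2; have [B hB] := st_bounds.
by apply: (L2_bounded_mul (measurable_Om L) measurable_st _ F2 (B := B)) => x /hB[].
Qed.

Lemma L2fun_ss F : L2fun L F -> L2fun L (fun x => ss x.1 * F x).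
Proof.
move=> F2; have [B hB] := st_bounds.
by apply: (L2_bounded_mul (measurable_Om L) measurable_ss _ F2 (B := B)) => x /hB[].
Qed.

Lemma L2fun_stV F : L2fun L F -> L2fun L (fun x => (st x.1)^-1 * F x).
Proof.
move=> F2; have [B hB] := st_bounds.
by apply: (L2_bounded_mul (measurable_Om L) measurable_stV _ F2 (B := B)) => x /hB[].
Qed.

Lemma measurable_x2 : measurable_fun (Om L) (fun x : R * R => x.2).
Proof. by apply: measurable_funTS; exact: measurable_snd. Qed.

Lemma L2fun_x2 F : L2fun L F -> L2fun L (fun x => x.2 * F x).
Proof.
move=> F2; apply: (L2_bounded_mul (measurable_Om L) measurable_x2 _ F2 (B := 1)) => x.
by move=> [_ /andP[x0 x1]]; rewrite ger0_norm ltW.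
Qed.

Variables (f : R * R -> R) (g0 gL : R -> R) (u du : R * R -> R).
Hypotheses (f2 : L2fun L f) (hg : L2Gam g0 gL) (hu : isV L u du).
Hypothesis weak : forall v dv : R * R -> R, isV L v dv ->
  ae L ss st u du v dv = int2 (Om L) (fun x => f x * v x)
     + bnd g0 gL (fun m => v (0, m)) (fun m => v (L, m)).

Lemma Tr_g : Tr g0 /\ Tr gL.
Proof.
have [m0 [mL gi]] := hg; have mg (h : R -> R) : measurable_fun `](0 : R), 1[ h ->
    measurable_fun `](0 : R), 1[ (fun m => h m ^+ 2 * m).
  by move=> mh; apply: measurable_funM; [exact: measurable_funX|exact: measurable_id].
split; apply: TrP => //; apply: (integrable_le (measurable_oo 0 1) _ gi); try exact: mg.
- move=> m; rewrite /= in_itv/= => /andP[m01 _]; rewrite ger0_norm.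
    by apply: ler_wpM2r; [exact: ltW|rewrite lerDl sqr_ge0].
  by apply: mulr_ge0; [exact: sqr_ge0|exact: ltW].
- move=> m; rewrite /= in_itv/= => /andP[m01 _]; rewrite ger0_norm.
    by apply: ler_wpM2r; [exact: ltW|rewrite lerDr sqr_ge0].
  by apply: mulr_ge0; [exact: sqr_ge0|exact: ltW].
Qed.

Definition flux x := (st x.1)^-1 * (x.2 * du x).
(** The weak equation says that [mu dz] of the flux equals this function in the sense of
    distributions. *)
Definition source x := st x.1 * u x - ss x.1 * Pop u x - f x.

Lemma L2fun_flux : L2fun L flux.
Proof. by apply: L2fun_stV; case: hu => _ [_ []]. Qed.

Lemma L2fun_source : L2fun L source.
Proof.
have u2 : L2fun L u by case: hu.
apply: (L2_sub (measurable_Om L)) => //; apply: (L2_sub (measurable_Om L)).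
  exact: L2fun_st.
by apply: L2fun_ss; exact: L2fun_Pop.
Qed.

Let z0L : 0 <= (0 : R) <= L. Proof. by rewrite lexx ltW. Qed.
Let zLL : 0 <= L <= L. Proof. by rewrite lexx ltW. Qed.

Lemma weak_flux v dv : isV L v dv ->
  int2 (Om L) (fun x => flux x * (x.2 * dv x)) + int2 (Om L) (fun x => source x * v x)
  + int1 0 1 (fun m => ((u (L, m) - gL m) * v (L, m) + (u (0, m) - g0 m) * v (0, m)) * m) = 0.
Proof.
move=> hv; have := weak hv; rewrite /ae /bnd.
have [v2 [_ [dv2 _]]] := hv; have u2 : L2fun L u by case: hu.
have i1 := L2funM (L2fun_st u2) v2.
have i2 : I2 L (fun x => ss x.1 * Pop u x * v x) by exact: (L2funM (L2fun_ss (L2fun_Pop u2)) v2).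
have i3 := L2funM f2 v2.
have -> : int2 (Om L) (fun x => source x * v x) = int2 (Om L) (fun x => st x.1 * u x * v x)
   - int2 (Om L) (fun x => ss x.1 * Pop u x * v x) - int2 (Om L) (fun x => f x * v x).
  rewrite -int2B// -int2B//; last exact: I2B.
  by apply: eq_int2 => x _; rewrite /source; ring.
have [t0 tL] := Tr_g; have tv0 := Tr_trace L0 hv z0L; have tvL := Tr_trace L0 hv zLL.
have tu0 := Tr_trace L0 hu z0L; have tuL := Tr_trace L0 hu zLL.
have -> : int1 0 1 (fun m => ((u (L, m) - gL m) * v (L, m) + (u (0, m) - g0 m) * v (0, m)) * m) =
  int1 0 1 (fun m => (u (L, m) * v (L, m) + u (0, m) * v (0, m)) * m) -
  int1 0 1 (fun m => (gL m * v (L, m) + g0 m * v (0, m)) * m).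
  rewrite -int1B; first by apply: eq_int1 => m _; ring.
    by apply: eq_I1 (integrable_add (measurable_oo 0 1) (TrM tuL tvL) (TrM tu0 tv0)) => m _; ring.
  by apply: eq_I1 (integrable_add (measurable_oo 0 1) (TrM tL tvL) (TrM t0 tv0)) => m _; ring.
rewrite /flux; lra.
Qed.

Lemma int2_ae_eq F F' : measurable_fun (Om L) F -> measurable_fun (Om L) F' ->
  {ae lam2, forall x, Om L x -> F x = F' x} -> int2 (Om L) F = int2 (Om L) F'.
Proof. by move=> mF mF' h; exact: (Rintegral_ae_eq (measurable_Om L) mF mF' h). Qed.

(* With [G] a primitive of the source, [H = mu * flux - G] is tested against the
   primitive [v] of [H - Hb], where [Hb] is the mean of [H] in [z]: then [v] vanishes
   at both ends, so [H = Hb] and [flux = (Hb + G) / mu]. *)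
Lemma flux_regularity : exists q dq, [/\ isV L q dq,
  {ae lam2, forall x, Om L x -> flux x = q x} &
  {ae lam2, forall x, Om L x -> source x = x.2 * dq x}].
Proof.
(* [source] has integrable slices only for almost every [mu]; its modification [r] has a primitive
   on every line. *)
have [r [r2 ri rae]] := good_slices L0 L2fun_source.
pose G x := int1 0 x.1 (fun s => r (s, x.2)).
have G2 : L2fun L G by exact: L2fun_cumul.
pose H x := x.2 * flux x - G x.
have H2 : L2fun L H.
  by apply: (L2_sub (measurable_Om L)) => //; apply: L2fun_x2; exact: L2fun_flux.
have [H' [H'2 H'i H'ae]] := good_slices L0 H2.
pose Hb m := L^-1 * int1 0 L (fun z => H' (z, m)).
have Hb2 : L2fun L (fun x => Hb x.2).
  by apply: L2fun_snd; apply: (L2_scale (measurable_oo 0 1)); exact: L2_int_z.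
pose dv x := H' x - Hb x.2; pose v x := int1 0 x.1 (fun s => dv (s, x.2)).
have dv2 : L2fun L dv by apply: (L2_sub (measurable_Om L)).
have dvi m : 0 < m < 1 -> I1 0 L (fun z => dv (z, m)).
  by move=> m01; exact: (integrable_sub (measurable_oo 0 L) (H'i m m01) (I1_cst 0 L (Hb m))).
have v2 : L2fun L v by exact: L2fun_cumul.
have hv : isV L v dv.
  apply: (isV_primitive (k := fun=> 0)) => //; first by case: dv2.
    exact: L2fun_x2.
  by move=> x; rewrite add0r.
have v0 m : v (0, m) = 0 by rewrite /v/= int1_ge.
have vL m : 0 < m < 1 -> v (L, m) = 0.
  move=> m01; transitivity (int1 0 L (fun z => H' (z, m) - Hb m)) => //.
  rewrite (int1B (H'i m m01) (I1_cst 0 L (Hb m))).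
  by rewrite int1_cst ?ltW// subr0 /Hb mulrC mulrA mulfV ?mul1r ?subrr// gt_eqF.
have e1 := weak_flux hv.
rewrite (@eq_int1 _ _ _ _ (fun=> 0)) in e1; last first.
  by move=> m m01; rewrite v0 vL// !mulr0 addr0 mul0r.
rewrite int1_cst// mul0r addr0 in e1.
have rv : I2 L (fun x => r x * v x) by exact: L2funM.
have Gdv : I2 L (fun x => G x * dv x) by exact: L2funM.
have e2 : int2 (Om L) (fun x => source x * v x) = int2 (Om L) (fun x => r x * v x).
  apply: int2_ae_eq.
  - by apply: measurable_funM; [case: L2fun_source|case: v2].
  - by apply: measurable_funM; [case: r2|case: v2].
  - by apply: ae_imp rae => x h /h ->.
have e3 : int2 (Om L) (fun x => r x * v x) + int2 (Om L) (fun x => G x * dv x) = 0.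
  rewrite -int2D//; have := @green R L L0 (fun=> 1) G r v dv.
  have E : (fun x => 1 * (r x * v x + G x * dv x)) = (fun x => r x * v x + G x * dv x).
    by apply/funext => x; rewrite mul1r.
  rewrite E => ->.
  - rewrite (@eq_int1 _ _ _ _ (fun=> 0)) ?int1_cst ?mul0r// => m m01.
    by rewrite v0 vL// !mulr0 subrr mulr0.
  - move=> m m01; have [h1 h2] := AC1_primitive 0 (ri m m01); split => // z1 z2 h3 h4 h5.
    by have := h2 z1 z2 h3 h4 h5; rewrite !add0r.
  - by move=> m m01; exact: isV_AC1 hv m01.
  - exact: I2D.
have Hdv : I2 L (fun x => H x * dv x) by exact: L2funM.
have H'dv : I2 L (fun x => H' x * dv x) by exact: L2funM.
have Hbdv : I2 L (fun x => Hb x.2 * dv x) by exact: L2funM.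
(* The weak equation tested with [v] sets the integrals of [flux * (mu * dv)] and [source * v]
   against each other, and Green's formula trades the latter for minus the integral of [G * dv]. *)
have e4 : int2 (Om L) (fun x => H x * dv x) = 0.
  have -> : int2 (Om L) (fun x => H x * dv x) =
     int2 (Om L) (fun x => flux x * (x.2 * dv x)) - int2 (Om L) (fun x => G x * dv x).
    rewrite -int2B//; first by apply: eq_int2 => x _; rewrite /H; ring.
    by apply: L2funM; [exact: L2fun_flux|exact: L2fun_x2].
  lra.
have e5 : int2 (Om L) (fun x => H' x * dv x) = 0.
  rewrite -[RHS]e4; apply: int2_ae_eq.
  - by apply: measurable_funM; [case: H'2|case: dv2].
  - by apply: measurable_funM; [case: H2|case: dv2].
  - by apply: ae_imp H'ae => x h /h ->.
have e6 : int2 (Om L) (fun x => Hb x.2 * dv x) = 0.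
  have [_ ->] := int2_fubini_m Hbdv.
  rewrite (@eq_int1 _ _ _ _ (fun=> 0)) ?int1_cst ?mul0r// => m m01 /=.
  rewrite int1Z; last exact: I1_measurable (dvi m m01).
  by have := vL m m01; rewrite /v/= => ->; rewrite mulr0.
(* [dv] is [H' - Hb], and both terms are orthogonal to it: [H'] by the weak equation, [Hb] because
   [v] vanishes at both ends. *)
have e7 : int2 (Om L) (fun x => dv x ^+ 2) = 0.
  transitivity (int2 (Om L) (fun x => H' x * dv x) - int2 (Om L) (fun x => Hb x.2 * dv x)).
    by rewrite -int2B//; apply: eq_int2 => x _; rewrite /dv; ring.
  by rewrite e5 e6 subrr.
have dv0 := Rintegral_eq0_ae (measurable_Om L) dv2.2 (fun x _ => sqr_ge0 (dv x)) e7.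
(* Dividing by [mu] loses bounds near [mu = 0]; square integrability of [q] is recovered from its
   agreement with [flux], that of [mu * dq] from [mu * dq = r]. *)
pose dq x := r x * x.2^-1.
pose q x := Hb x.2 * x.2^-1 + int1 0 x.1 (fun s => dq (s, x.2)).
have qE x : Om L x -> q x = (Hb x.2 + G x) * x.2^-1.
  move=> [/= /andP[x0 xL] m01]; rewrite mulrDl /q; congr (_ + _); rewrite mulrC -int1Z.
    by apply: eq_int1 => s _; rewrite /dq/= mulrC.
  by apply: I1_measurable; apply: I1_sub (ri _ m01) => //; exact: ltW.
have mV : measurable_fun (Om L) (fun x : R * R => x.2^-1).
  by apply: (measurable_pos_inv (measurable_Om L) measurable_x2) => x [_ /andP[]].
have mq : measurable_fun (Om L) q.
  have : measurable_fun (Om L) (fun x => (Hb x.2 + G x) * x.2^-1).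
    by apply: measurable_funM => //; apply: measurable_funD; [case: Hb2|case: G2].
  by apply: eq_measurable_fun => x /set_mem /qE.
have mdq : measurable_fun (Om L) dq by apply: measurable_funM => //; case: r2.
have dqE x : Om L x -> x.2 * dq x = r x.
  by move=> [_ /andP[x0 _]]; rewrite /dq mulrC mulfVK// gt_eqF.
have qae : {ae lam2, forall x, Om L x -> flux x = q x}.
  have := lam2_ae_and H'ae dv0; apply: ae_imp => x [h1 h2] Ox.
  have [_ /andP[x0 _]] := Ox; have := h2 Ox => /eqP; rewrite sqrf_eq0 subr_eq0 => /eqP h3.
  have := h1 Ox; rewrite /H h3 qE// => h4.
  have -> : Hb x.2 + G x = x.2 * flux x by rewrite -h4 subrK.
  by rewrite mulrAC mulfV ?mul1r// gt_eqF.
exists q, dq; split => //.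
  apply: (isV_primitive (k := fun m => Hb m * m^-1)) => //.
  - by apply: (L2_eq (measurable_Om L) _ r2) => x Ox; rewrite dqE.
  - move=> m m01; apply: eq_I1 (integrable_scale (measurable_oo 0 L) m^-1 (ri m m01)) => z _.
    by rewrite mulrC.
  - exact: (L2_ae_eq (measurable_Om L) mq qae L2fun_flux).
by apply: ae_imp rae => x h Ox; rewrite h// dqE.
Qed.

(* The boundary defects [bL], [b0] are only weighted [L^2] functions, so the test function
   interpolates the bounded functions [b / (1 + b^2)] instead. *)
Lemma flux_boundary q dq : isV L q dq ->
  {ae lam2, forall x, Om L x -> flux x = q x} ->
  {ae lam2, forall x, Om L x -> source x = x.2 * dq x} ->
  {ae mu, forall m, 0 < m < 1 ->
     q (L, m) + u (L, m) = gL m /\ u (0, m) - q (0, m) = g0 m}.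
Proof.
move=> hq qae dqae; have [q2 [_ [dq2 _]]] := hq.
pose bL m := q (L, m) + (u (L, m) - gL m); pose b0 m := - q (0, m) + (u (0, m) - g0 m).
have [t0 tL] := Tr_g; have tu0 := Tr_trace L0 hu z0L; have tuL := Tr_trace L0 hu zLL.
have tq0 := Tr_trace L0 hq z0L; have tqL := Tr_trace L0 hq zLL.
have tbL : Tr bL by apply: TrD => //; apply: TrB.
have tb0 : Tr b0 by apply: TrD; [exact: TrN|exact: TrB].
have [mg0 [mgL _]] := hg.
have mbL : measurable_fun `](0 : R), 1[ bL.
  apply: measurable_funD; first exact: (measurable_trace L0 hq zLL).
  by apply: measurable_funB => //; exact: (measurable_trace L0 hu zLL).
have mb0 : measurable_fun `](0 : R), 1[ b0.
  apply: measurable_funD; first by apply: measurableT_comp => //; exact: (measurable_trace L0 hq z0L).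
  by apply: measurable_funB => //; exact: (measurable_trace L0 hu z0L).
(* Green's formula for [q] and [v] cancels the bulk terms, because [mu * dq] is the source almost
   everywhere; the weak equation shrinks to its boundary part. *)
have key v dv : isV L v dv -> int1 0 1 (fun m => bL m * v (L, m) * m + b0 m * v (0, m) * m) = 0.
  move=> hv; have [v2 [_ [dv2 _]]] := hv; have := weak_flux hv.
  have -> : int2 (Om L) (fun x => flux x * (x.2 * dv x)) = int2 (Om L) (fun x => q x * (x.2 * dv x)).
    apply: int2_ae_eq; last by apply: ae_imp qae => x h /h ->.
      by apply: measurable_funM; [case: L2fun_flux|case: dv2].
    by apply: measurable_funM; [case: q2|case: dv2].
  have -> : int2 (Om L) (fun x => source x * v x) = int2 (Om L) (fun x => x.2 * dq x * v x).
    apply: int2_ae_eq; last by apply: ae_imp dqae => x h /h ->.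
      by apply: measurable_funM; [case: L2fun_source|case: v2].
    by apply: measurable_funM; [case: dq2|case: v2].
  have iq : I2 L (fun x => q x * (x.2 * dv x)) by exact: L2funM.
  have idq : I2 L (fun x => x.2 * dq x * v x) by exact: L2funM.
  have idE x : x.2 * (dq x * v x + q x * dv x) = q x * (x.2 * dv x) + x.2 * dq x * v x by ring.
  have gr := @green R L L0 id q dq v dv (fun m h => isV_AC1 hq h) (fun m h => isV_AC1 hv h).
  rewrite -int2D// -(eq_int2 (fun x _ => idE x)) gr; last first.
    by apply: eq_I2 (I2D iq idq) => x _; rewrite idE.
  have tv0 := Tr_trace L0 hv z0L; have tvL := Tr_trace L0 hv zLL.
  move=> h; rewrite -[RHS]h -int1D; first by apply: eq_int1 => m _; rewrite /bL /b0; ring.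
    apply: eq_I1 (integrable_sub (measurable_oo 0 1) (TrM tqL tvL) (TrM tq0 tv0)) => m _.
    by rewrite /=; ring.
  apply: eq_I1 (integrable_add (measurable_oo 0 1) (TrM (TrB tuL tL) tvL) (TrM (TrB tu0 t0) tv0)) => m _.
  by rewrite /=; ring.
pose bt (b : R -> R) m := b m * (1 + b m ^+ 2)^-1.
have bpos (b : R -> R) m : 0 < 1 + b m ^+ 2 by have := sqr_ge0 (b m); lra.
have mbt (b : R -> R) : measurable_fun `](0 : R), 1[ b -> measurable_fun `](0 : R), 1[ (bt b).
  move=> mb; apply: measurable_funM => //; apply: measurable_pos_inv => //.
  by apply: measurable_funD => //; exact: measurable_funX.
have btle (b : R -> R) m : `|bt b m| <= 1.
  rewrite normrM normfV (gtr0_norm (bpos b m)) ler_pdivrMr// mul1r ler_norml.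
  by have := sqr_ge0 (b m - 1); have := sqr_ge0 (b m + 1); nra.
pose dv (x : R * R) := L^-1 * (bt bL x.2 - bt b0 x.2).
pose v (x : R * R) := bt b0 x.2 + x.1 * dv x.
have b2 (b : R -> R) : measurable_fun `](0 : R), 1[ b -> L2fun L (fun x => bt b x.2).
  move=> mb; apply: L2fun_snd; apply: (L2_bounded (measurable_oo 0 1) (B := 1)).
  - exact: lebesgue_itv_fin.
  - exact: mbt.
  - by move=> m _; exact: btle.
have dv2 : L2fun L dv.
  by apply: (L2_scale (measurable_Om L)); apply: (L2_sub (measurable_Om L)); exact: b2.
have v2 : L2fun L v.
  apply: (L2_add (measurable_Om L)); first exact: b2.
  apply: (L2_bounded_mul (measurable_Om L) _ _ dv2 (B := L)).
    by apply: measurable_funTS; exact: measurable_fst.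
  by move=> x [/andP[x0 xL] _]; rewrite ger0_norm ltW.
have hv : isV L v dv.
  split => //; split; first by case: dv2.
  split; first exact: L2fun_x2.
  move=> m m01; split; first exact: (I1_cst 0 L (L^-1 * (bt bL m - bt b0 m))).
  move=> z1 z2 h1 h2 h3.
  rewrite [RHS](int1_cst (L^-1 * (bt bL m - bt b0 m)) h2) /v/= /dv/=; ring.
have := key v dv hv.
have vL m : v (L, m) = bt bL m by rewrite /v /dv/=; field; rewrite gt_eqF.
have v0 m : v (0, m) = bt b0 m by rewrite /v/= mul0r addr0.
move=> e; have i : I1 0 1 (fun m => bL m * v (L, m) * m + b0 m * v (0, m) * m).
  by apply: (integrable_add (measurable_oo 0 1)); apply: TrM => //; exact: (Tr_trace L0 hv).
(* [b * bt b] is [b ^+ 2 / (1 + b ^+ 2)]: nonnegative, and zero only where [b] is, so the vanishing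
   integral kills both defects. *)
have p (b : R -> R) m : 0 <= b m * bt b m.
  by rewrite /bt mulrA mulr_ge0 ?invr_ge0 ?(ltW (bpos b m))// -expr2 sqr_ge0.
have p0 (b : R -> R) m : b m * bt b m = 0 -> b m = 0.
  move=> /eqP; rewrite /bt mulrA mulf_eq0 invr_eq0 (gt_eqF (bpos b m)) orbF -expr2 sqrf_eq0.
  by move/eqP.
have := Rintegral_eq0_ae (measurable_oo 0 1) i _ e; move=> h.
have {h} : {ae mu, forall m, `](0 : R), 1[%classic m -> bL m * v (L, m) * m + b0 m * v (0, m) * m = 0}.
  apply: h => m; rewrite /= in_itv/= vL v0 => /andP[m0 _].
  by rewrite addr_ge0// mulr_ge0 ?p// ltW.
apply: ae_imp => m h m01; have := h; rewrite /= in_itv/= vL v0 => /(_ m01) e0.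
have /andP[m0 _] := m01.
have h1 : 0 <= bL m * bt bL m * m by rewrite mulr_ge0 ?p// ltW.
have h2 : 0 <= b0 m * bt b0 m * m by rewrite mulr_ge0 ?p// ltW.
have /eqP e1 : bL m * bt bL m * m = 0 by lra.
have /eqP e2 : b0 m * bt b0 m * m = 0 by lra.
move: e1 e2; rewrite !mulf_eq0 (gt_eqF m0) !orbF -!mulf_eq0 => /eqP /p0 e1 /eqP /p0 e2.
by move: e1 e2; rewrite /bL /b0; split; lra.
Qed.
End Regularity.

(** * Discrete functions *)

Section PiecewisePoly.
Context (R : realType).
Local Notation mu := (@lebesgue_measure R).

(* Covers both [pev] and [pdz], whose exponents in [z] are [i] and [i.-1]. *)
Definition gev a b (d : 'I_a -> 'I_b -> R) (e : 'I_a -> nat) (z m : R) : R :=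
  \sum_(i < a) \sum_(j < b) d i j * z ^+ e i * m ^+ j.

Lemma measurable_gev a b (d : 'I_a -> 'I_b -> R) e D :
  measurable_fun D (fun x : R * R => gev d e x.1 x.2).
Proof.
apply: measurable_funTS; apply: measurable_sum => i; apply: measurable_sum => j.
apply: measurable_funM; last by apply: measurable_funX; exact: measurable_snd.
by apply: measurable_funM => //; apply: measurable_funX; exact: measurable_fst.
Qed.

Lemma measurable_gev_m a b (d : 'I_a -> 'I_b -> R) e z D :
  measurable_fun D (fun m : R => gev d e z m).
Proof.
apply: measurable_funTS; apply: measurable_sum => i; apply: measurable_sum => j.
by apply: measurable_funM => //; apply: measurable_funX; exact: measurable_id.
Qed.

Lemma gev_bounded a b (d : 'I_a -> 'I_b -> R) e (L : R) : exists B : R,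
  forall z m, 0 <= z <= L -> 0 <= m <= 1 -> `|gev d e z m| <= B.
Proof.
exists (\sum_(i < a) \sum_(j < b) `|d i j| * L ^+ e i) => z m /andP[z0 zL] /andP[m0 m1].
apply: (le_trans (ler_norm_sum _ _ _)); apply: ler_sum => i _.
apply: (le_trans (ler_norm_sum _ _ _)); apply: ler_sum => j _.
rewrite !normrM !normrX (ger0_norm z0) (ger0_norm m0) -[leRHS]mulr1.
apply: ler_pM; [by rewrite mulr_ge0 ?exprn_ge0|exact: exprn_ge0| |exact: exprn_ile1].
by apply: ler_wpM2l => //; apply: lerXn2r; rewrite ?nnegrE// (le_trans z0).
Qed.

(** The restriction to a line as a polynomial in [z] alone, to which the one-dimensional
    inequalities apply. *)
Definition polz a b (c : 'M[R]_(a, b)) (m : R) : {poly R} :=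
  \sum_(i < a) (\sum_(j < b) c i j * m ^+ j) *: 'X^i.

Lemma horner_polz a b (c : 'M[R]_(a, b)) m z : (polz c m).[z] = pev R c z m.
Proof.
rewrite /polz horner_sum; apply: eq_bigr => i _; rewrite hornerZ hornerXn mulr_suml.
by apply: eq_bigr => j _; rewrite mulrAC.
Qed.

Lemma horner_deriv_polz a b (c : 'M[R]_(a, b)) m z : (polz c m)^`().[z] = pdz R c z m.
Proof.
rewrite /polz raddf_sum/= horner_sum; apply: eq_bigr => i _.
rewrite derivZ derivXn hornerZ hornerMn hornerXn mulr_suml.
by apply: eq_bigr => j _; rewrite -mulr_natl; ring.
Qed.

Lemma size_polz a b (c : 'M[R]_(a, b)) m : (size (polz c m) <= a)%N.
Proof.
apply: (leq_trans (size_sum _ _ _)); apply/bigmax_leqP => i _.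
by apply: (leq_trans (size_scale_leq _ _)); rewrite size_polyXn.
Qed.

Lemma size_deriv_polz a b (c : 'M[R]_(a.+1, b)) m : (size (polz c m)^`() <= a)%N.
Proof.
apply: (leq_trans (size_poly _ _)).
by have := size_polz c m; case: (size _).
Qed.

Lemma AC1_pev a b (c : 'M[R]_(a, b)) m z1 z2 :
  AC1 z1 z2 (fun z => pev R c z m) (fun z => pdz R c z m).
Proof.
have := AC1_poly z1 z2 (polz c m).
congr AC1; apply/funext => z; [exact: horner_polz|exact: horner_deriv_polz].
Qed.

Variables (L : R) (st : R -> R) (M : mesh R) (kz km : nat).
Hypotheses (L0 : 0 < L) (hM : is_mesh L st M).
Implicit Types (c : coefs M kz km) (K : 'I_(nK R M)).

Lemma measurable_inK K : measurable_fun (Om L) (fun x : R * R => inK M K x).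
Proof.
rewrite /inK; apply: measurable_and; apply: measurable_and; apply: measurable_fun_ltr => //;
  apply: measurable_funTS => //; exact: measurable_fst.
Qed.

Lemma L2fun_piecewise (h : 'I_(nK R M) -> R * R -> R) :
  (forall K, measurable_fun (Om L) (h K)) ->
  (forall K, exists B : R, forall x, Om L x -> `|h K x| <= B) ->
  L2fun L (fun x => \sum_(K | inK M K x) h K x).
Proof.
move=> mh hB; pose B K := xget 0 [set B : R | forall x, Om L x -> `|h K x| <= B].
have BP K x : Om L x -> `|h K x| <= B K.
  have [B0 hB0] := hB K; have := @xgetI _ 0 [set B : R | forall x, Om L x -> `|h K x| <= B] B0 hB0.
  exact.
apply: (L2_bounded (measurable_Om L) (B := \sum_K B K)) => /=.
- exact: lam2_Om_fin.
- have : measurable_fun (Om L) (fun x => \sum_K (if inK M K x then h K x else 0)).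
    apply: measurable_sum => K; apply: measurable_fun_if => //.
    + exact: measurable_Om.
    + exact: measurable_inK.
    + by apply: measurable_funS (mh K) => //; exact: measurable_Om.
  by apply: eq_measurable_fun => x _; rewrite -big_mkcond.
- move=> x Ox; rewrite big_mkcond/=; apply: (le_trans (ler_norm_sum _ _ _)).
  apply: ler_sum => K _; case: ifP => _; first exact: BP.
  by rewrite normr0 (le_trans _ (BP K x Ox)).
Qed.

Let Om_le x : Om L x -> 0 <= x.1 <= L /\ 0 <= x.2 <= 1.
Proof. by move=> [/andP[? ?] /andP[? ?]]; rewrite !ltW. Qed.

Lemma L2fun_ph c : L2fun L (ph M kz km c).
Proof.
apply: L2fun_piecewise => K; first exact: measurable_gev.
have [B hB] := gev_bounded (c K) (@nat_of_ord _) L; exists B => x /Om_le[h1 h2].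
exact: hB.
Qed.

Lemma L2fun_dph c : L2fun L (dph M kz km c).
Proof.
apply: L2fun_piecewise => K; first exact: measurable_gev.
have [B hB] := gev_bounded (fun i j => c K i j * i%:R) (fun i => i.-1) L.
by exists B => x /Om_le[h1 h2]; exact: hB.
Qed.

Lemma Tr_gev a b (d : 'I_a -> 'I_b -> R) e z : 0 <= z <= L -> Tr (gev d e z).
Proof.
move=> z0L; have [B hB] := gev_bounded d e L; apply: (@Tr_bounded R _ B).
  exact: measurable_gev_m.
by move=> m /andP[m0 m1]; apply: hB => //; rewrite !ltW.
Qed.

Lemma Tr_cond (f : R -> R) b t : Tr f -> Tr (fun m => if b < m < t then f m else 0).
Proof.
move=> f2; have cm : measurable_fun `](0 : R), 1[ (fun m : R => b < m < t).
  by apply: measurable_and; apply: measurable_fun_ltr => //; exact: measurable_id.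
apply: (L2_le (measurable_oo 0 1) _ f2).
  have : measurable_fun `](0 : R), 1[ (fun m => if b < m < t then Num.sqrt m * f m else 0).
    by apply: measurable_fun_if => //; case: f2 => mf _; apply: measurable_funS mf.
  by apply: eq_measurable_fun => m _; case: ifP; rewrite ?mulr0.
by move=> m _; case: ifP => //; rewrite mulr0 normr0.
Qed.

Lemma Tr0 : Tr (fun=> 0 : R).
Proof. by apply: (@Tr_bounded R _ 0) => // m _; rewrite normr0. Qed.

Lemma Tr_sum (I : Type) (s : seq I) (P : pred I) (h : I -> R -> R) :
  (forall i, P i -> Tr (h i)) -> Tr (fun m => \sum_(i <- s | P i) h i m).
Proof.
move=> hT; elim: s => [|i s IH].
  have -> : (fun m => \sum_(i <- [::] | P i) h i m) = (fun=> 0 : R); last exact: Tr0.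
  by apply/funext => m; rewrite big_nil.
have [Pi|nPi] := boolP (P i).
  have -> : (fun m => \sum_(i <- i :: s | P i) h i m) =
      (fun m => h i m + \sum_(i <- s | P i) h i m).
    by apply/funext => m; rewrite big_cons Pi.
  by apply: TrD => //; exact: hT.
have -> : (fun m => \sum_(i <- i :: s | P i) h i m) =
    (fun m => \sum_(i <- s | P i) h i m) => //.
by apply/funext => m; rewrite big_cons (negbTE nPi).
Qed.

Let Tr_pw (P : pred 'I_(nK R M)) (h : 'I_(nK R M) -> R -> R) : (forall K, P K -> Tr (h K)) ->
  Tr (fun m => \sum_(K | P K && onK m K) h K m).
Proof.
move=> hT; have -> : (fun m => \sum_(K | P K && onK m K) h K m) =
   (fun m => \sum_(K | P K) (if ml R M K < m < mr R M K then h K m else 0)).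
  by apply/funext => m; rewrite -big_mkcondr.
by apply: Tr_sum => K PK; apply: Tr_cond; exact: hT.
Qed.

Lemma Tr_ph0 c : Tr (ph0 M kz km c).
Proof. by apply: Tr_pw => K _; apply: Tr_gev; rewrite lexx ltW. Qed.

Lemma Tr_phL c : Tr (phL L M kz km c).
Proof. by apply: Tr_pw => K _; apply: Tr_gev; rewrite lexx ltW. Qed.

Lemma zF_bounds K1 K2 : 0 <= zF M K1 K2 <= L.
Proof. by have [[? ? ?] _] := mesh_bounds hM K1; rewrite /zF; apply/andP; split; lra. Qed.

Lemma face_bounds K1 K2 : 0 <= bF M K1 K2 /\ tF M K1 K2 <= 1.
Proof.
have [_ [h1 h2 h3]] := mesh_bounds hM K1.
by rewrite /bF /tF le_max ge_min h1 h3.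
Qed.

(** The part from [V] has a single value on the face and cancels. *)
Lemma bjumpE (v : R * R -> R) c K1 K2 m : bjump M kz km v c K1 K2 m =
  pev R (c K1) (zF M K1 K2) m - pev R (c K2) (zF M K1 K2) m.
Proof. by rewrite /bjump; ring. Qed.

Lemma Tr_jump v c K1 K2 : Tr (bjump M kz km v c K1 K2).
Proof.
have -> : bjump M kz km v c K1 K2 = (fun m => pev R (c K1) (zF M K1 K2) m - pev R (c K2) (zF M K1 K2) m).
  by apply/funext => m; rewrite bjumpE.
by apply: TrB; apply: Tr_gev; exact: zF_bounds.
Qed.

Lemma Tr_scale (k : R) (f : R -> R) : Tr f -> Tr (fun m => k * f m).
Proof.
move=> f2; apply: (L2_eq (measurable_oo 0 1) _ (L2_scale (measurable_oo 0 1) k f2)) => m _.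
by rewrite mulrCA.
Qed.

Lemma Tr_mulm (f : R -> R) : Tr f -> Tr (fun m => m * f m).
Proof.
move=> f2; apply: (L2_le (measurable_oo 0 1) _ f2).
  have : measurable_fun `](0 : R), 1[ (fun m => m * (Num.sqrt m * f m)).
    by apply: measurable_funM; [exact: measurable_id|case: f2].
  by apply: eq_measurable_fun => m _; rewrite mulrCA.
move=> m; rewrite /= in_itv/= => /andP[m0 m1]; rewrite mulrCA normrM ler_piMl//.
by rewrite ger0_norm ltW.
Qed.

Lemma Tr_avgflux q c K1 K2 : Tr (fun m => q (zF M K1 K2, m)) ->
  Tr (bavgflux st M kz km q c K1 K2).
Proof.
move=> tq; have tp K : Tr (fun m => m / sigK st M K * pdz R (c K) (zF M K1 K2) m).
  have -> : (fun m => m / sigK st M K * pdz R (c K) (zF M K1 K2) m) =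
    (fun m => (sigK st M K)^-1 * (m * pdz R (c K) (zF M K1 K2) m)).
    by apply/funext => m; ring.
  by apply/Tr_scale/Tr_mulm; apply: Tr_gev; exact: zF_bounds.
have -> : bavgflux st M kz km q c K1 K2 = (fun m => 2^-1 *
   ((q (zF M K1 K2, m) + m / sigK st M K1 * pdz R (c K1) (zF M K1 K2) m)
   + (q (zF M K1 K2, m) + m / sigK st M K2 * pdz R (c K2) (zF M K1 K2) m))).
  by apply/funext => m; rewrite /bavgflux mulrC.
by apply: Tr_scale; apply: TrD; apply: TrD.
Qed.

Lemma int1_slice m (h : 'I_(nK R M) -> R -> R) :
  (forall K, onK m K -> I1 (zl R M K) (zr R M K) (h K)) ->
  int1 0 L (fun z => \sum_(K | inK M K (z, m)) h K z) =
  \sum_(K | onK m K) int1 (zl R M K) (zr R M K) (h K).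
Proof.
move=> hi; transitivity (int1 0 L (fun z =>
   \sum_(K | onK m K) (if zl R M K < z < zr R M K then h K z else 0))).
  by apply: eq_int1 => z _; rewrite -big_mkcondr; apply: eq_bigl => K; rewrite andbC.
have [|-> _] := @int1_sum R _ (onK m) 0 L
    (fun K z => if zl R M K < z < zr R M K then h K z else 0).
  by move=> K mK; have [[? ? ?] _] := mesh_bounds hM K; apply: I1_cond => //; exact: hi.
apply: eq_bigr => K mK; have [[? ? ?] _] := mesh_bounds hM K.
by rewrite -(int1_cond _ _ _).
Qed.

(** Faces have varying extent in [mu]; indicators put them all under one integral over [(0, 1)],
    where they can be compared line by line. *)
Lemma sumF_int (w : 'I_(nK R M) -> 'I_(nK R M) -> R -> R) :
  (forall K1 K2, I1 0 1 (fun m => w K1 K2 m * m)) ->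
  sumF R (M := M) (fun K1 K2 => intF M K1 K2 (w K1 K2)) =
  int1 0 1 (fun m => \sum_K1 \sum_(K2 | isF M K1 K2)
     (if bF M K1 K2 < m < tF M K1 K2 then w K1 K2 m * m else 0)) /\
  I1 0 1 (fun m => \sum_K1 \sum_(K2 | isF M K1 K2)
     (if bF M K1 K2 < m < tF M K1 K2 then w K1 K2 m * m else 0)).
Proof.
move=> wi.
have wi' K1 K2 : I1 0 1 (fun m => if bF M K1 K2 < m < tF M K1 K2 then w K1 K2 m * m else 0).
  by have [h1 h2] := face_bounds K1 K2; apply: I1_cond => //; exact: I1_sub (wi K1 K2).
have S K1 := @int1_sum R _ (isF M K1) 0 1 (fun K2 m =>
  if bF M K1 K2 < m < tF M K1 K2 then w K1 K2 m * m else 0) (fun K2 _ => wi' K1 K2).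
have [S1 S2] := @int1_sum R _ predT 0 1 (fun K1 m => \sum_(K2 | isF M K1 K2)
  (if bF M K1 K2 < m < tF M K1 K2 then w K1 K2 m * m else 0)) (fun K1 _ => (S K1).2).
split => //; rewrite S1; apply: eq_bigr => K1 _; rewrite (S K1).1.
apply: eq_bigr => K2 _; have [h1 h2] := face_bounds K1 K2.
by rewrite /intF (int1_cond _ h1 h2).
Qed.

(** Integration by parts on every cell of a generic line, followed by [sum_faces]. Since [q] is
    absolutely continuous across faces, only jumps of the discrete function appear, and the factor
    [mu] of the volume terms becomes the weight in [intF]. *)
Lemma discrete_green q dq c : isV L q dq ->
  int2 (Om L) (fun x => q x * (x.2 * dph M kz km c x))
  + int2 (Om L) (fun x => x.2 * dq x * ph M kz km c x) =
  sumF R (M := M) (fun K1 K2 => intF M K1 K2 (fun m => q (zF M K1 K2, m) * bjump M kz km (fun=> 0) c K1 K2 m))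
  + int1 0 1 (fun m => (q (L, m) * phL L M kz km c m - q (0, m) * ph0 M kz km c m) * m).
Proof.
move=> hq; have [q2 [_ [dq2 _]]] := hq.
have i1 : I2 L (fun x => q x * (x.2 * dph M kz km c x)).
  by apply: L2funM => //; apply: L2fun_x2; exact: L2fun_dph.
have i2 : I2 L (fun x => x.2 * dq x * ph M kz km c x).
  by apply: L2funM => //; exact: L2fun_ph.
rewrite -int2D//; have [j1 ->] := int2_fubini_m (I2D i1 i2).
have tq0 : Tr (fun m => q (0, m)) by apply: (Tr_trace L0 hq); rewrite lexx ltW.
have tqL : Tr (fun m => q (L, m)) by apply: (Tr_trace L0 hq); rewrite lexx ltW.
have [|-> j2] := @sumF_int (fun K1 K2 m => q (zF M K1 K2, m) * bjump M kz km (fun=> 0) c K1 K2 m).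
  move=> K1 K2; apply: TrM; last exact: Tr_jump.
  by apply: (Tr_trace L0 hq); exact: zF_bounds.
have j3 : I1 0 1 (fun m => (q (L, m) * phL L M kz km c m - q (0, m) * ph0 M kz km c m) * m).
  apply: eq_I1 (integrable_sub (measurable_oo 0 1) (TrM tqL (Tr_phL c)) (TrM tq0 (Tr_ph0 c))) => m _.
  by rewrite /=; ring.
rewrite -int1D//; apply: (Rintegral_ae_eq (measurable_oo 0 1)).
- exact: I1_measurable j1.
- by apply: measurable_funD; [exact: I1_measurable j2|exact: I1_measurable j3].
have := ae_generic M; apply: ae_imp => m gm; rewrite /= in_itv/= => m01.
have ibp K : [/\ I1 (zl R M K) (zr R M K) (fun z => dq (z, m) * pev R (c K) z m),
    I1 (zl R M K) (zr R M K) (fun z => q (z, m) * pdz R (c K) z m) &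
    int1 (zl R M K) (zr R M K) (fun z => dq (z, m) * pev R (c K) z m + q (z, m) * pdz R (c K) z m) =
    q (zr R M K, m) * pev R (c K) (zr R M K) m - q (zl R M K, m) * pev R (c K) (zl R M K) m].
  have [[h1 h2 h3] _] := mesh_bounds hM K.
  exact: (AC1_ibp (ltW h2) (AC1_sub h1 h3 (isV_AC1 hq m01)) (AC1_pev (c K) m _ _)).
have ii K : I1 (zl R M K) (zr R M K)
    (fun z => dq (z, m) * pev R (c K) z m + q (z, m) * pdz R (c K) z m).
  by have [k1 k2 _] := ibp K; exact: (integrable_add (measurable_oo _ _) k1 k2).
transitivity (int1 0 L (fun z => \sum_(K | inK M K (z, m))
    m * (dq (z, m) * pev R (c K) z m + q (z, m) * pdz R (c K) z m))).
  apply: eq_int1 => z _; rewrite /dph /ph/= !mulr_sumr -big_split/=.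
  by apply: eq_bigr => K _; ring.
rewrite int1_slice; last by move=> K _; exact: (integrable_scale (measurable_oo _ _) m (ii K)).
transitivity (m * \sum_(K | onK m K) (q (zr R M K, m) * pev R (c K) (zr R M K) m
    - q (zl R M K, m) * pev R (c K) (zl R M K) m)).
  rewrite mulr_sumr; apply: eq_bigr => K _; have [_ _ <-] := ibp K.
  by rewrite int1Z//; exact: I1_measurable (ii K).
rewrite (sum_faces hM (fun z => q (z, m)) (fun K => pev R (c K) (zl R M K) m)
   (fun K => pev R (c K) (zr R M K) m) gm m01).
rewrite /phL /ph0 mulrBr mulrDr -addrA; congr (_ + _); last first.
  by rewrite !mulr_sumr mulrBl !mulr_suml; congr (_ - _); apply: eq_big => // K /andP[/eqP-> _];
     rewrite mulrC.
rewrite mulr_sumr; apply: eq_bigr => K1 _; rewrite mulr_sumr; apply: eq_bigr => K2.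
move=> /and3P[_ /eqP e _]; case: ifP => _; last by rewrite mulr0.
by rewrite bjumpE /zF -e; ring.
Qed.

Variables (cs : R) (ss : R -> R).
Hypothesis hs : sigma_hyp L cs ss st.
Let st_pos z : 0 < z < L -> 0 < st z := st_gt0 hs (z := z).

Lemma sigK_gt0 K : 0 < sigK st M K.
Proof.
have [[? ? ?] _] := mesh_bounds hM K; apply: st_pos; apply/andP; split; lra.
Qed.

Lemma hK_gt0 K : 0 < hK M K.
Proof. by have [[? ? ?] _] := mesh_bounds hM K; rewrite /hK subr_gt0. Qed.

Lemma st_sigK K z : zl R M K < z < zr R M K -> st z = sigK st M K.
Proof.
have [_ [_ [_ h]]] := hM; have [s sE] := h K => zK; rewrite sE// /sigK sE//.
by have [[? ? ?] _] := mesh_bounds hM K; apply/andP; split; lra.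
Qed.

Lemma DF_gt0 K1 K2 : 0 < DF st M K1 K2.
Proof.
by rewrite /DF invr_gt0 addr_gt0// invr_gt0 mulr_gt0 ?sigK_gt0 ?hK_gt0.
Qed.

(** [DF] is [s1 * s2 / (s1 + s2)] with [s1], [s2] the products of [sigK] and [hK]; the two sides
    differ by a quarter of [(s1 * x - s2 * y) ^+ 2 / (s1 + s2)]. *)
Lemma DF_avg_le K1 K2 x y : DF st M K1 K2 * ((x + y) / 2) ^+ 2 <=
  4^-1 * (sigK st M K1 * hK M K1 * x ^+ 2 + sigK st M K2 * hK M K2 * y ^+ 2).
Proof.
rewrite /DF; set s1 := sigK st M K1 * _; set s2 := sigK st M K2 * _.
have s10 : 0 < s1 by rewrite mulr_gt0 ?sigK_gt0 ?hK_gt0.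
have s20 : 0 < s2 by rewrite mulr_gt0 ?sigK_gt0 ?hK_gt0.
have s0 : 0 < s1 + s2 by rewrite addr_gt0.
rewrite -subr_ge0.
have -> : 4^-1 * (s1 * x ^+ 2 + s2 * y ^+ 2) - (s1^-1 + s2^-1)^-1 * ((x + y) / 2) ^+ 2 =
   4^-1 * ((s1 * x - s2 * y) ^+ 2 / (s1 + s2)).
  by field; rewrite ?gt_eqF.
by rewrite mulr_ge0// divr_ge0 ?sqr_ge0// ltW.
Qed.

(** The [z]-derivative of a discrete function has degree at most [kz], one less than the function,
    hence the constant [Cdt kz]. *)
Lemma trace_pdz_le c K m : 0 < m < 1 ->
  let e := m ^+ 2 * (sigK st M K)^-1 *
     int1 (zl R M K) (zr R M K) (fun z => pdz R (c K) z m ^+ 2) in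
  sigK st M K * hK M K * (m / sigK st M K * pdz R (c K) (zl R M K) m) ^+ 2 <= Cdt kz * e /\
  sigK st M K * hK M K * (m / sigK st M K * pdz R (c K) (zr R M K) m) ^+ 2 <= Cdt kz * e.
Proof.
move=> /andP[m0 _] e; have [[_ h _] _] := mesh_bounds hM K.
have := discrete_trace h (size_deriv_polz (c K) m).
have -> : int1 (zl R M K) (zr R M K) (fun x => (polz (c K) m)^`().[x] ^+ 2) =
  int1 (zl R M K) (zr R M K) (fun z => pdz R (c K) z m ^+ 2).
  by apply: eq_int1 => z _; rewrite horner_deriv_polz.
rewrite !horner_deriv_polz -/(hK M K) /e; set E := int1 _ _ _.
have s0 := sigK_gt0 K; have k0 : 0 <= m ^+ 2 * (sigK st M K)^-1.
  by rewrite mulr_ge0 ?sqr_ge0// invr_ge0 ltW.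
have E1 x : sigK st M K * hK M K * (m / sigK st M K * x) ^+ 2 =
   m ^+ 2 * (sigK st M K)^-1 * (hK M K * x ^+ 2).
  by field; rewrite gt_eqF.
by move=> [h1 h2]; rewrite !E1 [leRHS]mulrCA [X in _ /\ _ <= X]mulrCA; split; apply: ler_wpM2l.
Qed.

(** On a line, averaging contributes 1/4 for each side of a face, the discrete trace inequality
    [Cdt kz], and an element borders at most two faces: together [2 * Cdt kz / 4]. *)
Lemma flux_bound c :
  sumF R (M := M) (fun K1 K2 => DF st M K1 K2 * intF M K1 K2 (fun m =>
     bavgflux st M kz km (fun=> 0) c K1 K2 m * bavgflux st M kz km (fun=> 0) c K1 K2 m)) <=
  Cdt kz / 2 * int2 (Om L) (fun x => (st x.1)^-1 * (x.2 * dph M kz km c x) * (x.2 * dph M kz km c x)).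
Proof.
have Tavg K1 K2 : Tr (bavgflux st M kz km (fun=> 0) c K1 K2) by apply: Tr_avgflux; exact: Tr0.
pose w K1 K2 m := DF st M K1 K2 * (bavgflux st M kz km (fun=> 0) c K1 K2 m *
  bavgflux st M kz km (fun=> 0) c K1 K2 m).
have wi K1 K2 : I1 0 1 (fun m => w K1 K2 m * m).
  apply: eq_I1 (integrable_scale (measurable_oo 0 1) (DF st M K1 K2) (TrM (Tavg K1 K2) (Tavg K1 K2))).
  by move=> m _; rewrite /w !mulrA.
have [e1 i1] := sumF_int wi.
have -> : sumF R (M := M) (fun K1 K2 => DF st M K1 K2 * intF M K1 K2 (fun m =>
     bavgflux st M kz km (fun=> 0) c K1 K2 m * bavgflux st M kz km (fun=> 0) c K1 K2 m)) =
   sumF R (M := M) (fun K1 K2 => intF M K1 K2 (w K1 K2)).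
  apply: eq_bigr => K1 _; apply: eq_bigr => K2 _; have [h1 h2] := face_bounds K1 K2.
  rewrite /intF -int1Z; first by apply: eq_int1 => m _; rewrite /w mulrA.
  by apply: I1_measurable; apply: I1_sub (TrM (Tavg K1 K2) (Tavg K1 K2)).
have d2 := L2fun_x2 (L2fun_dph c).
have [i2 ->] := int2_fubini_m (L2funM (L2fun_stV hs d2) d2).
rewrite e1 -int1Z; last exact: I1_measurable.
apply: le_int1 => //; first exact: (integrable_scale (measurable_oo 0 1)).
move=> m m01; have /andP[m0 m1] := m01.
pose e K := m ^+ 2 * (sigK st M K)^-1 *
     int1 (zl R M K) (zr R M K) (fun z => pdz R (c K) z m ^+ 2).
have pi K : I1 (zl R M K) (zr R M K) (fun z => pdz R (c K) z m ^+ 2).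
  apply: eq_I1 (L2_poly (zl R M K) (zr R M K) (polz (c K) m)^`()).2 => z _.
  by rewrite horner_deriv_polz.
have e0 K : 0 <= e K.
  apply: mulr_ge0; last by apply: int1_ge0 => z _; exact: sqr_ge0.
  by rewrite mulr_ge0 ?sqr_ge0// invr_ge0 ltW// sigK_gt0.
have -> : int1 0 L (fun z => (st (z, m).1)^-1 * ((z, m).2 * dph M kz km c (z, m)) *
   ((z, m).2 * dph M kz km c (z, m))) = \sum_(K | onK m K) e K.
  transitivity (int1 0 L (fun z => \sum_(K | inK M K (z, m))
      (m ^+ 2 * (sigK st M K)^-1 * pdz R (c K) z m ^+ 2))).
    apply: eq_int1 => z _ /=.
    have -> : (st z)^-1 * (m * dph M kz km c (z, m)) * (m * dph M kz km c (z, m)) =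
       (m ^+ 2 * (st z)^-1) * dph M kz km c (z, m) ^+ 2 by ring.
    rewrite /dph (sqr_sum_inK hM) mulr_sumr; apply: eq_bigr => K /andP[/= zK _].
    by rewrite (st_sigK zK).
  rewrite int1_slice; last by move=> K _; exact: (integrable_scale (measurable_oo _ _) _ (pi K)).
  by apply: eq_bigr => K _; rewrite int1Z//; exact: I1_measurable (pi K).
have C0 : 0 <= Cdt kz :> R by apply: le_trans (Cdt_ge1 _ _).
have := @sum_faces_le R L st M hM m (fun K => Cdt kz / 4 * e K).
rewrite -mulr_sumr => h.
have -> : Cdt kz / 2 * \sum_(K | onK m K) e K = 2 * (Cdt kz / 4 * \sum_(K | onK m K) e K) by field.
apply: le_trans (h _); last by move=> K; rewrite mulr_ge0// divr_ge0.
apply: ler_sum => K1 _; apply: ler_sum => K2 /and3P[_ /eqP e12 _]; case: ifP => // _.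
have [_ t1] := trace_pdz_le c K1 m01; have [t2 _] := trace_pdz_le c K2 m01.
have D0 := DF_gt0 K1 K2.
(* The weight [m <= 1] of the face integral is given away here; the factor [m ^+ 2] inside [e]
   belongs to the streaming energy. *)
apply: (@le_trans _ _ (w K1 K2 m)).
  by apply: ler_piMr; [rewrite /w mulr_ge0 ?(ltW D0)// -expr2 sqr_ge0|exact: ltW].
have -> : w K1 K2 m = DF st M K1 K2 * ((m / sigK st M K1 * pdz R (c K1) (zr R M K1) m +
    m / sigK st M K2 * pdz R (c K2) (zl R M K2) m) / 2) ^+ 2.
  by rewrite /w /bavgflux /zF -e12; ring.
apply: (le_trans (DF_avg_le _ _ _ _)); rewrite /e; lra.
Qed.
End PiecewisePoly.

(** * Energy and face forms *)

Section Form.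
Context (R : realType) (L c : R) (ss st : R -> R).
Hypotheses (L0 : 0 < L) (hs : sigma_hyp L c ss st).
Implicit Types (w v : R * R -> R).
Local Notation mu := (@lebesgue_measure R).

Lemma Pop_Pop v : Pop (Pop v) = Pop v.
Proof.
apply/funext => x; have := int1_cst (Pop v (x.1, 0)) (@ler01 R).
by rewrite subr0 mulr1.
Qed.

Lemma int2_ss_Pop w v : L2fun L w -> L2fun L v ->
  int2 (Om L) (fun x => ss x.1 * Pop w x * v x) =
  int1 0 L (fun z => ss z * Pop w (z, 0) * Pop v (z, 0)).
Proof.
move=> w2 v2; have i := L2funM (L2fun_ss hs (L2fun_Pop w2)) v2.
have [_ ->] := int2_fubini_z i; apply: eq_int1 => z z0L /=.
rewrite -int1Z; last exact: (measurable_slice_z v2.1 z0L).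
by apply: eq_int1 => m _.
Qed.

Lemma Pop_sym w v : L2fun L w -> L2fun L v ->
  int2 (Om L) (fun x => ss x.1 * Pop w x * v x) = int2 (Om L) (fun x => ss x.1 * Pop v x * w x).
Proof. by move=> w2 v2; rewrite !int2_ss_Pop//; apply: eq_int1 => z _; rewrite mulrAC. Qed.

(** [Pop] is an orthogonal projection in [mu] that commutes with functions of [z], so pairing
    [ss * (w - Pop w)] with [v - Pop v] or with [v] gives the same value. The right side displays
    the nonnegativity of the collision terms. *)
Lemma scattering_split w v : L2fun L w -> L2fun L v ->
  int2 (Om L) (fun x => st x.1 * w x * v x) - int2 (Om L) (fun x => ss x.1 * Pop w x * v x) =
  int2 (Om L) (fun x => (st x.1 - ss x.1) * w x * v x) +
  int2 (Om L) (fun x => ss x.1 * (w x - Pop w x) * (v x - Pop v x)).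
Proof.
move=> w2 v2; have Pw2 := L2fun_Pop w2; have Pv2 := L2fun_Pop v2.
have i1 := L2funM (L2fun_st hs w2) v2; have i2 := L2funM (L2fun_ss hs w2) v2.
have i3 := L2funM (L2fun_ss hs Pw2) v2; have i4 := L2funM (L2fun_ss hs Pv2) w2.
have i5 := L2funM (L2fun_ss hs Pw2) Pv2.
have -> : int2 (Om L) (fun x => (st x.1 - ss x.1) * w x * v x) =
   int2 (Om L) (fun x => st x.1 * w x * v x) - int2 (Om L) (fun x => ss x.1 * w x * v x).
  by rewrite -int2B//; apply: eq_int2 => x _; ring.
have -> : int2 (Om L) (fun x => ss x.1 * (w x - Pop w x) * (v x - Pop v x)) =
   int2 (Om L) (fun x => ss x.1 * w x * v x) - int2 (Om L) (fun x => ss x.1 * Pop w x * v x)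
   - (int2 (Om L) (fun x => ss x.1 * Pop v x * w x) - int2 (Om L) (fun x => ss x.1 * Pop w x * Pop v x)).
  rewrite -int2B// -int2B// -int2B//; [|exact: I2B|exact: I2B].
  by apply: eq_int2 => x _; ring.
have -> : int2 (Om L) (fun x => ss x.1 * Pop w x * Pop v x) = int2 (Om L) (fun x => ss x.1 * Pop v x * w x).
  by rewrite (Pop_sym w2 Pv2) Pop_Pop.
ring.
Qed.

(* Value, broken [z]-derivative and the traces at [z = 0] and [z = L]. *)
Record broken := Broken { bw : R * R -> R; bdw : R * R -> R; bw0 : R -> R; bwL : R -> R }.

Definition admissible (a : broken) := [/\ L2fun L (bw a), L2fun L (fun x => x.2 * bdw a x),
  Tr (bw0 a) & Tr (bwL a)].

Definition broken_add a b := Broken (fun x => bw a x + bw b x) (fun x => bdw a x + bdw b x)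
  (fun m => bw0 a m + bw0 b m) (fun m => bwL a m + bwL b m).

(** This is [aeh] when the arguments are built by [mkb]; the record lets one set of lemmas cover
    [V], the discrete space and their sums. *)
Definition energy (a b : broken) : R :=
  int2 (Om L) (fun x => (st x.1)^-1 * (x.2 * bdw a x) * (x.2 * bdw b x))
  + int2 (Om L) (fun x => st x.1 * bw a x * bw b x)
  - int2 (Om L) (fun x => ss x.1 * Pop (bw a) x * bw b x)
  + bnd (bw0 a) (bwL a) (bw0 b) (bwL b).

Lemma admissible_add a b : admissible a -> admissible b -> admissible (broken_add a b).
Proof.
move=> [a1 a2 a3 a4] [b1 b2 b3 b4]; split; [| |by apply: TrD..].
  exact: (L2_add (measurable_Om L) a1 b1).
apply: (L2_eq (measurable_Om L) _ (L2_add (measurable_Om L) a2 b2)) => x _ /=.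
by rewrite mulrDr.
Qed.

Lemma energy_sym a b : admissible a -> admissible b -> energy a b = energy b a.
Proof.
move=> [a1 a2 a3 a4] [b1 b2 b3 b4]; rewrite /energy (Pop_sym a1 b1).
congr (_ + _ - _ + _).
- by apply: eq_int2 => x _; rewrite mulrAC.
- by apply: eq_int2 => x _; rewrite mulrAC.
- by apply: eq_int1 => m _; ring.
Qed.

Lemma integrable_bnd a b : admissible a -> admissible b ->
  I1 0 1 (fun m => (bwL a m * bwL b m + bw0 a m * bw0 b m) * m).
Proof.
move=> [_ _ a3 a4] [_ _ b3 b4].
apply: eq_I1 (integrable_add (measurable_oo 0 1) (TrM a4 b4) (TrM a3 b3)) => m _.
by rewrite /=; ring.
Qed.

Lemma energy_addr a b b' : admissible a -> admissible b -> admissible b' ->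
  energy a (broken_add b b') = energy a b + energy a b'.
Proof.
move=> ha hb hb'; have [a1 a2 a3 a4] := ha; have [b1 b2 b3 b4] := hb.
have [b1' b2' b3' b4'] := hb'.
have e1 : int2 (Om L) (fun x => (st x.1)^-1 * (x.2 * bdw a x) * (x.2 * (bdw b x + bdw b' x))) =
   int2 (Om L) (fun x => (st x.1)^-1 * (x.2 * bdw a x) * (x.2 * bdw b x)) +
   int2 (Om L) (fun x => (st x.1)^-1 * (x.2 * bdw a x) * (x.2 * bdw b' x)).
  rewrite -int2D; first by apply: eq_int2 => x _; ring.
    exact: (L2funM (L2fun_stV hs a2) b2).
  exact: (L2funM (L2fun_stV hs a2) b2').
have e2 : int2 (Om L) (fun x => st x.1 * bw a x * (bw b x + bw b' x)) =
   int2 (Om L) (fun x => st x.1 * bw a x * bw b x) + int2 (Om L) (fun x => st x.1 * bw a x * bw b' x).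
  rewrite -int2D; first by apply: eq_int2 => x _; ring.
    exact: (L2funM (L2fun_st hs a1) b1).
  exact: (L2funM (L2fun_st hs a1) b1').
have e3 : int2 (Om L) (fun x => ss x.1 * Pop (bw a) x * (bw b x + bw b' x)) =
   int2 (Om L) (fun x => ss x.1 * Pop (bw a) x * bw b x) +
   int2 (Om L) (fun x => ss x.1 * Pop (bw a) x * bw b' x).
  have Pa := L2fun_Pop a1; rewrite -int2D; first by apply: eq_int2 => x _; ring.
    exact: (L2funM (L2fun_ss hs Pa) b1).
  exact: (L2funM (L2fun_ss hs Pa) b1').
have e4 : bnd (bw0 a) (bwL a) (bw0 (broken_add b b')) (bwL (broken_add b b')) =
   bnd (bw0 a) (bwL a) (bw0 b) (bwL b) + bnd (bw0 a) (bwL a) (bw0 b') (bwL b').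
  rewrite /bnd -int1D; [|exact: integrable_bnd|exact: integrable_bnd].
  by apply: eq_int1 => m _ /=; ring.
rewrite /energy e4 /= e1 e2 e3; ring.
Qed.

Lemma energy_addl a a' b : admissible a -> admissible a' -> admissible b ->
  energy (broken_add a a') b = energy a b + energy a' b.
Proof.
move=> ha ha' hb; rewrite energy_sym//; last exact: admissible_add.
by rewrite energy_addr// (energy_sym hb ha) (energy_sym hb ha').
Qed.

Definition streaming (a b : broken) : R :=
  int2 (Om L) (fun x => (st x.1)^-1 * (x.2 * bdw a x) * (x.2 * bdw b x)).

Lemma psd_weight (k : R * R -> R) (f g : R * R -> R) : measurable_fun (Om L) k ->
  (exists B : R, forall x, Om L x -> 0 <= k x <= B) -> L2fun L f -> L2fun L g ->
  psd (int2 (Om L) (fun x => k x * f x * f x)) (int2 (Om L) (fun x => k x * f x * g x))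
      (int2 (Om L) (fun x => k x * g x * g x)).
Proof.
move=> mk [B hB] f2 g2.
have kf h : L2fun L h -> L2fun L (fun x => Num.sqrt (k x) * h x).
  move=> h2; apply: (L2_bounded_mul (measurable_Om L) _ _ h2 (B := Num.sqrt B)).
    apply: measurableT_comp => //; apply: continuous_measurable_fun; exact: sqrt_continuous.
  by move=> x /hB /andP[_ kB]; rewrite ger0_norm ?sqrtr_ge0// ler_wsqrtr.
have := L2_psd (measurable_Om L) (kf f f2) (kf g g2).
congr psd; apply: eq_int2 => x /hB /andP[k0 _];
  have := sqr_sqrtr k0; set s := Num.sqrt (k x) => <-; ring.
Qed.

Lemma streaming_psd a b : admissible a -> admissible b ->
  psd (streaming a a) (streaming a b) (streaming b b).
Proof.
move=> [_ a2 _ _] [_ b2 _ _]; apply: psd_weight => //; first exact: (measurable_stV hs).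
have [B hB] := st_bounds hs; exists B => x Ox; have [_ _ h] := hB x Ox.
by rewrite (le_trans (ler_norm _) h) andbT invr_ge0 ltW// (st_gt0 hs)//; case: Ox.
Qed.

(** After [scattering_split] only forms with nonnegative weights remain: absorption, scattering
    deviation and the two boundary traces. Kept apart from [energy_psd] because it also shows that
    the streaming part is at most the energy, which turns [flux_bound] into a bound by the
    energy. *)
Lemma energy_minus_streaming_psd a b : admissible a -> admissible b ->
  psd (energy a a - streaming a a) (energy a b - streaming a b) (energy b b - streaming b b).
Proof.
move=> ha hb.
have E p r : admissible p -> admissible r -> energy p r - streaming p r =
   int2 (Om L) (fun x => (st x.1 - ss x.1) * bw p x * bw r x) +
   int2 (Om L) (fun x => ss x.1 * (bw p x - Pop (bw p) x) * (bw r x - Pop (bw r) x)) +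
   (int1 0 1 (fun m => bwL p m * bwL r m * m) + int1 0 1 (fun m => bw0 p m * bw0 r m * m)).
  move=> [p1 p2 p3 p4] [r1 r2 r3 r4]; rewrite -scattering_split// /energy /streaming /bnd.
  rewrite -int1D; [|exact: TrM|exact: TrM].
  have -> : int1 0 1 (fun m => (bwL p m * bwL r m + bw0 p m * bw0 r m) * m) =
     int1 0 1 (fun m => bwL p m * bwL r m * m + bw0 p m * bw0 r m * m).
    by apply: eq_int1 => m _; ring.
  ring.
rewrite !E//; have [a1 a2 a3 a4] := ha; have [b1 b2 b3 b4] := hb.
have [B hB] := st_bounds hs; have [_ [_ [_ [c0 hc]]]] := hs.
have T h k : Tr h -> Tr k -> psd (int1 0 1 (fun m => h m * h m * m))
    (int1 0 1 (fun m => h m * k m * m)) (int1 0 1 (fun m => k m * k m * m)).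
  by move=> h2 k2; exact: (Tr_psd (lexx 0) (lexx 1) h2 k2).
apply: psd_add; apply: psd_add; [| |exact: T|exact: T].
- apply: psd_weight => //.
    by apply: measurable_funB; [exact: (measurable_st hs)|exact: (measurable_ss hs)].
  exists (B + B) => x Ox; have [h1 h2 _] := hB x Ox; have [x0 _] := Ox; have [h3 h4] := hc _ x0.
  by have := ler_norm (st x.1); have := ler_norm (ss x.1) => ? ?; apply/andP; split; lra.
- apply: psd_weight.
  + exact: (measurable_ss hs).
  + exists B => x Ox; have [h1 h2 _] := hB x Ox; have [x0 _] := Ox; have [h3 h4] := hc _ x0.
    by rewrite h3 (le_trans (ler_norm _) h1).
  + by apply: (L2_sub (measurable_Om L)) => //; exact: L2fun_Pop.
  + by apply: (L2_sub (measurable_Om L)) => //; exact: L2fun_Pop.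
Qed.

Lemma energy_psd a b : admissible a -> admissible b ->
  psd (energy a a) (energy a b) (energy b b).
Proof.
move=> ha hb; have := psd_add (energy_minus_streaming_psd ha hb) (streaming_psd ha hb).
by rewrite !subrK.
Qed.
End Form.

Section FaceForms.
Context (R : realType).

(** Substituting [t / k] for [t] puts the weight [k] on one diagonal entry and its inverse on the
    other, leaving the coupling unweighted. *)
Lemma psd_rescale (k a b c : R) : 0 < k -> psd a b c -> psd (k * a) b (k^-1 * c).
Proof.
move=> k0 h t; have := mulr_ge0 (ltW k0) (h (t / k)).
have -> // : k * (a + 2 * (t / k) * b + (t / k) ^+ 2 * c) =
  k * a + 2 * t * b + t ^+ 2 * (k^-1 * c).
by field; rewrite gt_eqF.
Qed.

Variables (L : R) (st : R -> R) (M : mesh R).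
Hypotheses (hM : is_mesh L st M).
Local Notation face_fun := ('I_(nK R M) -> 'I_(nK R M) -> R -> R).
Implicit Types (f g : face_fun) (k : 'I_(nK R M) -> 'I_(nK R M) -> R).

Definition face_form k f g := sumF R (M := M) (fun K1 K2 =>
  k K1 K2 * intF M K1 K2 (fun m => f K1 K2 m * g K1 K2 m)).

Definition face_Tr f := forall K1 K2, Tr (f K1 K2).

Lemma face_formD k f f' g : face_Tr f -> face_Tr f' -> face_Tr g ->
  face_form k (fun K1 K2 m => f K1 K2 m + f' K1 K2 m) g = face_form k f g + face_form k f' g.
Proof.
move=> tf tf' tg; rewrite /face_form /sumF -big_split; apply: eq_bigr => K1 _.
rewrite -big_split; apply: eq_bigr => K2 _ /=; have [h1 h2] := face_bounds hM K1 K2.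
rewrite -mulrDr /intF -int1D; first by congr (_ * _); apply: eq_int1 => m _; ring.
  by apply: I1_sub (TrM (tf K1 K2) (tg K1 K2)).
by apply: I1_sub (TrM (tf' K1 K2) (tg K1 K2)).
Qed.

Lemma face_formC k f g : face_form k f g = face_form k g f.
Proof.
apply: eq_bigr => K1 _; apply: eq_bigr => K2 _; congr (_ * _).
by apply: eq_int1 => m _; rewrite [f _ _ _ * _]mulrC.
Qed.

Lemma face_form_addsqr k f g : face_Tr f -> face_Tr g ->
  face_form k (fun K1 K2 m => f K1 K2 m + g K1 K2 m) (fun K1 K2 m => f K1 K2 m + g K1 K2 m) =
  face_form k f f + 2 * face_form k f g + face_form k g g.
Proof.
move=> tf tg; have tfg : face_Tr (fun K1 K2 m => f K1 K2 m + g K1 K2 m).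
  by move=> K1 K2; exact: TrD.
have e h : face_Tr h -> face_form k h (fun K1 K2 m => f K1 K2 m + g K1 K2 m) =
  face_form k f h + face_form k g h by move=> th; rewrite face_formC face_formD.
by rewrite face_formD// !e// (face_formC k g f); ring.
Qed.

(** Serves with [k] equal to [DF] up to a constant: fluxes are measured with [DF], jumps with its
    inverse, while the coupling in [ah] carries no weight. *)
Lemma face_psd k f g : (forall K1 K2, 0 < k K1 K2) -> face_Tr f -> face_Tr g ->
  psd (face_form k f f) (face_form (fun _ _ => 1) f g) (face_form (fun K1 K2 => (k K1 K2)^-1) g g).
Proof.
move=> k0 tf tg; apply: psd_sum => K1 _; apply: psd_sum => K2 _; rewrite mul1r.
have [h1 h2] := face_bounds hM K1 K2.
exact: (psd_rescale (k0 K1 K2) (Tr_psd h1 h2 (tf K1 K2) (tg K1 K2))).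
Qed.

Lemma face_psd1 k f g : (forall K1 K2, 0 <= k K1 K2) -> face_Tr f -> face_Tr g ->
  psd (face_form k f f) (face_form k f g) (face_form k g g).
Proof.
move=> k0 tf tg; apply: psd_sum => K1 _; apply: psd_sum => K2 _.
have [h1 h2] := face_bounds hM K1 K2.
exact: (psd_scale (k0 K1 K2) (Tr_psd h1 h2 (tf K1 K2) (tg K1 K2))).
Qed.

Lemma face_formZ (x : R) k f g : face_form (fun K1 K2 => x * k K1 K2) f g = x * face_form k f g.
Proof.
rewrite /face_form /sumF mulr_sumr; apply: eq_bigr => K1 _.
by rewrite mulr_sumr; apply: eq_bigr => K2 _; rewrite mulrA.
Qed.
End FaceForms.

(** * The error estimate as an inequality between real numbers *)

Section Estimate.
Context (R : realType).

(* [w = u - v_h], [d = v_h - u_h]: [a] is the energy form, [J] the jump form, [S] the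
   weighted flux norm of [w], and [X1], [X2], [X3] the flux-jump couplings
   (flux w, jump d), (flux d, jump w), (flux d, jump d). *)
Lemma quasi_optimality (C alpha aww awd add Jww Jwd Jdd S F X1 X2 X3 : R) :
  1 <= C -> 1 / 2 + C <= alpha ->
  psd aww awd add -> psd Jww Jwd Jdd ->
  0 <= S -> F <= C / 2 * add ->
  X1 ^+ 2 <= S * (C * Jdd) -> X2 ^+ 2 <= F * Jww -> X3 ^+ 2 <= F * Jdd ->
  awd + add - (X1 + X3 + (X2 + X3)) + alpha * (Jwd + Jdd) = 0 ->
  Num.sqrt (aww + 2 * awd + add + (Jww + 2 * Jwd + Jdd)) <=
  (1 + 2 * (C + alpha)) * Num.sqrt (Num.sqrt (aww + Jww) ^+ 2 + S).
Proof.
move=> C1 aC pa pJ S0 Fle h1 h2 h3 orth.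
have [a0 d0 ad] := psd_sqr_le pa; have [j0 k0 jk] := psd_sqr_le pJ.
have [n0 m0 nm] := psd_sqr_le (psd_add pa pJ).
rewrite sqr_sqrtr//.
set ns := Num.sqrt (aww + Jww + S); set nd := Num.sqrt (add + Jdd); set nw := Num.sqrt (aww + Jww).
have ns0 : 0 <= ns := sqrtr_ge0 _; have nd0 : 0 <= nd := sqrtr_ge0 _.
have nw0 : 0 <= nw := sqrtr_ge0 _.
have ns2 : ns ^+ 2 = aww + Jww + S by rewrite sqr_sqrtr// addr_ge0.
have nd2 : nd ^+ 2 = add + Jdd by rewrite sqr_sqrtr.
have nw2 : nw ^+ 2 = aww + Jww by rewrite sqr_sqrtr.
have Ca : 0 <= C + alpha by lra.
(* Young's inequality bounds [2 * X3] by [add / 2 + C * Jdd]; the remaining [(alpha - C) * Jdd] is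
   at least [Jdd / 2] by the choice of [alpha]. *)
have coer : nd ^+ 2 / 2 <= add - 2 * X3 + alpha * Jdd.
  have X3le : 2 * X3 <= add / 2 + C * Jdd.
    have hh : X3 ^+ 2 <= C / 2 * add * Jdd by apply: (le_trans h3); apply: ler_wpM2r.
    have p0 : 0 <= add / 2 + C * Jdd by rewrite addr_ge0 ?mulr_ge0//; lra.
    apply: (le_trans (ler_norm _)); rewrite -(@ler_pXn2r _ 2)// ?nnegrE// real_normK ?num_real//.
    by have := sqr_ge0 (add / 2 - C * Jdd); nra.
  by rewrite nd2; nra.
(* Orthogonality identifies the left side with the coercive expression in [d] just bounded below. *)
have bound : - (awd - X1 - X2 + alpha * Jwd) <= (C + alpha) * (ns * nd).
  apply: (le_trans (ler_norm _)); rewrite normrN -(@ler_pXn2r _ 2)// ?nnegrE ?mulr_ge0//.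
  rewrite real_normK ?num_real// !exprMn ns2 nd2.
  pose ra := Num.sqrt aww; pose rd := Num.sqrt add; pose rj := Num.sqrt Jww.
  pose rk := Num.sqrt Jdd; pose rs := Num.sqrt S; pose rc := Num.sqrt C.
  have C0 : 0 <= C by lra.
  have [ra0 rd0 rj0] : [/\ 0 <= ra, 0 <= rd & 0 <= rj] by split; exact: sqrtr_ge0.
  have [rk0 rs0 rc0] : [/\ 0 <= rk, 0 <= rs & 0 <= rc] by split; exact: sqrtr_ge0.
  have ra2 : ra ^+ 2 = aww by rewrite sqr_sqrtr.
  have rd2 : rd ^+ 2 = add by rewrite sqr_sqrtr.
  have rj2 : rj ^+ 2 = Jww by rewrite sqr_sqrtr.
  have rk2 : rk ^+ 2 = Jdd by rewrite sqr_sqrtr.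
  have rs2 : rs ^+ 2 = S by rewrite sqr_sqrtr.
  have rc2 : rc ^+ 2 = C by rewrite sqr_sqrtr.
  have root (x y : R) : 0 <= y -> x ^+ 2 <= y ^+ 2 -> `|x| <= y.
    by move=> y0 xy; rewrite -(@ler_pXn2r _ 2)// ?nnegrE// real_normK ?num_real.
  have b1 : `|awd| <= ra * rd by apply: root; rewrite ?mulr_ge0// exprMn ra2 rd2.
  have b2 : `|Jwd| <= rj * rk by apply: root; rewrite ?mulr_ge0// exprMn rj2 rk2.
  have b3 : `|X1| <= rs * (rc * rk) by apply: root; rewrite ?mulr_ge0// !exprMn rs2 rc2 rk2.
  have b4 : `|X2| <= rc * rd * rj.
    apply: root; rewrite ?mulr_ge0// !exprMn rc2 rd2 rj2; apply: (le_trans h2).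
    apply: ler_wpM2r => //; apply: (le_trans Fle); apply: ler_wpM2r => //; lra.
  (* Grouping by the two parts of the norm of [d], [rd] for energy and [rk] for jumps, makes the
     bound a scalar product in the plane, ready for Cauchy-Schwarz. *)
  have T : `|awd - X1 - X2 + alpha * Jwd| <= (ra + rc * rj) * rd + (rs * rc + alpha * rj) * rk.
    apply: (le_trans (ler_normD _ _)).
    have t1 : `|awd - X1 - X2| <= `|awd| + `|X1| + `|X2|.
      by apply: (le_trans (ler_normB _ _)); rewrite lerD2r; exact: ler_normB.
    have t2 : `|alpha * Jwd| <= alpha * (rj * rk).
      by rewrite normrM ger0_norm; [apply: ler_wpM2l => //|]; lra.
    lra.
  have T0 : 0 <= (ra + rc * rj) * rd + (rs * rc + alpha * rj) * rk by apply: le_trans T.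
  rewrite -[leLHS]real_normK ?num_real//.
  apply: (@le_trans _ _ (((ra + rc * rj) * rd + (rs * rc + alpha * rj) * rk) ^+ 2)).
    by rewrite ler_pXn2r ?nnegrE.
  rewrite -rd2 -rk2; set p := ra + _; set r := rs * _ + _.
  apply: (@le_trans _ _ ((p ^+ 2 + r ^+ 2) * (rd ^+ 2 + rk ^+ 2))).
    by have := sqr_ge0 (p * rk - r * rd); nra.
  rewrite [leRHS]mulrA; apply: ler_wpM2r; first by rewrite addr_ge0 ?sqr_ge0.
  have p2 : p ^+ 2 <= 2 * aww + 2 * C * Jww.
    rewrite -ra2 -rc2 -rj2 /p; have := sqr_ge0 (ra - rc * rj); nra.
  have r2 : r ^+ 2 <= (C + alpha ^+ 2) * (S + Jww).
    rewrite -rs2 -rc2 -rj2 /r; have := sqr_ge0 (rc * rj - alpha * rs); nra.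
  (* These are the coefficients of [aww], [S] and [Jww] in what [(C + alpha) ^+ 2] leaves after the
     bounds on [p] and [r]; they are nonnegative since [C >= 1] and [alpha >= 3/2]. *)
  have q1 : 0 <= (C + alpha) ^+ 2 - 2 by nra.
  have q2 : 0 <= (C + alpha) ^+ 2 - (C + alpha ^+ 2) by nra.
  have q3 : 0 <= (C + alpha) ^+ 2 - (C + alpha ^+ 2) - 2 * C by nra.
  have := mulr_ge0 q1 a0; have := mulr_ge0 q2 S0; have := mulr_ge0 q3 j0; nra.
have ndle : nd <= 2 * (C + alpha) * ns.
  move: nd0; rewrite le_eqVlt => /predU1P[<-|ndp]; first by rewrite !mulr_ge0.
  rewrite -(ler_pM2r ndp) -expr2.
  have : nd ^+ 2 / 2 <= (C + alpha) * (ns * nd) by lra.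
  by lra.
have nws : nw <= ns by rewrite ler_wsqrtr// lerDl.
(* The error is [w + d]; what remains is the triangle inequality for the norm made of energy and
   jumps. *)
apply: (@le_trans _ _ (nw + nd)); last by lra.
rewrite -[leRHS]ger0_norm ?addr_ge0// -sqrtr_sqr ler_wsqrtr//.
have cs : awd + Jwd <= nw * nd.
  apply: (le_trans (ler_norm _)); rewrite -(@ler_pXn2r _ 2)// ?nnegrE ?mulr_ge0//.
  by rewrite real_normK ?num_real// exprMn nw2 nd2.
have -> : (nw + nd) ^+ 2 = nw ^+ 2 + nd ^+ 2 + 2 * (nw * nd) by ring.
by rewrite nw2 nd2; lra.
Qed.
End Estimate.

(** * Consistency and quasi-optimality *)

Section BrokenFunctions.
Context (R : realType) (L : R) (st : R -> R) (M : mesh R) (kz km : nat).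
Hypotheses (L0 : 0 < L) (hM : is_mesh L st M).
Implicit Types (c : coefs M kz km) (v dv q : R * R -> R).
Local Notation zero2 := (fun _ : R * R => (0 : R)).

Lemma pevD a b (c c' : 'M[R]_(a, b)) z m : pev R (c + c') z m = pev R c z m + pev R c' z m.
Proof.
rewrite /pev -big_split; apply: eq_bigr => i _; rewrite -big_split; apply: eq_bigr => j _ /=.
by rewrite mxE; ring.
Qed.

Lemma pdzD a b (c c' : 'M[R]_(a, b)) z m : pdz R (c + c') z m = pdz R c z m + pdz R c' z m.
Proof.
rewrite /pdz -big_split; apply: eq_bigr => i _; rewrite -big_split; apply: eq_bigr => j _ /=.
by rewrite mxE; ring.
Qed.

Lemma pev0 a b z m : pev R (0 : 'M[R]_(a, b)) z m = 0.
Proof. by rewrite /pev big1// => i _; rewrite big1// => j _; rewrite mxE !mul0r. Qed.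

Lemma pdz0 a b z m : pdz R (0 : 'M[R]_(a, b)) z m = 0.
Proof. by rewrite /pdz big1// => i _; rewrite big1// => j _; rewrite mxE !mul0r. Qed.

(** The data of the sum of [v] and the discrete function [c]; with coefficients [- uh] it represents
    the error. *)
Definition mkb v dv c : broken R := Broken (bval M kz km v c) (bdz M kz km dv c)
  (btr0 M kz km v c) (btrL L M kz km v c).

Lemma mkbD v dv c c' :
  broken_add (mkb v dv c) (mkb zero2 zero2 c') = mkb v dv (fun K => c K + c' K).
Proof.
rewrite /mkb /broken_add/=; congr Broken; apply/funext => x.
- rewrite /bval /ph add0r -addrA -big_split; congr (_ + _).
  by apply: eq_bigr => K _; rewrite pevD.
- rewrite /bdz /dph add0r -addrA -big_split; congr (_ + _).
  by apply: eq_bigr => K _; rewrite pdzD.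
- rewrite /btr0 /ph0 add0r -addrA -big_split; congr (_ + _).
  by apply: eq_bigr => K _; rewrite pevD.
- rewrite /btrL /phL add0r -addrA -big_split; congr (_ + _).
  by apply: eq_bigr => K _; rewrite pevD.
Qed.

Lemma mkb0 v dv : mkb v dv (fun=> 0) =
  Broken v dv (fun m => v (0, m)) (fun m => v (L, m)).
Proof.
rewrite /mkb; congr Broken; apply/funext => x.
- by rewrite /bval /ph big1 ?addr0// => K _; rewrite pev0.
- by rewrite /bdz /dph big1 ?addr0// => K _; rewrite pdz0.
- by rewrite /btr0 /ph0 big1 ?addr0// => K _; rewrite pev0.
- by rewrite /btrL /phL big1 ?addr0// => K _; rewrite pev0.
Qed.

Lemma mkb_discrete c : mkb zero2 zero2 c =
  Broken (ph M kz km c) (dph M kz km c) (ph0 M kz km c) (phL L M kz km c).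
Proof. by rewrite /mkb; congr Broken; apply/funext => x; rewrite /bval /bdz /btr0 /btrL add0r. Qed.

Lemma isV0 : isV L zero2 zero2.
Proof.
have z2 : L2fun L zero2.
  apply: (L2_bounded (measurable_Om L) (B := 0)); [exact: lam2_Om_fin|exact: measurable_cst|].
  by move=> x _; rewrite normr0.
split => //; split; first exact: measurable_cst; split.
  by apply: (L2_eq (measurable_Om L) _ z2) => x _; rewrite mulr0.
move=> m _; split; first exact: (I1_cst 0 L 0).
by move=> z1 z2' h1 h2 h3; rewrite int1_cst// mul0r subrr.
Qed.

Lemma admissible_mkb v dv c : isV L v dv -> admissible L (mkb v dv c).
Proof.
move=> hv; have [v2 [_ [dv2 _]]] := hv; split => /=.
- exact: (L2_add (measurable_Om L) v2 (L2fun_ph _ c)).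
- have := L2_add (measurable_Om L) dv2 (L2fun_x2 (L2fun_dph L c)).
  by apply: (L2_eq (measurable_Om L)) => x _; rewrite /bdz mulrDr.
- by apply: TrD; [apply: (Tr_trace L0 hv); rewrite lexx ltW|exact: Tr_ph0].
- by apply: TrD; [apply: (Tr_trace L0 hv); rewrite lexx ltW|exact: Tr_phL].
Qed.

Lemma bjumpD v c c' K1 K2 m : bjump M kz km v (fun K => c K + c' K) K1 K2 m =
  bjump M kz km v c K1 K2 m + bjump M kz km zero2 c' K1 K2 m.
Proof. by rewrite !bjumpE !pevD; ring. Qed.

Lemma bavgfluxD q c c' K1 K2 m : bavgflux st M kz km q (fun K => c K + c' K) K1 K2 m =
  bavgflux st M kz km q c K1 K2 m + bavgflux st M kz km zero2 c' K1 K2 m.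
Proof. by rewrite /bavgflux !pdzD; ring. Qed.

Lemma bjump0 v K1 K2 m : bjump M kz km v (fun=> 0) K1 K2 m = 0.
Proof. by rewrite bjumpE !pev0 subrr. Qed.

Lemma bavgflux0 q K1 K2 m : bavgflux st M kz km q (fun=> 0) K1 K2 m = q (zF M K1 K2, m).
Proof. by rewrite /bavgflux !pdz0 !mulr0 !addr0; field. Qed.
End BrokenFunctions.

Section QuasiOptimality.
Context (R : realType) (L c alpha : R) (ss st : R -> R) (M : mesh R) (kz km : nat).
Context (f : R * R -> R) (g0 gL : R -> R) (u du q dq : R * R -> R).
Hypotheses (L0 : 0 < L) (hs : sigma_hyp L c ss st) (hM : is_mesh L st M).
Hypotheses (f2 : L2fun L f) (hg : L2Gam g0 gL) (hu : isV L u du) (hq : isV L q dq).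
Hypothesis flux_ae : {ae lam2, forall x, Om L x -> flux st du x = q x}.
Hypothesis source_ae : {ae lam2, forall x, Om L x -> source ss st f u x = x.2 * dq x}.
Hypothesis trace_ae : {ae (@lebesgue_measure R), forall m, 0 < m < 1 ->
  q (L, m) + u (L, m) = gL m /\ u (0, m) - q (0, m) = g0 m}.
Local Notation zero2 := (fun _ : R * R => (0 : R)).
Local Notation mkb := (@mkb R L M kz km).
Local Notation energy := (energy L ss st).
Local Notation jump v c := (bjump M kz km v c).
Local Notation avg q c := (bavgflux st M kz km q c).
Local Notation form := (@face_form R M).
Implicit Types (d vh uh : coefs M kz km).

(** The jumps of [u] vanish, so of the face terms of [ah] only the flux of [u] against the jump of
    [d] survives. The discrete Green formula turns it, together with the streaming term, into source
    and boundary terms that the strong equation identifies. *)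
Lemma consistency d :
  energy (mkb u du (fun=> 0)) (mkb zero2 zero2 d)
  - form (fun _ _ => 1) (avg q (fun=> 0)) (jump zero2 d) =
  int2 (Om L) (fun x => f x * ph M kz km d x) + bnd g0 gL (ph0 M kz km d) (phL L M kz km d).
Proof.
rewrite mkb0 mkb_discrete /energy /Defs.bnd/=.
have u2 : L2fun L u by case: hu.
have p2 := L2fun_ph L d; have dp2 := L2fun_x2 (L2fun_dph L d).
have [q2 [_ [dq2 _]]] := hq.
have e1 : int2 (Om L) (fun x => (st x.1)^-1 * (x.2 * du x) * (x.2 * dph M kz km d x)) =
   int2 (Om L) (fun x => q x * (x.2 * dph M kz km d x)).
  apply: int2_ae_eq; last by apply: ae_imp flux_ae => x h /h <-.
    by apply: measurable_funM; [case: (L2fun_flux hs hu)|case: dp2].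
  by apply: measurable_funM; [case: q2|case: dp2].
have s2 := L2fun_source hs f2 hu.
have e2 : int2 (Om L) (fun x => source ss st f u x * ph M kz km d x) =
   int2 (Om L) (fun x => x.2 * dq x * ph M kz km d x).
  apply: int2_ae_eq; last by apply: ae_imp source_ae => x h /h ->.
    by apply: measurable_funM; [case: s2|case: p2].
  by apply: measurable_funM; [case: dq2|case: p2].
have e3 : int2 (Om L) (fun x => source ss st f u x * ph M kz km d x) =
   int2 (Om L) (fun x => st x.1 * u x * ph M kz km d x)
   - int2 (Om L) (fun x => ss x.1 * Pop u x * ph M kz km d x) - int2 (Om L) (fun x => f x * ph M kz km d x).
  have i1 := L2funM (L2fun_st hs u2) p2; have i2 := L2funM (L2fun_ss hs (L2fun_Pop u2)) p2.
  have i3 := L2funM f2 p2; rewrite -int2B// -int2B//; last exact: I2B.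
  by apply: eq_int2 => x _; rewrite /source; ring.
have e4 := discrete_green L0 hM d hq.
have e5 : form (fun _ _ => 1) (avg q (fun=> 0)) (jump zero2 d) =
  sumF R (M := M) (fun K1 K2 => intF M K1 K2 (fun m => q (zF M K1 K2, m) * jump zero2 d K1 K2 m)).
  apply: eq_bigr => K1 _; apply: eq_bigr => K2 _; rewrite mul1r.
  by apply: eq_int1 => m _; rewrite bavgflux0.
have z00 : 0 <= (0 : R) <= L by rewrite lexx ltW.
have zLL : 0 <= L <= L by rewrite lexx ltW.
have tp0 := Tr_ph0 L0 d; have tpL := Tr_phL L0 d.
have tu0 := Tr_trace L0 hu z00; have tuL := Tr_trace L0 hu zLL.
have tq0 := Tr_trace L0 hq z00; have tqL := Tr_trace L0 hq zLL.
have [tg0 tgL] := Tr_g hg.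
have ib a b : Tr a -> Tr b -> I1 0 1 (fun m => (a m * phL L M kz km d m + b m * ph0 M kz km d m) * m).
  move=> ta tb.
  apply: eq_I1 (integrable_add (measurable_oo 0 1) (TrM ta tpL) (TrM tb tp0)) => m _.
  by rewrite /=; ring.
have e6 : int1 0 1 (fun m => (q (L, m) * phL L M kz km d m - q (0, m) * ph0 M kz km d m) * m) +
   int1 0 1 (fun m => (u (L, m) * phL L M kz km d m + u (0, m) * ph0 M kz km d m) * m) =
   int1 0 1 (fun m => (gL m * phL L M kz km d m + g0 m * ph0 M kz km d m) * m).
  have -> : int1 0 1 (fun m => (q (L, m) * phL L M kz km d m - q (0, m) * ph0 M kz km d m) * m) =
     int1 0 1 (fun m => (q (L, m) * phL L M kz km d m + (- q (0, m)) * ph0 M kz km d m) * m).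
    by apply: eq_int1 => m _; ring.
  have j1 := ib _ _ tqL (TrN tq0); have j2 := ib _ _ tuL tu0.
  rewrite -int1D//; apply: (Rintegral_ae_eq (measurable_oo 0 1)).
  - by apply: measurable_funD; [exact: I1_measurable j1|exact: I1_measurable j2].
  - exact: (I1_measurable (ib _ _ tgL tg0)).
  - apply: ae_imp trace_ae => m h; rewrite /= in_itv/= => /h[<- <-]; ring.
move: e2 e4 e6; rewrite e3 e5 e1; lra.
Qed.

Lemma galerkin_estimate uh vh : 1 / 2 + Cdt kz <= alpha ->
  (forall d, ah L ss st M kz km alpha uh d =
    int2 (Om L) (fun x => f x * ph M kz km d x) + bnd g0 gL (ph0 M kz km d) (phL L M kz km d)) ->
  normVh L ss st M kz km u du (fun K => - uh K) <=
  (1 + 2 * (Cdt kz + alpha)) * normStar L ss st M kz km u du q (fun K => - vh K).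
Proof.
move=> aC hah; pose d : coefs M kz km := fun K => vh K - uh K.
have ceE : (fun K => - uh K) = (fun K => - vh K + d K) :> coefs M kz km.
  by apply/funext => K; rewrite /d addrA addNr add0r.
(* Writing the zero coefficients as [- uh + uh] splits [u] into error and discrete solution, so that
   additivity of the forms applies. *)
have c0E : (fun=> 0) = (fun K => - uh K + uh K) :> coefs M kz km.
  by apply/funext => K; rewrite addNr.
pose Bw := mkb u du (fun K => - vh K).
pose Bd := mkb zero2 zero2 d; pose Bu := mkb zero2 zero2 uh.
have aw : admissible L Bw by exact: admissible_mkb.
have ad : admissible L Bd by apply: admissible_mkb => //; exact: isV0.
have au : admissible L Bu by apply: admissible_mkb => //; exact: isV0.
pose D K1 K2 := DF st M K1 K2; have D0 K1 K2 : 0 < D K1 K2 by exact: (DF_gt0 hM hs).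
pose iD K1 K2 := (D K1 K2)^-1; have iD0 K1 K2 : 0 <= iD K1 K2 by rewrite invr_ge0 ltW.
pose jw := jump u (fun K => - vh K); pose jd := jump zero2 d; pose ju := jump zero2 uh.
pose fw := avg q (fun K => - vh K); pose fd := avg zero2 d; pose fu := avg zero2 uh.
have tq K1 K2 : Tr (fun m => q (zF M K1 K2, m)) by apply: (Tr_trace L0 hq); exact: (zF_bounds hM).
have tjw : face_Tr jw by move=> K1 K2; exact: (Tr_jump hM).
have tjd : face_Tr jd by move=> K1 K2; exact: (Tr_jump hM).
have tju : face_Tr ju by move=> K1 K2; exact: (Tr_jump hM).
have tfw : face_Tr fw by move=> K1 K2; apply: (Tr_avgflux hM); exact: tq.
have tfd : face_Tr fd by move=> K1 K2; apply: (Tr_avgflux hM); exact: Tr0.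
have tfu : face_Tr fu by move=> K1 K2; apply: (Tr_avgflux hM); exact: Tr0.
pose one := fun _ _ : 'I_(nK R M) => (1 : R).
have C1 : 1 <= Cdt kz :> R := Cdt_ge1 _ kz.
have Cp : 0 < Cdt kz :> R by apply: lt_le_trans C1.
have je : jump u (fun K => - uh K) = (fun K1 K2 m => jw K1 K2 m + jd K1 K2 m).
  by rewrite ceE; apply/funext => K1; apply/funext => K2; apply/funext => m; rewrite bjumpD.
have fe : avg q (fun K => - uh K) = (fun K1 K2 m => fw K1 K2 m + fd K1 K2 m).
  by rewrite ceE; apply/funext => K1; apply/funext => K2; apply/funext => m; rewrite bavgfluxD.
have Be : mkb u du (fun K => - uh K) = broken_add Bw Bd by rewrite mkbD -ceE.
(* Galerkin orthogonality: consistency minus the discrete equation, expanded along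
   [u = w + d + u_h]. *)
have orth : energy Bw Bd + energy Bd Bd
  - (form one fw jd + form one fd jd + (form one fd jw + form one fd jd))
  + alpha * (form iD jw jd + form iD jd jd) = 0.
  have h1 := consistency d; rewrite -hah /ah in h1.
  have E1 : energy (mkb u du (fun=> 0)) Bd = energy Bw Bd + energy Bd Bd + energy Bu Bd.
    rewrite {1}c0E -mkbD Be (energy_addl hs)//; last exact: admissible_add.
    by rewrite (energy_addl hs).
  have E2 : form one (avg q (fun=> 0)) jd = form one fw jd + form one fd jd + form one fu jd.
    have -> : avg q (fun=> 0) = (fun K1 K2 m => (fw K1 K2 m + fd K1 K2 m) + fu K1 K2 m).
      rewrite c0E; apply/funext => K1; apply/funext => K2; apply/funext => m.
      by rewrite bavgfluxD fe.
    rewrite (face_formD hM)//; first by rewrite (face_formD hM).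
    by move=> K1 K2; apply: TrD; [exact: tfw|exact: tfd].
  (* The jumps of [w], [d] and [u_h] add up to that of [u], which is zero; this supplies the
     symmetric and penalty terms of the error. *)
  have E3 k g : face_Tr g -> form k jw g + form k jd g + form k ju g = 0.
    move=> tg; rewrite -(face_formD hM)// -(face_formD hM)//; last first.
      by move=> K1 K2; apply: TrD; [exact: tjw|exact: tjd].
    have z K1 K2 m : jw K1 K2 m + jd K1 K2 m + ju K1 K2 m = 0.
      have := bjump0 kz km u K1 K2 m; rewrite c0E bjumpD.
      by have := congr1 (fun h => h K1 K2 m) je => /= ->.
    rewrite /face_form /sumF big1// => K1 _; rewrite big1// => K2 _.
    rewrite /intF (@eq_int1 _ _ _ _ (fun=> 0)).
      by rewrite (_ : int1 _ _ _ = 0) ?mulr0//; rewrite [LHS]Rintegral_cst ?mul0r//.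
    by move=> m _; rewrite z !mul0r.
  have E4 : sumF R (M := M) (fun K1 K2 => intF M K1 K2 (fun m =>
        avg zero2 uh K1 K2 m * jump zero2 d K1 K2 m
      + avg zero2 d K1 K2 m * jump zero2 uh K1 K2 m)) = form one fu jd + form one fd ju.
    rewrite /face_form /sumF -big_split; apply: eq_bigr => K1 _.
    rewrite -big_split; apply: eq_bigr => K2 _ /=; rewrite /one !mul1r.
    have [b0 t1] := face_bounds hM K1 K2.
    rewrite /intF -int1D; first by apply: eq_int1 => m _; rewrite mulrDl.
      by apply: I1_sub (TrM (tfu K1 K2) (tjd K1 K2)).
    by apply: I1_sub (TrM (tfd K1 K2) (tju K1 K2)).
  have E5 : sumF R (M := M) (fun K1 K2 => alpha / DF st M K1 K2 * intF M K1 K2 (fun m =>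
        jump zero2 uh K1 K2 m * jump zero2 d K1 K2 m)) = alpha * form iD ju jd.
    by rewrite -face_formZ.
  have E6 : aeh L ss st M kz km zero2 zero2 uh zero2 zero2 d = energy Bu Bd by [].
  have h2 := E3 one fd tfd; have h3 := E3 iD jd tjd.
  rewrite ![form one _ fd]face_formC in h2.
  move: h1; rewrite E1 E2 E4 E5 E6 => h1.
  move: h1 h2 h3; move: (form iD jw jd) (form iD jd jd) (form iD ju jd) => x y z {E1 E2 E3 E4 E5 E6}.
  move: (form one fd jw) (form one fd jd) (form one fd ju) => ? ? ?.
  move: (form one fw jd) (form one fu jd) => ? ?.
  move: (energy Bw Bd) (energy Bd Bd) (energy Bu Bd) => ? ? ? h1 h2 h3.
  by have -> : x + y = - z; lra.
have Fb := flux_bound hM hs d.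
have [_ B0 _] := psd_sqr_le (energy_minus_streaming_psd hs aw ad).
have Fle : form D fd fd <= Cdt kz / 2 * energy Bd Bd.
  have E : streaming L st Bd Bd = int2 (Om L) (fun x => (st x.1)^-1 *
      (x.2 * dph M kz km d x) * (x.2 * dph M kz km d x)).
    by rewrite /Bd mkb_discrete.
  apply: (le_trans Fb); rewrite -E; apply: ler_wpM2l; first by lra.
  by rewrite -subr_ge0.
have [S0 _ X1] := psd_sqr_le (face_psd hM (fun K1 K2 => divr_gt0 (D0 K1 K2) Cp) tfw tjd).
have [_ _ X2] := psd_sqr_le (face_psd hM D0 tfd tjw).
have [_ _ X3] := psd_sqr_le (face_psd hM D0 tfd tjd).
(* The weight [D / Cdt kz] of the star norm is dual to [Cdt kz * iD] on the jumps, whence the factor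
   [Cdt kz] before the jump norm of [d]. *)
have X1' : form one fw jd ^+ 2 <= form (fun K1 K2 => D K1 K2 / Cdt kz) fw fw * (Cdt kz * form iD jd jd).
  rewrite -face_formZ; apply: (le_trans X1); rewrite le_eqVlt; apply/orP; left; apply/eqP.
  congr (_ * _); apply: eq_bigr => K1 _; apply: eq_bigr => K2 _; congr (_ * _).
  by rewrite /iD invf_div.
have pE := energy_psd hs aw ad; have pJ := face_psd1 hM iD0 tjw tjd.
have fin := quasi_optimality C1 aC pE pJ S0 Fle X1' X2 X3 orth.
have NE : aeh L ss st M kz km u du (fun K => - uh K) u du (fun K => - uh K) =
  energy Bw Bw + 2 * energy Bw Bd + energy Bd Bd.
  transitivity (energy (broken_add Bw Bd) (broken_add Bw Bd)); first by rewrite -Be.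
  rewrite (energy_addl hs)//; last exact: admissible_add.
  rewrite !(energy_addr hs)// (energy_sym hs ad aw); ring.
have NJ : sumF R (M := M) (fun K1 K2 => (DF st M K1 K2)^-1 *
    intF M K1 K2 (fun m => jump u (fun K => - uh K) K1 K2 m ^+ 2)) =
  form iD jw jw + 2 * form iD jw jd + form iD jd jd.
  transitivity (form iD (fun K1 K2 m => jw K1 K2 m + jd K1 K2 m)
      (fun K1 K2 m => jw K1 K2 m + jd K1 K2 m)); first by rewrite -je.
  exact: (face_form_addsqr hM).
have -> : normVh L ss st M kz km u du (fun K => - uh K) =
  Num.sqrt (energy Bw Bw + 2 * energy Bw Bd + energy Bd Bd
    + (form iD jw jw + 2 * form iD jw jd + form iD jd jd)) by rewrite /normVh NE NJ.
exact: fin.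
Qed.
End QuasiOptimality.

Theorem mainTheorem9 (R : realType) (L c alpha : R) (ss st : R -> R)
  (M : mesh R) (kz km : nat)
  (f : R * R -> R) (g0 gL : R -> R) (u du : R * R -> R) (uh : coefs M kz km) :
  0 < L ->
  sigma_hyp L c ss st ->
  is_mesh L st M ->
  L2fun L f -> L2Gam g0 gL ->
  isV L u du ->
  (forall v dv : R * R -> R, isV L v dv ->
     ae L ss st u du v dv
     = int2 (Om L) (fun x => f x * v x)
       + bnd g0 gL (fun m => v (0, m)) (fun m => v (L, m))) ->
  1 / 2 + Cdt kz <= alpha ->
  (forall vh : coefs M kz km,
     ah L ss st M kz km alpha uh vh
     = int2 (Om L) (fun x => f x * ph M kz km vh x)
       + bnd g0 gL (ph0 M kz km vh) (phL L M kz km vh)) ->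
  exists q dq : R * R -> R,
    isV L q dq /\
    {ae lam2, forall x, Om L x -> q x = x.2 / st x.1 * du x} /\
    normVh L ss st M kz km u du (fun K => - uh K)
      <= (1 + 2 * (Cdt kz + alpha)) *
         inf [set normStar L ss st M kz km u du q (fun K => - vh K)
             | vh in [set: coefs M kz km]].
Proof.
move=> L0 hs hM f2 hg hu weak aC hah.
have [q [dq [hq flux_ae source_ae]]] := flux_regularity L0 hs f2 hg hu weak.
have trace_ae := flux_boundary L0 hs f2 hg hu weak hq flux_ae source_ae.
exists q, dq; split => //; split.
  by apply: ae_imp flux_ae => x h Ox; rewrite -h// /flux; ring.
have C1 : 1 <= Cdt kz :> R := Cdt_ge1 _ kz.
have k0 : 0 < 1 + 2 * (Cdt kz + alpha) by lra.
(* With the positive constant moved to the other side, the claim is that the left side is a lower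
   bound; [uh] shows that the infimum runs over a nonempty set. *)
rewrite -ler_pdivrMl//; apply: lb_le_inf.
  by exists (normStar L ss st M kz km u du q (fun K => - uh K)), uh.
move=> _ [vh _ <-]; rewrite ler_pdivrMl//.
exact: (galerkin_estimate L0 hs hM f2 hg hu hq flux_ae source_ae trace_ae).
Qed.
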